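(* Let $d\ge 2$, let $\Omega\subseteq\mathbb{R}^d$ be an exterior domain with Lipschitz boundary and let $1<p<\infty$. Let $\partial\Omega$ be the disjoint union of sets $\Gamma_1,\Gamma_2$ with $\Gamma_1$ closed, and let $h\colon\Gamma_2\times\mathbb{R}\to\mathbb{R}$ be a Carathéodory function such that for every $w\in L^p(\Gamma_2)$ one has $h(\cdot,w)\in L^{p/(p-1)}(\Gamma_2)$ and $h(x,w(x))\,w(x)\ge 0$ for $\mathcal{H}$-a.e. $x\in\Gamma_2$. Suppose that $v$ is a positive weak solution of $$-\Delta_p v=0 \text{ in }\Omega,\qquad v=0\text{ on }\Gamma_1,\qquad |\nabla v|^{p-2}\frac{\partial v}{\partial\nu}+h(x,v)=0\text{ on }\Gamma_2,$$ such that $\lim_{|x|\to\infty}v(x)=0$. Then $v\equiv 0$.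
   Context: An exterior domain of $\mathbb{R}^d$ is a connected open set $\Omega\subseteq\mathbb{R}^d$ such that $\Omega^c=\mathbb{R}^d\setminus\Omega$ is compact and nonempty. $\nu$ is the outward pointing unit normal on $\partial\Omega$, $\mathcal{H}$ is the $(d-1)$-dimensional Hausdorff measure on $\partial\Omega$, and $\Delta_p v=\operatorname{div}(|\nabla v|^{p-2}\nabla v)$. ''Positive'' means $v\ge 0$. Functions that are $p$-harmonic are taken to be in $W^{1,p}_{\mathrm{loc}}(\Omega)\cap C(\Omega)$ (continuous representative). Write $B_r=B(0,r)$ for the open ball and let $r_0>0$ be such that $\partial\Omega\subseteq B_r$ for all $r\ge r_0$. Define $$V^{1,p}(\Omega)=\{v\in W^{1,p}_{\mathrm{loc}}(\Omega): v\in W^{1,p}(\Omega\cap B_r)\text{ for all } r>r_0\},$$ with the topology given by the (semi)norms of $W^{1,p}(\Omega\cap B_r)$, $r>r_0$, and let $V^{1,p}_{\Gamma_1}(\Omega)$ be the closure in $V^{1,p}(\Omega)$ of the subspace $\{v\in V^{1,p}(\Omega): v=0\text{ in a neighbourhood of }\Gamma_1\}$. A function $v$ is a weak solution of the boundary value problem if $v\in V^{1,p}_{\Gamma_1}(\Omega)$ and $$\int_\Omega |\nabla v|^{p-2}\nabla v\cdot\nabla\varphi\,dx+\int_{\Gamma_2}h(x,v)\,\varphi\,d\mathcal{H}=0$$ for every $\varphi\in V^{1,p}_{\Gamma_1}(\Omega)$ with $\operatorname{supp}(\varphi)\subseteq B_r$ for some $r>r_0$ (boundary values in the sense of traces). 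*)

(* Defs.v *)
From HB Require Import structures.
From mathcomp Require Import all_boot all_order all_algebra.
From mathcomp Require Import all_classical all_reals all_analysis.
Set Implicit Arguments.
Unset Strict Implicit.
Unset Printing Implicit Defensive.
Import Order.TTheory GRing.Theory Num.Theory.
Import numFieldNormedType.Exports.

Local Open Scope classical_set_scope.
Local Open Scope ring_scope.

(* The library norm of 'rV[R]_d is the sup norm: it has the Euclidean topology,
   but balls, diameters and |grad u| have to be Euclidean. *)
Definition dotv (R : realType) (d : nat) (x y : 'rV[R]_d) : R :=
  \sum_(i < d) x 0 i * y 0 i.

Definition enorm (R : realType) (d : nat) (x : 'rV[R]_d) : R :=
  Num.sqrt (dotv x x).

Definition eball (R : realType) (d : nat) (r : R) : set 'rV[R]_d :=
  [set x | enorm x < r].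
Arguments eball {R d} r.

Definition boundary (T : topologicalType) (A : set T) : set T :=
  closure A `\` A°.

(* A copy of T in which every set is measurable: [mu_ext] over it is the
   outer measure generated by arbitrary countable coverings. *)
Definition anyset (T : Type) : Type := T.
HB.instance Definition _ (T : pointedType) := Pointed.on (anyset T).
HB.instance Definition _ (T : pointedType) := @isMeasurable.Build
  default_measure_display (anyset T) (@discrete_measurable T)
  (@discrete_measurable0 T) (@discrete_measurableC T) (@discrete_measurableU T).

Section covering_outer_measure.
Local Open Scope ereal_scope.
Context (R : realType) (T : pointedType).
Variable cost : set T -> \bar R.
Hypotheses (cost0 : cost set0 = 0) (cost_ge0 : forall A, 0 <= cost A).

Definition covering_outer : set T -> \bar R :=
  @mu_ext _ (anyset T) R cost.

Definition covering_is_outer : isOuterMeasure R T covering_outer :=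
  isOuterMeasure.Build R T covering_outer
    (@mu_ext0 _ (anyset T) R cost cost0 cost_ge0)
    (@mu_ext_ge0 _ (anyset T) R cost cost_ge0)
    (@le_mu_ext _ (anyset T) R cost)
    (@mu_ext_sigma_subadditive _ (anyset T) R cost cost_ge0).

End covering_outer_measure.

Section lebesgue.
Context (R : realType) (d : nat).

Definition box (a b : 'rV[R]_d) : set 'rV[R]_d :=
  [set x | forall i, a 0 i <= x 0 i < b 0 i].

(* +oo on the nonempty sets that are not boxes, as [ereal_inf set0 = +oo]. *)
Definition box_volume (A : set 'rV[R]_d) : \bar R :=
  if A == set0 then 0%E else
  ereal_inf [set (\prod_(i < d) (ab.2 0 i - ab.1 0 i))%:E
            | ab in [set ab : 'rV[R]_d * 'rV[R]_d |
                      (forall i, ab.1 0 i <= ab.2 0 i) /\ A = box ab.1 ab.2]].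

Lemma box_volume0 : box_volume set0 = 0%E.
Proof. by rewrite /box_volume eqxx. Qed.

Lemma box_volume_ge0 A : (0 <= box_volume A)%E.
Proof.
rewrite /box_volume; case: ifP => // _.
apply: le_ereal_inf_tmp => _ [[a b] /= [ab _] <-].
by rewrite lee_fin; apply: prodr_ge0 => i _; rewrite subr_ge0.
Qed.

Definition lebesgue_outer : {outer_measure set 'rV[R]_d -> \bar R} :=
  HB.pack (covering_outer box_volume)
    (covering_is_outer box_volume0 box_volume_ge0).

(* The measurable sets are the Caratheodory-measurable ones, that is the
   Lebesgue-measurable sets. *)
Definition leb :
    {measure set (caratheodory_type lebesgue_outer) -> \bar R} :=
  lebesgue_outer.

End lebesgue.

Section hausdorff.
Local Open Scope ereal_scope.
Context (R : realType) (d s : nat).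

Definition diam (A : set 'rV[R]_d) : \bar R :=
  ereal_sup [set (enorm (x - y))%:E | x in A & y in A].

Definition unit_ball_volume : R :=
  fine (leb R s (eball 1 : set 'rV[R]_s)).

Definition hausdorff_cost (delta : R) (A : set 'rV[R]_d) : \bar R :=
  if A == set0 then 0 else
  if diam A <= delta%:E
  then (unit_ball_volume * (fine (diam A) / 2) ^+ s)%:E else +oo.

Lemma hausdorff_cost0 delta : hausdorff_cost delta set0 = 0.
Proof. by rewrite /hausdorff_cost eqxx. Qed.

Lemma hausdorff_cost_ge0 delta A : 0 <= hausdorff_cost delta A.
Proof.
rewrite /hausdorff_cost; case: (eqVneq A set0) => // /set0P[x Ax].
case: ifP => // _; rewrite lee_fin mulr_ge0 ?fine_ge0 ?exprn_ge0//.
rewrite divr_ge0// fine_ge0//; apply: ereal_sup_ubound.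
exists x => //; exists x => //; rewrite subrr /enorm /dotv big1 ?sqrtr0// => i _.
by rewrite mxE mul0r.
Qed.

Definition hausdorff_pre (delta : R) : {outer_measure set 'rV[R]_d -> \bar R} :=
  HB.pack (covering_outer (hausdorff_cost delta))
    (covering_is_outer (hausdorff_cost0 delta) (hausdorff_cost_ge0 delta)).

Definition hausdorff_fun (A : set 'rV[R]_d) : \bar R :=
  ereal_sup [set hausdorff_pre delta A | delta in [set delta : R | (0 < delta)%R]].

Lemma hausdorff_fun_ge0 A : 0 <= hausdorff_fun A.
Proof.
apply: (@le_trans _ _ (hausdorff_pre 1 A)); first exact: outer_measure_ge0.
by apply: ereal_sup_ubound; exists 1%R => //=.
Qed.

Lemma hausdorff_fun0 : hausdorff_fun set0 = 0.
Proof.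
apply/eqP; rewrite eq_le hausdorff_fun_ge0 andbT.
by apply: ge_ereal_sup => _ [e _ <-]; rewrite outer_measure0.
Qed.

Lemma le_hausdorff_fun : {homo hausdorff_fun : A B / A `<=` B >-> A <= B}.
Proof.
move=> A B AB; apply: ge_ereal_sup => _ [e e0 <-].
apply: (le_trans (le_outer_measure _ _ _ AB)).
by apply: ereal_sup_ubound; exists e.
Qed.

Lemma hausdorff_fun_sigma_subadditive : sigma_subadditive hausdorff_fun.
Proof.
move=> F; apply: ge_ereal_sup => _ [e e0 <-].
apply: (le_trans (outer_measure_sigma_subadditive _ F)).
apply: lee_nneseries => k _; first by move=> _; exact: outer_measure_ge0.
by apply: ereal_sup_ubound; exists e.
Qed.

Definition hausdorff_outer : {outer_measure set 'rV[R]_d -> \bar R} :=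
  HB.pack hausdorff_fun (isOuterMeasure.Build R 'rV[R]_d hausdorff_fun
    hausdorff_fun0 hausdorff_fun_ge0 le_hausdorff_fun
    hausdorff_fun_sigma_subadditive).

Definition hausdorff :
    {measure set (caratheodory_type hausdorff_outer) -> \bar R} :=
  hausdorff_outer.

End hausdorff.

Section domains.
Context (R : realType) (d : nat).
Implicit Types Omega : set 'rV[R]_d.

Definition exterior_domain Omega :=
  [/\ open Omega, connected Omega, compact (~` Omega) & ~` Omega !=set0].

(* Near each boundary point, Omega is the strict epigraph, in some unit
   direction e, of a Lipschitz function on the hyperplane orthogonal to e. *)
Definition lipschitz_boundary Omega :=
  forall x0, boundary Omega x0 ->
  exists (e : 'rV[R]_d) (gamma : 'rV[R]_d -> R) (rho : R),
    [/\ 0 < rho, enorm e = 1,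
        [lipschitz gamma y | y in [set y | dotv y e = 0]]
      & forall x, enorm (x - x0) < rho ->
          (Omega x <-> gamma (x - dotv x e *: e) < dotv x e)].

End domains.

Definition Lp_on (disp : measure_display) (T : measurableType disp)
    (R : realType) (mu : {measure set T -> \bar R}) (D : set T) (p : R)
    (f : T -> R) :=
  measurable_fun D f /\ (\int[mu]_(x in D) (`|f x| `^ p)%:E < +oo)%E.

Section sobolev.
Context (R : realType) (d : nat).
Local Notation E := 'rV[R]_d.
Local Notation L := (leb R d).
Local Notation H := (hausdorff R d d.-1).
Implicit Types (p r : R) (U Omega Gamma K : set E) (u v w t phi : E -> R)
  (g : E -> E).

Definition partial (i : 'I_d) (f : E -> R) : E -> R :=
  fun x => 'D_(delta_mx 0 i) f x.

Fixpoint differentiable_n (n : nat) (f : E -> R) : Prop :=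
  continuous f /\
  if n is m.+1 then
    forall i : 'I_d, (forall x, derivable f x (delta_mx 0 i)) /\
      differentiable_n m (partial i f)
  else True.

Definition smooth (f : E -> R) := forall n, differentiable_n n f.

Definition test_function U phi :=
  smooth phi /\
  exists K, [/\ compact K, K `<=` U & forall x, ~ K x -> phi x = 0].

Definition locally_L1 U (f : E -> R) :=
  forall K, compact K -> K `<=` U -> L.-integrable K (EFin \o f).

Definition weak_gradient U u g :=
  [/\ locally_L1 U u,
      forall i, locally_L1 U (fun x => g x 0 i)
    & forall phi (i : 'I_d), test_function U phi ->
        \int[L]_(x in U) (u x * partial i phi x) =
        - \int[L]_(x in U) (g x 0 i * phi x)].

(* u belongs to W^{1,p}(U) and its gradient is g (which is unique a.e.). *)
Definition sobolev_with p U u g :=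
  [/\ weak_gradient U u g, Lp_on L U p u
    & forall i, Lp_on L U p (fun x => g x 0 i)].

Definition sobolev p U u := exists g, sobolev_with p U u g.

Definition sobolev_loc p Omega u :=
  forall U, open U -> compact (closure U) -> closure U `<=` Omega ->
    sobolev p U u.

(* || u - w ||_{W^{1,p}(U)} < eps *)
Definition sobolev_close p U u w (eps : R) :=
  exists g, sobolev_with p U (u \- w) g /\
    ((\int[L]_(x in U) (`|u x - w x| `^ p + enorm (g x) `^ p)%:E) `^ p^-1
      < eps%:E)%E.

Definition V1p p Omega r0 v :=
  sobolev_loc p Omega v /\
  forall r, r0 < r -> sobolev p (Omega `&` eball r) v.

Definition vanishes_near Omega Gamma u :=
  exists N, [/\ open N, Gamma `<=` N
    & {ae L, forall x, (Omega `&` N) x -> u x = 0}].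

(* The seminorms of V^{1,p} increase with r, so a basic neighbourhood is given
   by a single r. *)
Definition V1p_Gamma p Omega r0 Gamma v :=
  V1p p Omega r0 v /\
  forall r eps, r0 < r -> 0 < eps -> exists u,
    [/\ V1p p Omega r0 u, vanishes_near Omega Gamma u
      & sobolev_close p (Omega `&` eball r) u v eps].

(* t is the trace of v: the trace operator is the extension by continuity of
   the restriction to the boundary of the functions continuous up to the
   boundary, so its graph is the closure of the graph of that restriction in
   V^{1,p}(Omega) x L^p(boundary Omega). *)
Definition is_trace p Omega r0 v t :=
  Lp_on H (boundary Omega) p t /\
  forall r eps, r0 < r -> 0 < eps -> exists u,
    [/\ V1p p Omega r0 u, {within closure Omega, continuous u},
        sobolev_close p (Omega `&` eball r) u v eps
      & (\int[H]_(x in boundary Omega) (`|u x - t x| `^ p)%:E < eps%:E)%E].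

(* The support of the a.e. class of phi on Omega. *)
Definition supp Omega phi : set E :=
  [set x | forall N, open N -> N x ->
    ~ {ae L, forall y, (Omega `&` N) y -> phi y = 0}].

Definition caratheodory_function Gamma (h : E -> R -> R) :=
  (forall s, measurable_fun (Gamma : set (caratheodory_type
    (hausdorff_outer R d d.-1))) (h^~ s)) /\
  {ae H, forall x, Gamma x -> continuous (h x)}.

(* |z|^{p-2} z . y, which is 0 at z = 0 also for p < 2 because dotv 0 y = 0. *)
Definition p_flux p (z y : E) : R := enorm z `^ (p - 2) * dotv z y.

Definition weak_solution p Omega r0 Gamma1 Gamma2 (h : E -> R -> R) v :=
  V1p_Gamma p Omega r0 Gamma1 v /\
  exists gv tv, [/\ weak_gradient Omega v gv, is_trace p Omega r0 v tv
    & forall phi gphi tphi,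
        V1p_Gamma p Omega r0 Gamma1 phi ->
        (exists r, r0 < r /\ supp Omega phi `<=` eball r) ->
        weak_gradient Omega phi gphi -> is_trace p Omega r0 phi tphi ->
        \int[L]_(x in Omega) p_flux p (gv x) (gphi x) +
        \int[H]_(x in Gamma2) (h x (tv x) * tphi x) = 0].

Definition tends_to_0_at_infinity Omega v :=
  forall eps, 0 < eps -> exists M : R,
    forall x, Omega x -> M < enorm x -> `|v x| < eps.

End sobolev.

(* Main.v *)
(* Let F be a C^1 convex function that vanishes on ]-oo, eps], with 0 <= F' <= 1.
   Since v tends to 0 at infinity, F(v) has bounded support, so it is an
   admissible test function. The identity becomes
     \int F'(v) |grad v|^p + \int_{Gamma_2} h(x, v) F(v) = 0
   with both integrands nonnegative. Hence grad F(v) = F'(v) grad v = 0 a.e., the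
   continuous function F(v) is constant on the connected set Omega, and it
   vanishes far away: F(v) = 0, that is v <= eps, for every eps > 0.

   The chain rule and the constancy are obtained without mollifiers: a weak
   partial derivative is the L^1_loc limit of difference quotients (by duality
   with test functions), and conversely. Hausdorff measure is a metric outer
   measure, so Gamma_1 and the boundary of Omega are measurable. *)

From HB Require Import structures.
Require Import Defs.
From mathcomp Require Import all_boot all_order all_algebra.
From mathcomp Require Import all_classical all_reals all_analysis.
From mathcomp Require Import measurable_realfun zify ring lra.
Import Order.TTheory GRing.Theory Num.Theory.
Import numFieldNormedType.Exports.
Local Open Scope classical_set_scope.
Local Open Scope ring_scope.

Set Implicit Arguments.
Unset Strict Implicit.
Unset Printing Implicit Defensive.

(** * Lebesgue measure *)

(** The spaces of test functions and the traces are defined as closures, so admissibility of F(v)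
    needs continuity of u |-> F(u) at v in W^{1,p}, not just a chain rule. The delicate term is
    (F'(u) - F'(v)) grad v: the factor is bounded by 1 and by |u - v|, so the term is small where
    |grad v|^p <= M, and the part of |grad v|^p above M has small integral. The same cut at a level
    M, applied to an integrable function, drives the chain rule and the duality with test functions.
    What is asked of F is recorded in [truncation]: a Taylor remainder bounded both by |b - a| and
    by (b - a)^2, as holds for suitable C^1 functions with bounded Lipschitz derivative; (s - eps)^+
    itself would fail the quadratic bound. Passing from almost everywhere to everywhere for
    continuous functions requires nonempty open sets to have positive measure. As the measure is
    built from coverings by boxes, this rests on a lower bound for the unit cube, obtained by
    counting. Nothing is known about the sign of the trace of v: on the boundary the sign comes from
    F vanishing on negative values. *)

Section covering_outer_measure.
Context (R : realType) (T : pointedType) (cost : set T -> \bar R).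
Hypothesis cost0 : cost set0 = 0%E.
Hypothesis cost_ge0 : forall A, (0 <= cost A)%E.

Let mu : {outer_measure set T -> \bar R} :=
  HB.pack (covering_outer cost) (covering_is_outer cost0 cost_ge0).

Lemma covering_outer_le X (A : nat -> set T) : X `<=` \bigcup_k A k ->
  (covering_outer cost X <= \sum_(k <oo) cost (A k))%E.
Proof.
by move=> XA; apply: ereal_inf_lbound; exists A => //; split.
Qed.

Lemma covering_outer_le1 X : (covering_outer cost X <= cost X)%E.
Proof.
apply: (le_trans (covering_outer_le (A := fun k => if k == 0%N then X else set0) _)).
  by move=> x Xx; exists 0%N.
rewrite nneseries_recl//.
by rewrite /= eseries0 ?adde0//; case.
Qed.

Lemma covering_outer_ge X (c : \bar R) :
  (forall A : nat -> set T, X `<=` \bigcup_k A k ->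
    (c <= \sum_(k <oo) cost (A k))%E) -> (c <= covering_outer cost X)%E.
Proof. by move=> cA; apply: le_ereal_inf_tmp => _ [A [_ XA] <-]; exact: cA. Qed.

(** Any cover of X is turned into a cover of Y by the [YC (A k)] and a cover of Z by the [ZC (A k)],
    at no greater total cost. With intersections this gives Caratheodory measurability; with [YC]
    keeping or discarding a covering set it gives additivity of the Hausdorff premeasure on
    separated sets. *)
Lemma covering_outer_split (X Y Z : set T) (YC ZC : set T -> set T) :
  (forall A, Y `&` A `<=` YC A) -> (forall A, Z `&` A `<=` ZC A) ->
  Y `<=` X -> Z `<=` X ->
  (forall A, cost (YC A) + cost (ZC A) <= cost A)%E ->
  (covering_outer cost Y + covering_outer cost Z <= covering_outer cost X)%E.
Proof.
move=> YC_ ZC_ YX ZX cle; apply: covering_outer_ge => A XA.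
have hY : Y `<=` \bigcup_k YC (A k).
  by move=> y Yy; have [k _ Aky] := XA y (YX y Yy); exists k => //; apply: YC_.
have hZ : Z `<=` \bigcup_k ZC (A k).
  by move=> y Yy; have [k _ Aky] := XA y (ZX y Yy); exists k => //; apply: ZC_.
apply: (le_trans (leeD (covering_outer_le hY) (covering_outer_le hZ))).
rewrite -nneseriesD; [|by move=> *|by move=> *].
by apply: lee_nneseries => // k _; rewrite adde_ge0.
Qed.

Lemma covering_outer_caratheodory (H : set T) :
  (forall A, cost (A `&` H) + cost (A `&` ~` H) <= cost A)%E ->
  caratheodory_measurable (covering_outer cost) H.
Proof.
move=> cH; apply: (@le_caratheodory_measurable _ _ mu) => X /=.
apply: (covering_outer_split (YC := setI^~ H) (ZC := setI^~ (~` H))) => //.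
- by move=> A x [[]].
- by move=> A x [[]].
Qed.

Lemma covering_outer_preimage (f : T -> T) X :
  (forall A, cost (f @^-1` A) <= cost A)%E ->
  (covering_outer cost (f @^-1` X) <= covering_outer cost X)%E.
Proof.
move=> cf; apply: covering_outer_ge => A XA.
apply: (@le_trans _ _ (\sum_(k <oo) cost (f @^-1` A k))%E).
  by apply: covering_outer_le => x /= /XA[k _ Ak]; exists k.
by apply: lee_nneseries => // k _; exact: cost_ge0.
Qed.

End covering_outer_measure.

Section lebesgue.
Context (R : realType) (d : nat).
Implicit Types (a b c : 'rV[R]_d) (A B : set 'rV[R]_d).
Local Notation lo := (lebesgue_outer R d).
Local Notation L := (leb R d).
Local Notation T := (caratheodory_type (lebesgue_outer R d)).

Definition vol a b : R := \prod_(i < d) (b 0 i - a 0 i).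

Lemma box_volume_box a b : (forall i, a 0 i <= b 0 i) ->
  (box_volume (box a b) <= (vol a b)%:E)%E.
Proof.
move=> ab; rewrite /box_volume; case: ifPn => _.
  by rewrite lee_fin prodr_ge0// => i _; rewrite subr_ge0.
by apply: ereal_inf_lbound; exists (a, b).
Qed.

Lemma le_box_volume A (c : \bar R) : (A = set0 -> (c <= 0)%E) ->
  (forall a b, (forall i, a 0 i <= b 0 i) -> A = box a b ->
    (c <= (vol a b)%:E)%E) -> (c <= box_volume A)%E.
Proof.
rewrite /box_volume; case: eqP => [A0 /(_ A0)//|_ _ cA].
by apply: le_ereal_inf_tmp => _ [[a b] /= [ab AE] <-]; exact: cA.
Qed.

Lemma box_volume_halfspace (i : 'I_d) (c : R) A :
  (box_volume (A `&` [set x | (x 0 i < c)%R]) +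
   box_volume (A `&` ~` [set x | (x 0 i < c)%R]) <= box_volume A)%E.
Proof.
set H := [set _ | _]; apply: le_box_volume => [->|a b ab ->].
  by rewrite !set0I box_volume0 adde0.
(* c clamped to [a_i, b_i]: both pieces are then boxes, one of them degenerate when the hyperplane
   misses the box. *)
pose m := Num.min (b 0 i) (Num.max (a 0 i) c).
have am : a 0 i <= m by rewrite le_min ab le_max lexx.
have mb : m <= b 0 i by rewrite ge_min lexx.
pose b' : 'rV[R]_d := \row_j (if j == i then m else b 0 j).
pose a' : 'rV[R]_d := \row_j (if j == i then m else a 0 j).
have -> : box a b `&` H = box a b'.
  apply/seteqP; split => [x [/= xab xH] j|x xab]; rewrite ?mxE.
    case: eqP => [->|_]; last exact: xab.
    by have /andP[-> xb] := xab i; rewrite lt_min xb/= lt_max xH orbT.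
  have := xab i; rewrite mxE eqxx lt_min lt_max => /and3P[xai xbi].
  rewrite ltNge xai/= => xc; split => // j.
  by have := xab j; rewrite mxE; case: eqP => [->|//]; rewrite xai xbi.
have -> : box a b `&` ~` H = box a' b.
  apply/seteqP; split => [x [/= xab xH] j|x xab]; rewrite ?mxE.
    case: eqP => [->|_]; last exact: xab.
    have /andP[xai ->] := xab i; rewrite andbT ge_min ge_max xai/=.
    by move/negP: xH; rewrite /H/= -leNgt => ->; rewrite orbT.
  have := xab i; rewrite mxE eqxx => /andP[mx xb].
  have [xa xc] : a 0 i <= x 0 i /\ c <= x 0 i.
    move: mx; rewrite /m ge_min leNgt xb/= ge_max => /andP[]//.
  split; last by rewrite /H/=; apply/negP; rewrite -leNgt.
  by move=> j; have := xab j; rewrite mxE; case: eqP => [->|//]; rewrite xa xb.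
apply: (le_trans (leeD (box_volume_box _) (box_volume_box _))).
- by move=> j; rewrite mxE; case: eqP => [->|//].
- by move=> j; rewrite mxE; case: eqP => [->|//].
have volD1 u v : vol u v = (v 0 i - u 0 i) * \prod_(j < d | j != i) (v 0 j - u 0 j).
  by rewrite /vol (bigD1 i).
rewrite -EFinD lee_fin !volD1 !mxE eqxx.
rewrite (eq_bigr (fun j => b 0 j - a 0 j)); last first.
  by move=> j /negbTE ji; rewrite mxE ji.
rewrite [X in _ + _ * X](eq_bigr (fun j => b 0 j - a 0 j)); last first.
  by move=> j /negbTE ji; rewrite mxE ji.
by rewrite -mulrDl; set P := \prod_(_ | _) _; rewrite addrC addrA subrK.
Qed.

Lemma measurable_halfspace (i : 'I_d) (c : R) :
  measurable ([set x : 'rV[R]_d | x 0 i < c] : set T).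
Proof.
apply: covering_outer_caratheodory.
- exact: box_volume0.
- exact: box_volume_ge0.
- by move=> A; exact: box_volume_halfspace.
Qed.

Lemma measurable_box a b : measurable (box a b : set T).
Proof.
have -> : (box a b : set T) = \bigcap_(i in [set: 'I_d])
    (~` [set x : 'rV[R]_d | x 0 i < a 0 i] `&` [set x | x 0 i < b 0 i]).
  apply/seteqP; split => [x xab i _|x xab i].
    by have /andP[ax xb] := xab i; split => //; apply/negP; rewrite -leNgt.
  by have [/= /negP] := xab i I; rewrite -leNgt => -> ->.
apply: fin_bigcap_measurable => // i _; apply: measurableI.
  by apply: measurableC; exact: measurable_halfspace.
exact: measurable_halfspace.
Qed.

Lemma leb_box a b : (forall i, a 0 i <= b 0 i) -> (L (box a b) <= (vol a b)%:E)%E.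
Proof.
move=> ab; apply: le_trans (box_volume_box ab).
by apply: covering_outer_le1; [exact: box_volume0|exact: box_volume_ge0].
Qed.

Lemma box_volume_translate c A :
  (box_volume ((fun x : 'rV[R]_d => x + c)%R @^-1` A) <= box_volume A)%E.
Proof.
apply: le_box_volume => [->|a b ab ->].
  by rewrite preimage_set0 box_volume0.
have -> : (fun x => x + c) @^-1` box a b = box (a - c) (b - c).
  apply/seteqP; split => x /= xab i; have := xab i; rewrite !mxE.
    by rewrite lerBlDr ltrBrDr.
  by rewrite lerBlDr ltrBrDr.
apply: (le_trans (box_volume_box _)); first by move=> i; rewrite !mxE lerB.
rewrite lee_fin /vol ler_prod// => i _; rewrite !mxE.
by rewrite subr_ge0 lerB//=; lra.
Qed.

Lemma lebesgue_outer_translate c A :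
  lo ((fun x : 'rV[R]_d => x + c) @^-1` A) = lo A.
Proof.
have le c' B : (lo ((fun x : 'rV[R]_d => x + c')%R @^-1` B) <= lo B)%E.
  apply: covering_outer_preimage; [exact: box_volume_ge0|].
  by move=> ?; exact: box_volume_translate.
apply/eqP; rewrite eq_le le/=.
have := le (- c) ((fun x : 'rV[R]_d => x + c) @^-1` A).
rewrite -comp_preimage (_ : _ \o _ = id)//.
by apply/funext => x/=; rewrite subrK.
Qed.

Lemma measurable_translate c :
  measurable_fun setT ((fun x : 'rV[R]_d => x + c) : T -> T).
Proof.
move=> _ B mB; rewrite setTI.
have cB : caratheodory_measurable lo B := mB.
suff cB' : caratheodory_measurable lo ((fun x : 'rV[R]_d => x + c) @^-1` B) by exact: cB'.
move=> X; rewrite -(lebesgue_outer_translate (- c) X) cB.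
rewrite -(lebesgue_outer_translate (- c) (X `&` _)).
rewrite -(lebesgue_outer_translate (- c) (X `&` ~` _)).
have E : (fun x : 'rV[R]_d => x - c) @^-1` ((fun x => x + c) @^-1` B) = B.
  rewrite -comp_preimage (_ : _ \o _ = id)//.
  by apply/funext => x/=; rewrite subrK.
have E' : (fun x : 'rV[R]_d => x - c) @^-1` (~` ((fun x => x + c) @^-1` B)) = ~` B.
  by rewrite -[in RHS]E.
by rewrite !preimage_setI E E'.
Qed.

End lebesgue.

Lemma ex_invS_lt (R : realType) (e : R) : 0 < e -> exists n : nat, n.+1%:R^-1 < e.
Proof.
move=> e0; have [N _ HN] := near_infty_natSinv_lt (PosNum e0).
by exists N; exact: (HN N (leqnn N)).
Qed.

Section row_topology.
Context (R : realType) (d : nat).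
Implicit Types (a b c x y : 'rV[R]_d) (A U K : set 'rV[R]_d).

Definition cbox a b := [set x : 'rV[R]_d | forall i, a 0 i <= x 0 i <= b 0 i].

Lemma compact_cbox a b : compact (cbox a b).
Proof.
have := @rV_compact R d (fun i => `[a 0 i, b 0 i]%classic)
  (fun i => @segment_compact _ _ _).
by congr compact; apply/seteqP; split => x xab i; have := xab i;
  rewrite /= in_itv.
Qed.

Lemma coord_le_norm x (i : 'I_d) : `|x 0 i| <= `|x|.
Proof.
rewrite [leRHS]/Num.norm /= mx_normrE; apply/bigmax_geP; right => /=.
by exists (0, i).
Qed.

Lemma norm_ltP x (e : R) : 0 < e -> (`|x| < e) <-> (forall i, `|x 0 i| < e).
Proof.
move=> e0; split=> [xe i|xe]; first exact: le_lt_trans (coord_le_norm x i) xe.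
rewrite [ltLHS]/Num.norm /= mx_normrE; apply/bigmax_ltP; split => //= -[i j] _ /=.
by rewrite (ord1 i).
Qed.

Lemma open_rowP U : open U <->
  forall x, U x -> exists2 e : R, 0 < e & forall y : 'rV[R]_d, (forall i : 'I_d, `|x 0 i - y 0 i| < e) -> U y.
Proof.
rewrite openE; split => [oU x Ux|oU x Ux].
  have /nbhs_ballP[e e0 xe] := oU _ Ux; exists e => // y xy; apply: xe.
  rewrite -ball_normE /ball_ /=; apply/norm_ltP => // i.
  by rewrite !mxE; exact: xy.
have [e e0 xe] := oU _ Ux; apply/nbhs_ballP; exists e => // y.
rewrite -ball_normE /ball_ /= => /(norm_ltP _ e0) xy; apply: xe => i.
by have := xy i; rewrite !mxE.
Qed.

Lemma bounded_box A : (exists M : R, forall x, A x -> forall i, `|x 0 i| <= M) ->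
  exists M : R, 0 < M /\ A `<=` box (const_mx (- M)) (const_mx M).
Proof.
move=> [M AM]; exists (`|M| + 1); split; first by rewrite ltr_pwDr.
move=> x Ax i; rewrite !mxE.
have := AM x Ax i; rewrite ler_norml => /andP[? ?].
have := ler_norm M; lra.
Qed.

Lemma compact_box K : compact K ->
  exists M : R, 0 < M /\ K `<=` box (const_mx (- M)) (const_mx M).
Proof.
move=> /compact_bounded[M [_ KM]]; apply: bounded_box; exists (M + 1) => x Kx i.
by apply: (le_trans (coord_le_norm x i)); apply: KM => //; rewrite ltrDl.
Qed.

(** Corners of the grid cubes of side 1/(k.2+1). The index type is countable, so unions of such
    cubes are countable unions. *)
Definition cube_lo (k : 'rV[int]_d * nat) : 'rV[R]_d :=
  \row_i ((k.1 0 i)%:~R / k.2.+1%:R).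
Definition cube_hi (k : 'rV[int]_d * nat) : 'rV[R]_d :=
  \row_i ((k.1 0 i + 1)%:~R / k.2.+1%:R).

(** The half-open cubes cover, while the condition is put on the closed ones: the same family also
    exhausts U by compact subsets. *)
Lemma open_bigcup_cubes U : open U ->
  U = \bigcup_(k in [set k | cbox (cube_lo k) (cube_hi k) `<=` U])
        box (cube_lo k) (cube_hi k).
Proof.
move=> /open_rowP oU; apply/seteqP; split => [x Ux|x [k kU xk]]; last first.
  by apply: kU => i; have /andP[-> /ltW ->] := xk i.
have [e e0 xe] := oU _ Ux; have [n ne] := ex_invS_lt e0.
pose m : 'rV[int]_d := \row_i Num.floor (x 0 i * n.+1%:R).
have xm i : (m 0 i)%:~R / n.+1%:R <= x 0 i < (m 0 i + 1)%:~R / n.+1%:R.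
  by rewrite ler_pdivrMr// ltr_pdivlMr// mxE floor_itv.
have loE i : cube_lo (m, n) 0 i = (m 0 i)%:~R / n.+1%:R by rewrite /cube_lo mxE.
have hiE i : cube_hi (m, n) 0 i = (m 0 i + 1)%:~R / n.+1%:R.
  by rewrite /cube_hi mxE.
exists (m, n) => /=; last by move=> i; rewrite loE hiE; exact: xm.
move=> y ym; apply: xe => i; have := ym i; have := xm i; rewrite loE hiE.
rewrite intrD mulrDl div1r; move: ne; set q := _^-1; set r := _%:~R * q.
by move=> ? /andP[? ?] /andP[? ?]; rewrite ltr_norml; apply/andP; split; lra.
Qed.

End row_topology.

Section borel.
Context (R : realType) (d : nat).
Local Notation L := (leb R d).
Local Notation T := (caratheodory_type (lebesgue_outer R d)).
Implicit Types (a b c x y : 'rV[R]_d) (A U K : set 'rV[R]_d).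

Lemma measurable_open U : open U -> measurable (U : set T).
Proof.
move=> /open_bigcup_cubes ->; rewrite bigcup_mkcond.
apply: (@countable_bigcupT_measurable _ T ('rV[int]_d * nat)%type) => [|k].
  exact: countableP.
by case: ifP => _; [exact: measurable_box|exact: measurable0].
Qed.

Lemma measurable_closed A : closed A -> measurable (A : set T).
Proof.
by move/closed_openC/measurable_open/measurableC; rewrite setCK.
Qed.

Lemma measurable_compact K : compact K -> measurable (K : set T).
Proof. by move=> /(compact_closed (@norm_hausdorff _ _)); exact: measurable_closed. Qed.

Lemma leb_bounded_box (M : R) : 0 < M ->
  (L (box (const_mx (- M)%R) (const_mx M)) < +oo)%E.
Proof.
move=> M0; apply: le_lt_trans (leb_box _) _ => [i|]; last exact: ltry.
by rewrite !mxE; lra.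
Qed.

Lemma leb_compact K : compact K -> (L K < +oo)%E.
Proof.
move=> cK; have [M [M0 KM]] := compact_box cK.
apply: le_lt_trans (leb_bounded_box M0).
exact: (le_outer_measure (lebesgue_outer R d)).
Qed.

End borel.

Lemma continuous_caratheodory (R : realType) (d : nat)
    (mu : {outer_measure set 'rV[R]_d -> \bar R}) (f : 'rV[R]_d -> R)
    (D : set 'rV[R]_d) :
  (forall U : set 'rV[R]_d, open U -> measurable (U : set (caratheodory_type mu))) ->
  {within D, continuous f} ->
  @measurable_fun _ _ (caratheodory_type mu) _ D f.
Proof.
move=> mo /continuousP cf mD.
apply: (measurability _ (RGenOpens.measurableE R)) => //.
move=> _ [_ [a [b ->] <-]].
have /open_subspaceP[V oV VD] := cf _ (@interval_open R (BRight a) (BLeft b) isT isT).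
by rewrite setIC -VD; apply: measurableI => //; exact: mo.
Qed.

(* Counting the points of the lattice (1/N) Z^d in boxes bounds below the total
   volume of a finite cover of the unit cube, without Fubini. *)
Section lattice_counting.
Context (R : realType) (d : nat).
Implicit Types (a b : 'rV[R]_d).

(** The smallest solution m and the largest M satisfy a N <= m and M < b N, and all solutions lie
    among the M - m + 1 integers between them. *)
Lemma card_grid_itv (N : nat) (a b : R) : (0 < N)%N -> a <= b ->
  (#|[pred k : 'I_N | a <= k%:R / N%:R < b]|%:R : R) <= N%:R * (b - a) + 1.
Proof.
move=> N0 ab; set S := [pred _ | _].
have NR : 0 < N%:R :> R by rewrite ltr0n.
have [S0|[k0 Sk0]] := set_0Vmem [set k in S].
  rewrite (_ : #|S| = 0%N); last by rewrite -cardsE S0 cards0.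
  by rewrite addr_ge0// mulr_ge0// ?subr_ge0// ltW.
have {}Sk0 : S k0 by move: Sk0; rewrite inE.
case: (@arg_minnP _ k0 S (@nat_of_ord N) Sk0) => m Sm minm.
case: (@arg_maxnP _ k0 S (@nat_of_ord N) Sk0) => M SM maxM.
have cS : (#|S| <= M.+1 - m)%N.
  have : uniq [seq val k | k <- enum S] by rewrite map_inj_uniq ?enum_uniq//; exact: val_inj.
  move=> /(@uniq_leq_size _ _ (iota m (M.+1 - m))).
  rewrite size_iota size_map -cardE; apply => x /mapP[k + ->{x}].
  rewrite mem_enum => Sk; rewrite mem_iota minm//= subnKC//.
    by rewrite ltnS; exact: maxM.
  by apply: (leq_trans (minm _ Sk)); apply: (leq_trans (maxM _ Sk)).
have mM : (m <= M)%N by exact: minm.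
apply: (@le_trans _ _ ((M.+1 - m)%:R)); first by rewrite ler_nat.
rewrite natrB; last exact: leq_trans mM (leqnSn _).
move: Sm SM => /= /andP[+ _] /andP[_ +].
rewrite ler_pdivlMr// ltr_pdivrMr// => am Mb.
by rewrite -natr1; nra.
Qed.

Definition grid (N : nat) (f : {ffun 'I_d -> 'I_N}) : 'rV[R]_d :=
  \row_i ((f i)%:R / N%:R).

Lemma card_grid_box (N : nat) a b : (0 < N)%N -> (forall i, a 0 i <= b 0 i) ->
  (#|[pred f : {ffun 'I_d -> 'I_N} | `[< box a b (grid f) >]]|%:R : R)
  <= \prod_(i < d) (N%:R * (b 0 i - a 0 i) + 1).
Proof.
move=> N0 ab.
rewrite (_ : #|_| = \prod_(i < d) #|[pred k : 'I_N | (a 0 i <= k%:R / N%:R < b 0 i)%R]|)%N.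
  rewrite natr_prod; apply: ler_prod => i _; rewrite ler0n/=.
  exact: card_grid_itv.
have := card_family (fun i => [pred k : 'I_N | a 0 i <= k%:R / N%:R < b 0 i]).
rewrite foldrE big_map big_enum /= => <-.
apply: eq_card => f; rewrite !inE; apply/asboolP/familyP => /=.
  by move=> fab i; have := fab i; rewrite mxE inE.
by move=> fab i; have := fab i; rewrite mxE inE.
Qed.

(** The product is a polynomial in t, hence continuous at t = 0. *)
Lemma prod_addl_cont (l : 'I_d -> R) (e : R) : 0 < e -> (forall i, 0 <= l i) ->
  exists2 t, 0 < t & \prod_(i < d) (l i + t) <= \prod_(i < d) l i + e.
Proof.
move=> e0 l0; pose P : {poly R} := \prod_(i < d) ((l i)%:P + 'X).
have PE t : P.[t] = \prod_(i < d) (l i + t).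
  by rewrite horner_prod; apply: eq_bigr => i _; rewrite hornerD hornerC hornerX.
have : P.[t] @[t --> 0] --> P.[0] by exact: continuous_horner.
move=> /cvgrPdist_le /(_ _ e0) /nbhs_ballP[r /= r0 Hr].
have r2 : 0 < r / 2 by rewrite divr_gt0.
exists (r / 2) => //.
have : ball 0 r (r / 2).
  by rewrite /ball/= sub0r normrN gtr0_norm//; rewrite ltr_pdivrMr//; lra.
move=> /Hr; rewrite !PE distrC => /(le_trans (ler_norm _)).
rewrite lerBlDl; under [X in _ <= X + _]eq_bigr do rewrite addr0.
by rewrite addrC.
Qed.

(** The grid of mesh 1/N has N^d points in the unit cube, and a box with sides l_i contains at most
    the product of the N l_i + 1, which is N^d times the product of the l_i + 1/N. For N large the
    latter product is at most the volume plus [e k], simultaneously for the finitely many k;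
    dividing by N^d gives the bound. *)
Lemma finite_box_cover (s : seq nat) (a b : nat -> 'rV[R]_d) (e : nat -> R) :
  (forall k, 0 < e k) -> (forall k i, a k 0 i <= b k 0 i) ->
  (forall f : 'rV[R]_d, (forall i, 0 <= f 0 i <= 1) ->
    exists2 k, k \in s & box (a k) (b k) f) ->
  1 <= \sum_(k <- s) (vol (a k) (b k) + e k).
Proof.
move=> e0 ab cov.
pose t k := projT1 (cid2 (prod_addl_cont (e0 k)
  (fun i => eq_rect_r is_true (ab k i) (subr_ge0 (a k 0 i) (b k 0 i))))).
have t0 k : 0 < t k by rewrite /t; case: cid2.
have tE k : \prod_(i < d) (b k 0 i - a k 0 i + t k) <= vol (a k) (b k) + e k.
  by rewrite /t; case: cid2.
have [N N0 Ht] : exists2 N, (0 < N)%N & forall k, k \in s -> N%:R^-1 <= t k.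
  elim: s {cov} => [|k s [N N0 IH]]; first by exists 1%N.
  have [M Mt] := ex_invS_lt (t0 k).
  exists (maxn N M.+1); first by rewrite leq_max N0.
  have NM : 0 < (maxn N M.+1)%:R :> R by rewrite ltr0n leq_max N0.
  move=> j; rewrite inE => /orP[/eqP ->|js].
    apply: le_trans (ltW Mt); rewrite lef_pV2 ?posrE//.
    by rewrite ler_nat leq_max leqnn orbT.
  apply: le_trans (IH _ js); rewrite lef_pV2 ?posrE// ?ltr0n//.
  by rewrite ler_nat leq_max leqnn.
have NR : 0 < N%:R :> R by rewrite ltr0n.
apply: le_trans (ler_sum _ (fun k _ => tE k)).
have NdR : 0 < (N%:R ^+ d : R) by rewrite exprn_gt0.
rewrite -(ler_pM2l NdR) mulr1 mulr_sumr.
pose B k := [pred f : {ffun 'I_d -> 'I_N} | `[< box (a k) (b k) (grid f) >]].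
apply: (@le_trans _ _ (\sum_(k <- s) #|B k|%:R)).
  rewrite -natr_sum -natrX ler_nat -[X in (X ^ _)%N]card_ord.
  rewrite -[X in (_ ^ X)%N](card_ord d) -card_ffun.
  rewrite -sum1_card (eq_bigr (fun k => \sum_(f | B k f) 1)%N); last first.
    by move=> k _; rewrite -sum1_card.
  rewrite (exchange_big_dep predT)//=; apply: leq_sum => f _.
  have [|k ks kf] := cov (grid f).
    move=> i; rewrite mxE divr_ge0//= ler_pdivrMr// mul1r ler_nat.
    exact: ltnW.
  rewrite sum1_count -has_count; apply/hasP; exists k => //.
  exact/asboolP.
rewrite big_seq [leRHS]big_seq; apply: ler_sum => k ks.
apply: le_trans (card_grid_box N0 (ab k)) _.
rewrite -[X in _ ^+ X](card_ord d) -prodr_const -big_split /=.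
apply: ler_prod => i _.
have ab0 : 0 <= b k 0 i - a k 0 i by rewrite subr_ge0.
rewrite addr_ge0 ?mulr_ge0//= [leRHS]mulrDr lerD2l.
by rewrite mulrC -ler_pdivrMr// div1r Ht.
Qed.

End lattice_counting.

Section leb_positive.
Context (R : realType) (d : nat).
Hypothesis d_gt0 : (0 < d)%N.
Local Notation L := (leb R d).
Local Notation T := (caratheodory_type (lebesgue_outer R d)).
Implicit Types (a b c x y : 'rV[R]_d) (A U K : set 'rV[R]_d).

Lemma box_volume_adherent A (e : R) : 0 < e -> (box_volume A < +oo)%E ->
  exists a b, [/\ forall i, a 0 i <= b 0 i, A `<=` box a b
    & ((vol a b)%:E <= box_volume A + e%:E)%E].
Proof.
move=> e0 Aoo; have A0 := box_volume_ge0 A.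
have Afin : box_volume A \is a fin_num by rewrite ge0_fin_numE.
(* The degenerate box at 0 has volume 0 because d > 0; for d = 0 the empty product would be 1. *)
have [->|/eqP An0] := eqVneq A set0.
  exists 0, 0; split => //; rewrite box_volume0 add0e lee_fin /vol.
  by rewrite (bigD1 (Ordinal d_gt0))//= mxE subr0 mul0r ltW.
have : (box_volume A < box_volume A + e%:E)%E by rewrite lteDl.
rewrite {1}/box_volume; move/eqP/negbTE: (An0) => ->.
move=> /ereal_inf_lt[_ [[a b] /= [ab ->] <-] /ltW vab].
by exists a, b; split.
Qed.

(** The boxes of a countable cover are enlarged to open ones, compactness leaves finitely many, and
    counting lattice points bounds their total volume from below. *)
Lemma leb_unit_cube : (1 <= L (@cbox R d 0%R (const_mx 1%R)))%E.
Proof.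
change (1 <= covering_outer (@box_volume R d)
  (@cbox R d 0%R (const_mx 1%R)))%E.
apply: covering_outer_ge => A cA.
set S := (X in (_ <= X)%E).
have [->|Soo] := eqVneq S +oo%E; first exact: leey.
have A0 k : (0 <= box_volume (A k))%E by exact: box_volume_ge0.
have Aoo k : (box_volume (A k) < +oo)%E.
  rewrite ltey; apply: contra Soo => /eqP Ak.
  by rewrite /S (@nneseries_pinfty _ _ xpredT k).
apply/lee_addgt0Pr => e e0.
(* The errors [h k] sum to e. Half of [h k] pays for a box nearly realising [box_volume (A k)], a
   quarter for opening it, a quarter for the error term of [finite_box_cover]. *)
pose h k : R := e / (2 ^ k.+1)%:R.
have h0 k : 0 < h k by rewrite divr_gt0// ltr0n expn_gt0.
have h20 k : 0 < h k / 2 by rewrite divr_gt0.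
have h40 k : 0 < h k / 4 by rewrite divr_gt0.
have [a /choice[b Hab]] := choice (fun k => box_volume_adherent (h20 k) (Aoo k)).
have ab k i : a k 0 i <= b k 0 i by have [] := Hab k.
have l0 k i : 0 <= b k 0 i - a k 0 i by rewrite subr_ge0.
have /choice[t Ht] : forall k, exists t : R, 0 < t /\
    \prod_(i < d) (b k 0 i - a k 0 i + t) <= vol (a k) (b k) + h k / 4.
  by move=> k; have [t t0 tE] := prod_addl_cont (h40 k) (l0 k); exists t.
have t0 k : 0 < t k by have [] := Ht k.
(* Boxes lack their upper faces, so moving the lower corner alone yields an open set [O k] between
   [box (a k) (b k)] and [box (a' k) (b k)]. *)
pose a' k : 'rV[R]_d := \row_i (a k 0 i - t k).
pose O k := [set x : 'rV[R]_d | forall i, a' k 0 i < x 0 i < b k 0 i].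
have oO k : [set: nat] k -> open (O k).
  move=> _; apply/open_rowP => x Ox.
  pose e' := \big[Num.min/1]_(i < d) Num.min (x 0 i - a' k 0 i) (b k 0 i - x 0 i).
  exists e'.
    apply/bigmin_gtP; split => // i _; rewrite lt_min !subr_gt0; exact: Ox.
  move=> y xy i.
  have : `|x 0 i - y 0 i| < Num.min (x 0 i - a' k 0 i) (b k 0 i - x 0 i).
    by apply: lt_le_trans (xy i) _; exact: bigmin_le_cond.
  rewrite lt_min !ltr_norml => /andP[/andP[? ?] /andP[? ?]].
  by apply/andP; split; lra.
have : cbox (0 : 'rV[R]_d) (const_mx 1) `<=` cover setT O.
  move=> x /cA[k _ Akx]; exists k => // i.
  have [_ /(_ _ Akx) /(_ i) /andP[ax xb] _] := Hab k.
  by rewrite mxE xb andbT; apply: lt_le_trans ax; rewrite ltrBlDr ltrDl.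
have := @compact_cbox R d 0 (const_mx 1).
rewrite compact_cover => cc Ocov; have [D _ cD] := cc _ _ _ oO Ocov.
have a'b k i : a' k 0 i <= b k 0 i.
  by rewrite mxE lerBlDr (le_trans (ab k i))// lerDl ltW.
have : 1 <= \sum_(k <- finmap.enum_fset D) (vol (a' k) (b k) + h k / 4).
  apply: finite_box_cover => // f f01.
  have [|k kD Okf] := cD f; first by move=> i; rewrite !mxE.
  by exists k => // i; have /andP[/ltW -> ->] := Okf i.
move=> h1.
have := @epsilon_trick R (fun k => box_volume (A k)) e xpredT A0 (ltW e0).
apply: le_trans.
have Ah0 k : true -> (0 <= box_volume (A k) + (h k)%:E)%E.
  by move=> _; rewrite adde_ge0// lee_fin ltW// h0.
have := @lee_sum_fset_lim R (fun k => box_volume (A k) + (h k)%:E)%E D xpredT Ah0.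
apply: le_trans.
have : (1%:E <= (\sum_(k <- finmap.enum_fset D) (vol (a' k) (b k) + h k / 4))%R%:E)%E.
  by rewrite lee_fin.
move=> /le_trans; apply; rewrite -sumEFin; apply: lee_sum => k _.
have [_ _ vk] := Hab k.
have -> : h k = h k / 2 + h k / 2 by rewrite -splitr.
rewrite -/(h k) [in leRHS]EFinD addeA.
apply: le_trans (leeD vk (lexx _)); rewrite -EFinD lee_fin.
have [_ tk] := Ht k.
have -> : vol (a' k) (b k) = \prod_(i < d) (b k 0 i - a k 0 i + t k).
  by apply: eq_bigr => i _; rewrite mxE opprB addrA addrAC.
lra.
Qed.

(** If U were null, so would be the whole space, a countable union of translates of U along a fine
    enough grid; but the unit cube is not null. *)
Lemma leb_open_gt0 U : open U -> U !=set0 -> (0 < L U)%E.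
Proof.
move=> /open_rowP oU [x Ux]; rewrite lt_neqAle outer_measure_ge0 andbT eq_sym.
apply/eqP => LU0; have [e e0 xe] := oU _ Ux.
have [n ne] := ex_invS_lt e0.
pose sh (k : 'rV[int]_d) : 'rV[R]_d := x - \row_i ((k 0 i)%:~R / n.+1%:R).
pose F m := if @unpickle ('rV[int]_d) m is Some k then (fun y : 'rV[R]_d => y + sh k) @^-1` U
            else set0.
have F0 m : lebesgue_outer R d (F m) = 0%E.
  rewrite /F; case: unpickle => [k|]; last exact: outer_measure0.
  by rewrite lebesgue_outer_translate.
have FT : [set: 'rV[R]_d] `<=` \bigcup_m F m.
  move=> y _; pose k : 'rV[int]_d := \row_i Num.floor (y 0 i * n.+1%:R).
  exists (pickle k) => //; rewrite /F pickleK /=; apply: xe => i.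
  have : (k 0 i)%:~R / n.+1%:R <= y 0 i < (k 0 i + 1)%:~R / n.+1%:R.
    by rewrite ler_pdivrMr// ltr_pdivlMr// mxE floor_itv.
  rewrite !mxE intrD mulrDl div1r; move: ne; set q := _^-1.
  set r := _%:~R * q => ? /andP[? ?].
  by rewrite ltr_norml; apply/andP; split; lra.
have : (lebesgue_outer R d setT <= 0)%E.
  apply: le_trans (le_outer_measure (lebesgue_outer R d) _ _ FT) _.
  apply: le_trans (outer_measure_sigma_subadditive (lebesgue_outer R d) F) _.
  by rewrite eseries0.
apply/negP; rewrite -ltNge.
apply: lt_le_trans (le_outer_measure (lebesgue_outer R d) (cbox 0 (const_mx 1)) _ _) => //.
exact: lt_le_trans leb_unit_cube.
Qed.

End leb_positive.

Lemma is_derive_cvg (R : realType) (V : normedModType R) (f : V -> R) (x v : V) (l : R) :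
  h^-1 *: ((f \o shift x) (h *: v) - f x) @[h --> 0^'] --> l ->
  is_derive x v f l.
Proof.
by move=> fl; split; [apply/cvg_ex; exists l|exact: cvg_lim fl].
Qed.

Lemma is_derive_continuous (R : realType) (f : R -> R) (x l : R) :
  is_derive x 1 f l -> {for x, continuous f}.
Proof. by move=> [/derivable1_diffP/differentiable_continuous]. Qed.

(** * Test functions *)

Section smooth_real_functions.
Context (R : realType).
Implicit Types f g : R -> R.

Fixpoint smooth1_n (n : nat) f : Prop :=
  if n is m.+1 then
    exists f', (forall x : R, is_derive x (1 : R) f (f' x)) /\ smooth1_n m f'
  else continuous f.

Lemma smooth1_n_continuous n f : smooth1_n n f -> continuous f.
Proof.
by case: n => // n [f' [ff' _]] x; exact: is_derive_continuous (ff' x).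
Qed.

Lemma smooth1_nW n f : smooth1_n n.+1 f -> smooth1_n n f.
Proof.
elim: n f => [|n IH] f; first exact: smooth1_n_continuous.
by move=> [f' [ff' /IH nf']]; exists f'.
Qed.

Lemma smooth1_n_cst n (c : R) : smooth1_n n (cst c).
Proof.
elim: n c => [|n IH] c; first exact: cst_continuous.
by exists (cst 0); split => // x; exact: is_derive_cst.
Qed.

Lemma smooth1_n_id n : smooth1_n n id.
Proof.
case: n => [|n]; first by move=> x; exact: cvg_id.
by exists (cst 1); split; [move=> x; exact: is_derive_id|exact: smooth1_n_cst].
Qed.

Lemma smooth1_nD n f g : smooth1_n n f -> smooth1_n n g -> smooth1_n n (f \+ g).
Proof.
elim: n f g => [|n IH] f g; first by move=> cf cg x; apply: cvgD; [exact: cf|exact: cg].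
move=> [f' [ff' nf']] [g' [gg' ng']]; exists (f' \+ g'); split; last exact: IH.
by move=> x; have := is_deriveD (ff' x) (gg' x).
Qed.

Lemma smooth1_nM n f g : smooth1_n n f -> smooth1_n n g -> smooth1_n n (f \* g).
Proof.
elim: n f g => [|n IH] f g; first by move=> cf cg x; apply: cvgM; [exact: cf|exact: cg].
move=> hf hg; have [f' [ff' nf']] := hf; have [g' [gg' ng']] := hg.
exists (f \* g' \+ g \* f'); split; last first.
  by apply: smooth1_nD; apply: IH => //; exact: smooth1_nW.
by move=> x; have := is_deriveM (ff' x) (gg' x).
Qed.

(** [flat 0] is the classical smooth function exp(-1/z) that is flat at 0. The powers z^-m are
    included to make the family closed under differentiation up to linear combinations. *)
Definition flat (m : nat) (z : R) : R :=
  if 0 < z then z^-1 ^+ m * expR (- z^-1) else 0.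

(** From exp(y) >= y^(m+1) / (m+1)! at y = 1/z. *)
Lemma flat_le m (z : R) : `|flat m z| <= (m.+1)`!%:R * `|z|.
Proof.
rewrite /flat; case: ifPn => [z0|_]; last by rewrite normr0 mulr_ge0.
rewrite !gtr0_norm ?mulr_gt0 ?exprn_gt0 ?invr_gt0 ?expR_gt0//.
rewrite expRN -ler_pdivlMr ?invr_gt0 ?expR_gt0// invrK.
have iz0 : 0 <= z^-1 by rewrite invr_ge0 ltW.
have := expR_ge1Dxn m iz0.
set F := _`!%:R; have F0 : 0 < F by rewrite ltr0n fact_gt0.
move=> /(le_trans _) -/(_ (z^-1 ^+ m.+1 / F)); rewrite lerDr ler01 => /(_ isT) h.
have := ler_wpM2l (ltW (mulr_gt0 F0 z0)) h; apply: le_trans.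
rewrite exprS le_eqVlt; apply/orP; left; apply/eqP; field.
by rewrite !gt_eqF.
Qed.

Lemma is_derive_flat m (z : R) :
  is_derive z 1 (flat m) (- m%:R * flat m.+1 z + flat m.+2 z).
Proof.
have [z0|z0|->] := ltgtP z 0.
- rewrite {2 3}/flat ltNge (ltW z0)/= mulr0 addr0.
  have d0 : is_derive z (1 : R) (cst 0 : R -> R) 0 by exact: is_derive_cst.
  apply: near_eq_is_derive d0.
  near=> y; rewrite /flat ltNge (_ : y <= 0)//.
  by apply: ltW; near: y; exact: lt_nbhsl.
- pose f (y : R) := y^-1 ^+ m * expR (- y^-1).
  suff df : is_derive z (1 : R) f (- m%:R * flat m.+1 z + flat m.+2 z).
    apply: near_eq_is_derive df.
    by near=> y; rewrite /flat (_ : 0 < y)//; near: y; exact: lt_nbhsr.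
  have zn0 : z != 0 by rewrite gt_eqF.
  have dV : is_derive z 1 (fun y : R => y^-1) (- z ^- 2).
    split; first exact: derivableV.
    by rewrite (@deriveV _ _ id)//= derive_id /GRing.scale /= mulr1.
  have dX := is_deriveX m dV.
  have dN := is_deriveN dV.
  have dE : is_derive z 1 (expR \o (fun y : R => - y^-1)) (expR (- z^-1) * - - z ^- 2).
    exact: is_derive1_comp.
  have -> : f = (fun y : R => y^-1) ^+ m * (expR \o (fun y : R => - y^-1)).
    by apply/funext => y; rewrite !fctE.
  apply: is_derive_eq (is_deriveM dX dE) _.
  rewrite /flat z0 /= /GRing.scale /= !fctE.
  rewrite -exprVn; move: (z^-1) => q; move: (expR (- q)) => E.
  case: m {dX f} => [|m] /=; first by rewrite !expr0; ring.
  by move: (m.+1%:R) => M; rewrite !exprS; ring.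
- apply: is_derive_cvg; rewrite {2 3 4}/flat ltxx mulr0 addr0 /=.
  (* The difference quotient of [flat m] at 0 is [flat m.+1] itself, which tends to 0 by
     [flat_le]. *)
  have E h : h^-1 *: (flat m (h%:A + 0) - 0) = flat m.+1 h.
    rewrite subr0 addr0 [h%:A]mulr1 /flat; case: ifP => _; last by rewrite scaler0.
    by rewrite exprS -mulrA.
  apply/cvgr0Pnorm_le => e e0; near=> h; rewrite E.
  apply: le_trans (flat_le _ _) _; rewrite mulrC -ler_pdivlMr ?ltr0n ?fact_gt0//.
  near: h; apply: nbhs_dnbhs; apply/nbhs_ballP.
  exists (e / (m.+2)`!%:R); first by rewrite /= divr_gt0// ltr0n fact_gt0.
  by move=> h; rewrite -ball_normE /ball_ /= sub0r normrN => /ltW.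
Unshelve. all: by end_near. Qed.

Lemma smooth1_n_flat_comp n m (q : R -> R) (q' : R -> R) :
  (forall x : R, is_derive x (1 : R) q (q' x)) -> (forall k, smooth1_n k q') ->
  smooth1_n n (flat m \o q).
Proof.
move=> qq' nq'; elim: n m => [|n IH] m.
  move=> x; apply: (@continuous_comp _ _ _ q (flat m)).
    exact: is_derive_continuous (qq' x).
  exact: is_derive_continuous (is_derive_flat m (q x)).
exists ((cst (- m%:R) \* (flat m.+1 \o q) \+ (flat m.+2 \o q)) \* q').
split => [x|]; first exact: (is_derive1_comp (is_derive_flat m (q x)) (qq' x)).
apply: smooth1_nM => //; apply: smooth1_nD => //.
by apply: smooth1_nM => //; exact: smooth1_n_cst.
Qed.

Lemma flat0_ge0 (z : R) : 0 <= flat 0 z.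
Proof. by rewrite /flat; case: ifP => // _; rewrite mul1r expR_ge0. Qed.

Lemma flat0_le1 (z : R) : flat 0 z <= 1.
Proof.
rewrite /flat; case: ifP => // z0; rewrite mul1r -[leRHS]expR0 ler_expR.
by rewrite oppr_le0 invr_ge0 ltW.
Qed.

Lemma flat0_npos (z : R) : z <= 0 -> flat 0 z = 0.
Proof. by rewrite /flat ltNge => ->. Qed.

Lemma flat0_ge (z : R) : 0 < z -> 1 - z^-1 <= flat 0 z.
Proof. by move=> z0; rewrite /flat z0 mul1r expR_ge1Dx. Qed.

(** For a <= b, positive exactly on ]a - 1/(n+1), b[. The factor (n+1)^2 sends the argument of
    [flat 0] to infinity on all of [a, b[, including t = a, where the middle factor is only 1/(n+1).
    The limit is therefore the indicator of the half-open interval, which matches [box]. *)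
Definition bump1 (n : nat) (a b t : R) : R :=
  flat 0 (n.+1%:R ^+ 2 * (t - (a - n.+1%:R^-1)) * (b - t)).

Lemma smooth1_n_bump1 k n (a b : R) : smooth1_n k (bump1 n a b).
Proof.
pose c : R := n.+1%:R ^+ 2; pose al : R := a - n.+1%:R^-1.
pose q' t := c * (b + al) - 2 * c * t.
apply: (@smooth1_n_flat_comp k 0 (fun t => c * (t - al) * (b - t)) q') => [x|j].
  have -> : (fun t => c * (t - al) * (b - t)) =
      (cst c * (id - cst al) * (cst b - id) : R -> R) by [].
  apply: is_derive_eq; rewrite /q' /GRing.scale /= !fctE; ring.
have -> : q' = cst (c * (b + al)) \+ (cst (- (2 * c)) \* id).
  by apply/funext => t; rewrite /q' /= mulNr.
apply: smooth1_nD; first exact: smooth1_n_cst.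
by apply: smooth1_nM; [exact: smooth1_n_cst|exact: smooth1_n_id].
Qed.

Lemma bump1_out n (a b t : R) : a <= b -> ~~ (a - n.+1%:R^-1 <= t <= b) ->
  bump1 n a b t = 0.
Proof.
move=> ab; rewrite negb_and -!ltNge => tab; apply: flat0_npos.
have n0 : 0 < n.+1%:R^-1 :> R by rewrite invr_gt0.
rewrite -mulrA pmulr_rle0 ?exprn_gt0//.
move: (_^-1) n0 tab => r r0 /orP[h|h].
  by apply: mulr_le0_ge0; lra.
by apply: mulr_ge0_le0; lra.
Qed.

Lemma bump1_cvg (a b t : R) : a <= b ->
  bump1 n a b t @[n --> \oo] --> ((a <= t < b)%R%:R : R).
Proof.
move=> ab; have [bt|tb] := leP b t.
  rewrite andbF; apply: cvg_near_cst; apply: nearW => n; apply: flat0_npos.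
  have n0 : 0 < n.+1%:R^-1 :> R by rewrite invr_gt0.
  rewrite -mulrA pmulr_rle0 ?exprn_gt0//; move: (_^-1) n0 => r r0.
  by apply: mulr_ge0_le0; lra.
rewrite andbT; have [at_|ta] := leP a t; last first.
  have at0 : 0 < a - t by rewrite subr_gt0.
  apply: cvg_near_cst; near=> n; apply: bump1_out => //.
  rewrite negb_and -ltNge ltrBrDl -ltrBrDr; apply/orP; left.
  by near: n; exact: (near_infty_natSinv_lt (PosNum at0)).
have bt0 : 0 < b - t by rewrite subr_gt0.
apply/cvgrPdist_le => e e0; have ebt0 : 0 < e * (b - t) by rewrite mulr_gt0.
near=> n.
have n0 : 0 < n.+1%:R :> R by [].
have qn : n.+1%:R * (b - t) <= n.+1%:R ^+ 2 * (t - (a - n.+1%:R^-1)) * (b - t).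
  have nn : n.+1%:R != 0 :> R by rewrite gt_eqF.
  rewrite ler_pM2r// opprB addrCA mulrDr expr2 mulfK// lerDl.
  by rewrite !mulr_ge0// subr_ge0.
have q0 : 0 < n.+1%:R * (b - t) by rewrite mulr_gt0.
have q1 := lt_le_trans q0 qn.
rewrite ger0_norm ?subr_ge0 ?flat0_le1// lerBlDl -lerBlDr.
apply: le_trans (flat0_ge q1); rewrite lerD2l lerN2.
apply: (@le_trans _ _ (n.+1%:R * (b - t))^-1); first by rewrite lef_pV2.
rewrite invfM ler_pdivrMr//; apply: ltW; near: n.
exact: (near_infty_natSinv_lt (PosNum ebt0)).
Unshelve. all: by end_near. Qed.

End smooth_real_functions.

Section smooth_functions.
Context (R : realType) (d : nat).
Implicit Types (f g phi : 'rV[R]_d -> R) (a b c x : 'rV[R]_d) (U K : set 'rV[R]_d).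
Local Notation e_ i := (delta_mx 0 i : 'rV[R]_d).

Lemma continuous_addf f g : continuous f -> continuous g -> continuous (f \+ g).
Proof. by move=> cf cg x; exact: (cvgD (cf x) (cg x)). Qed.

Lemma continuous_mulf f g : continuous f -> continuous g -> continuous (f \* g).
Proof. by move=> cf cg x; exact: (cvgM (cf x) (cg x)). Qed.

Lemma translate_continuous c : continuous (fun x => x + c).
Proof.
by move=> x; apply: (@continuousD _ _ _ id (cst c)); [exact: cvg_id|exact: cst_continuous].
Qed.

Lemma partialE f x (i : 'I_d) (l : R) : is_derive x (e_ i) f l -> partial i f x = l.
Proof. by move=> [_ <-]. Qed.

Lemma differentiable_nP n f (F : 'I_d -> 'rV[R]_d -> R) : continuous f ->
  (forall i x, is_derive x (e_ i) f (F i x)) ->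
  (forall i, differentiable_n n (F i)) -> differentiable_n n.+1 f.
Proof.
move=> cf fF nF; split => // i; split => [x|]; first by have [] := fF i x.
by rewrite (_ : partial i f = F i)//; apply/funext => x; exact: partialE.
Qed.

Lemma differentiable_n_continuous n f : differentiable_n n f -> continuous f.
Proof. by case: n => [|n] []. Qed.

Lemma differentiable_nW n f : differentiable_n n.+1 f -> differentiable_n n f.
Proof.
elim: n f => [|n IH] f [cf fS]; first by split.
by split => // i; have [df pf] := fS i; split => //; exact: IH.
Qed.

Lemma differentiable_n_derive n f i x : differentiable_n n.+1 f ->
  is_derive x (e_ i) f (partial i f x).
Proof. by move=> [_ /(_ i)[df _]]; exact: derivableP. Qed.

Lemma differentiable_n_partial n f i :
  differentiable_n n.+1 f -> differentiable_n n (partial i f).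
Proof. by move=> [_ /(_ i)[]]. Qed.

Lemma differentiable_n_cst n (c : R) : differentiable_n n (cst c : 'rV[R]_d -> R).
Proof.
elim: n c => [|n IH] c; first by split => // x; exact: cst_continuous.
apply: (differentiable_nP (F := fun=> cst 0)); first exact: cst_continuous.
by move=> i; exact: IH.
Qed.

Lemma differentiable_nD n f g : differentiable_n n f -> differentiable_n n g ->
  differentiable_n n (f \+ g).
Proof.
elim: n f g => [|n IH] f g nf ng.
  by split => //; exact: continuous_addf (proj1 nf) (proj1 ng).
apply: (differentiable_nP (F := fun i => partial i f \+ partial i g)) => [x|i x|i].
- exact: continuous_addf (differentiable_n_continuous nf) (differentiable_n_continuous ng) x.
- by have := is_deriveD (differentiable_n_derive i x nf) (differentiable_n_derive i x ng).
- by apply: IH; exact: differentiable_n_partial.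
Qed.

Lemma differentiable_nM n f g : differentiable_n n f -> differentiable_n n g ->
  differentiable_n n (f \* g).
Proof.
elim: n f g => [|n IH] f g nf ng.
  by split => //; exact: continuous_mulf (proj1 nf) (proj1 ng).
apply: (differentiable_nP
    (F := fun i => f \* partial i g \+ g \* partial i f)) => [x|i x|i].
- exact: continuous_mulf (differentiable_n_continuous nf) (differentiable_n_continuous ng) x.
- by have := is_deriveM (differentiable_n_derive i x nf) (differentiable_n_derive i x ng).
- apply: differentiable_nD; apply: IH.
  + exact: differentiable_nW.
  + exact: differentiable_n_partial.
  + exact: differentiable_nW.
  + exact: differentiable_n_partial.
Qed.

Lemma is_derive_translate f c x v (l : R) : is_derive (x + c) v f l ->
  is_derive x v (fun y => f (y + c)) l.
Proof.
move=> [df fl].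
have E : (fun h : R => h^-1 *: (((fun y => f (y + c)) \o shift x) (h *: v) - f (x + c)))
  = (fun h => h^-1 *: ((f \o shift (x + c)) (h *: v) - f (x + c))).
  by apply/funext => h /=; rewrite addrA.
by split; rewrite /derivable /derive E.
Qed.

Lemma differentiable_n_translate n f c : differentiable_n n f ->
  differentiable_n n (fun x => f (x + c)).
Proof.
have ct g : continuous g -> continuous (fun x => g (x + c)).
  move=> cg x; apply: (@continuous_comp _ _ _ (fun x => x + c) g); last exact: cg.
  exact: translate_continuous.
elim: n f => [|n IH] f nf; first by split => //; exact: (ct _ (differentiable_n_continuous nf)).
apply: (differentiable_nP (F := fun i y => partial i f (y + c))) => [|i x|i].
- by exact: (ct _ (differentiable_n_continuous nf)).
- exact: is_derive_translate (differentiable_n_derive i (x + c) nf).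
- by apply: IH; exact: differentiable_n_partial.
Qed.

Lemma coord_row_continuous (j : 'I_d) : continuous (fun x : 'rV[R]_d => x 0 j).
Proof. exact: coord_continuous. Qed.

Lemma is_derive_coord (f : R -> R) (i j : 'I_d) x (l : R) :
  is_derive (x 0 j) (1 : R) f l ->
  is_derive x (e_ i) (fun y => f (y 0 j)) (if i == j then l else 0).
Proof.
move=> [df fl]; case: eqP => [->|/eqP ij].
  have E : (fun h : R => h^-1 *: (((fun y => f (y 0 j)) \o shift x) (h *: e_ j) - f (x 0 j)))
    = (fun h => h^-1 *: ((f \o shift (x 0 j)) (h *: 1) - f (x 0 j))).
    by apply/funext => h /=; rewrite !mxE !eqxx.
  by split; rewrite /derivable /derive E.
apply: is_derive_cvg.
rewrite [X in X @ _](_ : _ = cst 0); first exact: cvg_cst.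
apply/funext => h /=; rewrite !mxE eqxx /= [j == i]eq_sym (negbTE ij).
by rewrite mulr0 add0r subrr scaler0.
Qed.

Lemma differentiable_n_coord n (f : R -> R) (j : 'I_d) : smooth1_n n f ->
  differentiable_n n (fun x => f (x 0 j)).
Proof.
have cc (g : R -> R) : continuous g -> continuous (fun x : 'rV[R]_d => g (x 0 j)).
  move=> cg x; apply: (@continuous_comp _ _ _ (fun x : 'rV[R]_d => x 0 j) g).
    exact: coord_row_continuous.
  exact: cg.
elim: n f => [|n IH] f nf; first by split => //; exact: cc.
have [f' [ff' nf']] := nf.
apply: (differentiable_nP (F := fun i x => if i == j then f' (x 0 j) else 0)).
- by apply: cc; exact: smooth1_n_continuous nf.
- by move=> i x; apply: is_derive_coord; exact: ff'.
- by move=> i; case: eqP => _; [exact: IH|exact: differentiable_n_cst].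
Qed.

Lemma smooth_prod_coord (s : seq 'I_d) (f : 'I_d -> R -> R) :
  (forall i n, smooth1_n n (f i)) ->
  smooth (fun x : 'rV[R]_d => \prod_(i <- s) f i (x 0 i)).
Proof.
move=> nf n; elim: s => [|i s IH].
  rewrite (_ : (fun _ => _) = cst 1); first exact: differentiable_n_cst.
  by apply/funext => x; rewrite big_nil.
rewrite (_ : (fun _ => _) =
    (fun x => f i (x 0 i)) \* (fun x => \prod_(i <- s) f i (x 0 i))); last first.
  by apply/funext => x; rewrite big_cons.
by apply: differentiable_nM => //; exact: differentiable_n_coord.
Qed.

Lemma test_functionS U U' phi : U `<=` U' -> test_function U phi -> test_function U' phi.
Proof.
move=> UU' [sphi [K [cK KU phi0]]]; split => //; exists K; split => //.
exact: subset_trans UU'.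
Qed.

Lemma test_functionD U f g : test_function U f -> test_function U g ->
  test_function U (f \+ g).
Proof.
move=> [sf [K [cK KU f0]]] [sg [K' [cK' KU' g0]]]; split.
  by move=> n; exact: differentiable_nD.
exists (K `|` K'); split.
- exact: compactU.
- by move=> x [/KU|/KU'].
- by move=> x /not_orP[? ?] /=; rewrite f0// g0// addr0.
Qed.

Lemma test_functionM U f g : test_function U f -> smooth g ->
  test_function U (f \* g).
Proof.
move=> [sf [K [cK KU f0]]] sg; split; first by move=> n; exact: differentiable_nM.
by exists K; split => // x Kx /=; rewrite f0// mul0r.
Qed.

Lemma test_function_partial U phi i : test_function U phi ->
  test_function U (partial i phi).
Proof.
move=> [sphi [K [cK KU phi0]]]; split.
  by move=> n; exact: differentiable_n_partial (sphi n.+1).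
exists K; split => // x Kx; apply: partialE.
have oK : open (~` K).
  by apply: closed_openC; apply: compact_closed => //; exact: norm_hausdorff.
have d0 : is_derive x (e_ i) (cst 0 : 'rV[R]_d -> R) 0 by exact: is_derive_cst.
apply: near_eq_is_derive d0.
by near=> y; rewrite phi0//; near: y; exact: open_nbhs_nbhs.
Unshelve. all: by end_near. Qed.

Lemma test_function_translate U U' phi c : test_function U phi ->
  (forall x, U x -> U' (x - c)) ->
  test_function U' (fun x => phi (x + c)).
Proof.
move=> [sphi [K [cK KU phi0]]] UU'; split.
  by move=> n; exact: differentiable_n_translate.
exists ((fun x => x - c) @` K); split.
- by apply: continuous_compact => //; apply: continuous_subspaceT; exact: translate_continuous.
- by move=> _ [x Kx <-]; apply: UU'; exact: KU.
- move=> x Kx; apply: phi0 => Kxc; apply: Kx; exists (x + c) => //.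
  by rewrite addrK.
Qed.

Lemma continuous_compact_bounded K phi : compact K -> continuous phi ->
  exists M : R, forall x, K x -> `|phi x| <= M.
Proof.
move=> cK cphi.
have /compact_bounded[M [_ HM]] : compact (phi @` K).
  by apply: continuous_compact => //; exact: continuous_subspaceT.
exists (M + 1) => x Kx; apply: HM; last by exists x.
by rewrite ltrDl.
Qed.

Lemma test_function_bounded U phi : test_function U phi ->
  exists2 M : R, 0 < M & forall x, `|phi x| <= M.
Proof.
move=> [sphi [K [cK KU phi0]]].
have [M HM] := continuous_compact_bounded cK (differentiable_n_continuous (sphi 0%N)).
exists (`|M| + 1) => [|x]; first by rewrite ltr_pwDr.
have [Kx|/phi0 ->] := pselect (K x).
  apply: le_trans (HM _ Kx) _; apply: le_trans (ler_norm _) _.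
  by rewrite lerDl.
by rewrite normr0 addr_ge0.
Qed.

Definition bump (n : nat) (a b x : 'rV[R]_d) : R :=
  \prod_(i < d) bump1 n (a 0 i) (b 0 i) (x 0 i).

Lemma bump01 n a b x : 0 <= bump n a b x <= 1.
Proof.
rewrite /bump; apply/andP; split.
  by apply: prodr_ge0 => i _; exact: flat0_ge0.
rewrite -[leRHS](@big1_eq _ _ *%R 'I_d (index_enum 'I_d) xpredT).
by apply: ler_prod => i _; rewrite flat0_ge0 flat0_le1.
Qed.

Lemma bump_out n a b x : (forall i, a 0 i <= b 0 i) ->
  ~ cbox (a - const_mx n.+1%:R^-1) b x -> bump n a b x = 0.
Proof.
move=> ab /existsNP[i xi]; rewrite /bump (bigD1 i)//= bump1_out ?mul0r//.
by apply/negP; move: xi; rewrite !mxE.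
Qed.

Lemma bump_test n a b U : (forall i, a 0 i <= b 0 i) ->
  cbox (a - const_mx n.+1%:R^-1) b `<=` U -> test_function U (bump n a b).
Proof.
move=> ab abU; split.
  exact: (@smooth_prod_coord (index_enum 'I_d) (fun i => bump1 n (a 0 i) (b 0 i))
    (fun i k => smooth1_n_bump1 k n (a 0 i) (b 0 i))).
exists (cbox (a - const_mx n.+1%:R^-1) b); split => //; first exact: compact_cbox.
by move=> x; exact: bump_out.
Qed.

Lemma bump_cvg a b x : (forall i, a 0 i <= b 0 i) ->
  bump n a b x @[n --> \oo] --> (\1_(box a b) x : R).
Proof.
move=> ab.
have -> : (\1_(box a b) x : R) = \prod_(i < d) (a 0 i <= x 0 i < b 0 i)%R%:R.
  rewrite indicE; case: (boolP (x \in _)); rewrite ?inE ?notin_setE => xab.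
    by rewrite big1// => i _; rewrite (xab i).
  have /existsNP[i /negP xi] := xab.
  by rewrite (bigD1 i)//= (negbTE xi) mul0r.
rewrite /bump; elim: (index_enum _) => [|i s IH].
  under eq_fun do rewrite big_nil.
  by rewrite big_nil; exact: cvg_cst.
under eq_fun do rewrite big_cons.
by rewrite big_cons; apply: cvgM => //; exact: bump1_cvg.
Qed.

End smooth_functions.

(** * Integrals of nonnegative functions *)

Section nonnegative_integrals.
Context (disp : measure_display) (T : measurableType disp) (R : realType).
Context (mu : {measure set T -> \bar R}) (D : set T).
Hypothesis mD : measurable D.
Implicit Types f g h : T -> R.

Lemma ge0_le_integral_EFin f g : measurable_fun D f -> measurable_fun D g ->
  (forall x, D x -> 0 <= f x <= g x) ->
  (\int[mu]_(x in D) (f x)%:E <= \int[mu]_(x in D) (g x)%:E)%E.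
Proof.
move=> mf mg fg; apply: ge0_le_integral => //.
- by move=> x /fg/andP[]; rewrite lee_fin.
- exact/measurable_EFinP.
- exact/measurable_EFinP.
- by move=> x /fg/andP[]; rewrite lee_fin.
Qed.

Lemma ge0_integralD_EFin f g : measurable_fun D f -> measurable_fun D g ->
  (forall x, D x -> 0 <= f x) -> (forall x, D x -> 0 <= g x) ->
  (\int[mu]_(x in D) (f x + g x)%:E =
   \int[mu]_(x in D) (f x)%:E + \int[mu]_(x in D) (g x)%:E)%E.
Proof.
move=> mf mg f0 g0; under eq_integral do rewrite EFinD.
by rewrite ge0_integralD//; exact/measurable_EFinP.
Qed.

Lemma ge0_integralZl_EFin' f (k : R) : measurable_fun D f -> 0 <= k ->
  (forall x, D x -> 0 <= f x) ->
  (\int[mu]_(x in D) (k * f x)%:E = k%:E * \int[mu]_(x in D) (f x)%:E)%E.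
Proof.
move=> mf k0 f0; under eq_integral do rewrite EFinM.
by rewrite ge0_integralZl_EFin//; exact/measurable_EFinP.
Qed.

Lemma ge0_integral_le_add h f g :
  measurable_fun D h -> measurable_fun D f -> measurable_fun D g ->
  (forall x, D x -> 0 <= f x) -> (forall x, D x -> 0 <= g x) ->
  (forall x, D x -> 0 <= h x <= f x + g x) ->
  (\int[mu]_(x in D) (h x)%:E <=
   \int[mu]_(x in D) (f x)%:E + \int[mu]_(x in D) (g x)%:E)%E.
Proof.
move=> mh mf mg f0 g0 hfg; rewrite -ge0_integralD_EFin//.
by apply: ge0_le_integral_EFin => //; exact: measurable_funD.
Qed.

Lemma measurable_fun_norm f : measurable_fun D f -> measurable_fun D (fun x => `|f x|).
Proof. by move=> mf; exact: measurableT_comp. Qed.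

Lemma measurable_fun_normB f g : measurable_fun D f -> measurable_fun D g ->
  measurable_fun D (fun x => `|f x - g x|).
Proof. by move=> mf mg; apply: measurable_fun_norm; exact: measurable_funB. Qed.

End nonnegative_integrals.

Lemma finite_indic_integrable (disp : measure_display) (T : measurableType disp)
    (R : realType) (mu : {measure set T -> \bar R}) (C : set T) :
  measurable C -> (mu C < +oo)%E -> mu.-integrable setT (EFin \o (\1_C : T -> R)).
Proof.
move=> mC Coo; apply/integrableP; split.
  by apply/measurable_EFinP; exact: measurable_indic.
under eq_integral do rewrite /= ger0_norm//.
by rewrite integral_indic// setIT.
Qed.

Lemma indic01 (R : realType) (X : Type) (A : set X) (x : X) :
  0 <= (\1_A x : R) <= 1.
Proof. by rewrite indicE; case: (x \in A); rewrite ?lexx ?ler01. Qed.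

Lemma cvge0_ex (R : realType) (u : nat -> \bar R) (e : R) :
  (u n @[n --> \oo] --> 0)%E -> 0 < e -> exists n, (u n <= e%:E)%E.
Proof.
move=> /fine_cvgP[[N _ finN] cv] e0.
have /cvgrPdist_le/(_ _ e0)[M _ HM] := cv.
exists (maxn N M); have := HM (maxn N M) (leq_maxr _ _).
rewrite /= sub0r normrN => /(le_trans (ler_norm _)).
by rewrite -lee_fin fineK//; apply: finN; exact: leq_maxl.
Qed.

Lemma leb_box_cover (R : realType) (d : nat) (A : set 'rV[R]_d) (e : R) :
  (0 < d)%N -> 0 < e -> (leb R d A < +oo)%E ->
  exists a b : nat -> 'rV[R]_d, [/\ forall k i, a k 0 i <= b k 0 i,
    A `<=` \bigcup_k box (a k) (b k)
  & (\sum_(k <oo) leb R d (box (a k) (b k)) <= leb R d A + e%:E)%E].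
Proof.
move=> d0 e0 LA; have LA0 : (0 <= leb R d A)%E by exact: outer_measure_ge0.
have LAfin : leb R d A \is a fin_num by rewrite ge0_fin_numE.
have e2 : 0 < e / 2 by rewrite divr_gt0.
have [_ [F [_ AF] <-] ltF] := lb_ereal_inf_adherent e2 LAfin.
have F0 k : (0 <= box_volume (F k))%E by exact: box_volume_ge0.
set S := (X in (X < _)%E) in ltF.
have Soo : (S < +oo)%E.
  by apply: lt_trans ltF _; rewrite lte_add_pinfty// ltry.
have Foo k : (box_volume (F k) < +oo)%E.
  rewrite ltey; apply/eqP => Fk; move: Soo.
  by rewrite /S (@nneseries_pinfty _ _ xpredT k)// ltxx.
pose h k : R := (e / 2) / (2 ^ k.+1)%:R.
have h0 k : 0 < h k by rewrite divr_gt0// ltr0n expn_gt0.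
have [a /choice[b Hab]] := choice (fun k => box_volume_adherent d0 (h0 k) (Foo k)).
exists a, b; split => [k|x /AF[k _ Fk]|]; first by have [] := Hab k.
  by exists k => //; have [_ + _] := Hab k; exact.
have -> : (leb R d A + e%:E = leb R d A + (e / 2)%:E + (e / 2)%:E)%E.
  by rewrite -addeA -EFinD -splitr.
apply: le_trans (leeD (ltW ltF) (lexx _)).
have := @epsilon_trick R (fun k => box_volume (F k)) (e / 2) xpredT F0 (ltW e2).
apply: le_trans; apply: lee_nneseries => [k _ _|k _]; first exact: outer_measure_ge0.
by have [ab _ +] := Hab k; apply: le_trans; exact: leb_box.
Qed.

(** * Approximation in L^1 *)

Section approximation_by_test_functions.
Context (R : realType) (d : nat).
Hypothesis d_gt0 : (0 < d)%N.
Local Notation L := (leb R d).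
Local Notation T := (caratheodory_type (lebesgue_outer R d)).
Implicit Types (a b c x : 'rV[R]_d) (A B U K : set 'rV[R]_d) (f phi : 'rV[R]_d -> R).

Lemma continuous_leb_measurable f (D : set T) :
  continuous f -> @measurable_fun _ _ T _ D f.
Proof.
move=> cf; apply: (@measurable_funS _ _ T _ setT) => //.
apply: continuous_caratheodory; last exact: continuous_subspaceT.
exact: measurable_open.
Qed.

Lemma test_function_measurable U phi (D : set T) : test_function U phi ->
  @measurable_fun _ _ T _ D phi.
Proof.
by move=> [/(_ 0%N)/differentiable_n_continuous cphi _]; exact: continuous_leb_measurable.
Qed.

(** The bounds 0 <= phi <= 1 are part of the notion because they control products in the treatment
    of unions, and because the fundamental lemma tests with functions bounded by 1. *)
Definition test_approx U A := forall e : R, 0 < e -> exists phi,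
  [/\ test_function U phi, forall x, 0 <= phi x <= 1
    & (\int[L]_x (`|\1_A x - phi x|%R)%:E <= e%:E)%E].

Lemma measurable_indic_sub U A phi : measurable (A : set T) -> test_function U phi ->
  @measurable_fun _ _ T _ setT (fun x => `|\1_A x - phi x|).
Proof.
move=> mA tphi; apply: measurable_fun_normB; first exact: measurable_indic.
exact: test_function_measurable tphi.
Qed.

Lemma test_approx0 U : test_approx U set0.
Proof.
move=> e e0; exists (cst 0); split.
- split; first by move=> n; exact: differentiable_n_cst.
  by exists set0; split => //; exact: compact0.
- by move=> x; rewrite lexx ler01.
- rewrite integral0_eq ?lee_fin ?ltW// => x _.
  by rewrite indicE in_set0 subr0 normr0.
Qed.

Lemma test_approx_box U a b (e : R) : 0 < e -> (forall i, a 0 i <= b 0 i) ->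
  cbox (a - const_mx e) b `<=` U -> test_approx U (box a b).
Proof.
move=> e0 ab abU; have [n0 n0e] := ex_invS_lt e0.
(* Starting the sequence of bumps at [n0], where 1/(n0+1) < e, keeps all supports in this compact
   subset of U, whose indicator dominates them. *)
pose C := cbox (a - const_mx e) b.
have sub n : cbox (a - const_mx (n0 + n).+1%:R^-1) b `<=` C.
  move=> x xab i; have := xab i; rewrite !mxE => /andP[+ ->]; rewrite andbT.
  apply: le_trans; rewrite lerB// (le_trans _ (ltW n0e))// lef_pV2 ?posrE//.
  by rewrite ler_nat ltnS leq_addr.
have bT n : test_function U (bump (n0 + n) a b).
  by apply: bump_test => //; exact: subset_trans (sub n) abU.
have mC : measurable (C : set T) by apply: measurable_compact; exact: compact_cbox.
have mbox : measurable (box a b : set T) by exact: measurable_box.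
have iC : L.-integrable setT (EFin \o (\1_C : T -> R)).
  by apply: finite_indic_integrable => //; exact: leb_compact (@compact_cbox _ _ _ _).
have bC n x : ~ C x -> bump (n0 + n) a b x = 0.
  by move=> Cx; apply: bump_out => // /sub.
have boxC : box a b `<=` C.
  move=> x xab i; have := xab i; rewrite !mxE => /andP[ax /ltW ->]; rewrite andbT.
  by rewrite (le_trans _ ax)// gerBl ltW.
have mb n : @measurable_fun _ _ T _ setT (bump (n0 + n) a b).
  exact: test_function_measurable (bT n).
have [_ cv _] : [/\ L.-integrable setT (EFin \o (\1_(box a b) : T -> R)),
    (\int[L]_x `|(bump (n0 + n) a b x)%:E - (\1_(box a b) x)%:E| @[n --> \oo] --> 0)%E
  & (\int[L]_x (bump (n0 + n) a b x)%:E @[n --> \oo] -->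
     \int[L]_x (\1_(box a b) x)%:E)%E].
  apply: (@dominated_convergence _ T R L setT measurableT
      (fun n => EFin \o bump (n0 + n) a b) (EFin \o \1_(box a b)) (EFin \o \1_C)).
  - by move=> n; apply/measurable_EFinP.
  - by apply/measurable_EFinP; exact: measurable_indic.
  - apply/aeW => x _; apply: cvg_EFin; first exact: nearW.
    have := @bump_cvg R d a b x ab.
    by rewrite -(cvg_shiftn n0); under eq_fun do rewrite addnC.
  - exact: iC.
  - apply/aeW => x n _; rewrite lee_fin /=.
    have /andP[b0 b1] := bump01 (n0 + n) a b x.
    have [Cx|Cx] := pselect (C x); first by rewrite indicE mem_set// ger0_norm.
    by rewrite bC// normr0.
move=> e' e'0; have [n nn] := cvge0_ex cv e'0.
exists (bump (n0 + n) a b); split => //; first by move=> x; exact: bump01.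
move: nn; congr (_ <= _)%E; apply: eq_integral => x _.
by rewrite -EFinB /= distrC.
Qed.

Lemma test_approxU U A B : measurable (A : set T) -> measurable (B : set T) ->
  test_approx U A -> test_approx U B -> test_approx U (A `|` B).
Proof.
move=> mA mB aA aB e e0; have e2 : 0 < e / 2 by rewrite divr_gt0.
have [f [tf f01 fA]] := aA _ e2; have [g [tg g01 gB]] := aB _ e2.
(* This is 1 - (1 - f)(1 - g), modelled on the indicator of a union; written as f + g (1 - f) it is
   visibly a test function. *)
pose h := f \+ (g \* (cst 1 \+ (cst (-1) \* f))).
have th : test_function U h.
  apply: (test_functionD tf); apply: (test_functionM tg) => n.
  apply: differentiable_nD; first exact: differentiable_n_cst.
  apply: differentiable_nM; first exact: differentiable_n_cst.
  exact: (proj1 tf n).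
exists h; split; first exact: th.
- by move=> x /=; have := f01 x; have := g01 x; rewrite /h /=; nra.
- have mf := measurable_indic_sub mA tf; have mg := measurable_indic_sub mB tg.
  have mh := measurable_indic_sub (measurableU _ _ mA mB) th.
  apply: (@le_trans _ _ ((e / 2)%:E + (e / 2)%:E)%E); last first.
    by rewrite -EFinD -splitr.
  apply: le_trans (leeD fA gB).
  have := @ge0_integral_le_add _ T R L setT measurableT _ _ _ mh mf mg; apply => [x _|x _|x _].
  - exact: normr_ge0.
  - exact: normr_ge0.
  rewrite normr_ge0 /= /h /=.
  have -> : \1_(A `|` B) x = 1 - (1 - \1_A x) * (1 - \1_B x) :> R.
    rewrite !indicE in_setU; case: (x \in A); case: (x \in B) => /=; ring.
  have /andP[g0 g1] := g01 x; have /andP[f0 f1] := f01 x.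
  move: (indic01 R A x) (indic01 R B x).
  move: (\1_A x) (\1_B x) (f x) (g x) f0 f1 g0 g1 => p q u v ? ? ? ? /andP[? ?] /andP[? ?].
  have -> : 1 - (1 - p) * (1 - q) - (u + v * (1 + -1 * u)) =
     (p - u) * (1 - q) + (q - v) * (1 - u) by ring.
  apply: le_trans (ler_normD _ _) _; rewrite !normrM; apply: lerD.
    by rewrite ler_piMr// ger0_norm; lra.
  by rewrite ler_piMr// ger0_norm; lra.
Qed.

Lemma test_approx_bigsetU U (F : nat -> set T) n :
  (forall k, measurable (F k)) -> (forall k, test_approx U (F k)) ->
  test_approx U (\big[setU/set0]_(k < n) F k).
Proof.
move=> mF aF; elim: n => [|n IH]; first by rewrite big_ord0; exact: test_approx0.
rewrite big_ord_recr /=; apply: test_approxU => //.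
by apply: bigsetU_measurable.
Qed.

Lemma test_approx_close U A : measurable (A : set T) ->
  (forall e : R, 0 < e -> exists B, [/\ measurable (B : set T), test_approx U B
     & (L (A `\` B) + L (B `\` A) <= e%:E)%E]) -> test_approx U A.
Proof.
move=> mA hA e e0; have e2 : 0 < e / 2 by rewrite divr_gt0.
have [B [mB aB AB]] := hA _ e2; have [f [tf f01 fB]] := aB _ e2.
exists f; split => //.
have mAB : measurable (A `\` B : set T) by exact: measurableD.
have mBA : measurable (B `\` A : set T) by exact: measurableD.
apply: (@le_trans _ _ ((e / 2)%:E + (e / 2)%:E)%E); last first.
  by rewrite -EFinD -splitr.
apply: le_trans (leeD AB fB).
have -> : (L (A `\` B) + L (B `\` A))%E =
    (\int[L]_x (\1_(A `\` B) x + \1_(B `\` A) x)%:E)%E.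
  rewrite ge0_integralD_EFin//; try exact: measurable_indic.
  by rewrite !integral_indic// !setIT.
have mAB' : @measurable_fun _ _ T _ setT
    (fun x => \1_(A `\` B) x + \1_(B `\` A) x : R).
  by apply: measurable_funD; exact: measurable_indic.
have := @ge0_integral_le_add _ T R L setT measurableT _ _ _
  (measurable_indic_sub mA tf) mAB' (measurable_indic_sub mB tf).
apply => [x _|x _|x _].
- exact: addr_ge0.
- exact: normr_ge0.
- rewrite normr_ge0 /=.
  have -> : \1_A x - f x = (\1_A x - \1_B x) + (\1_B x - f x) by ring.
  apply: le_trans (ler_normD _ _) _; rewrite lerD2r.
  rewrite !indicE !in_setD; case: (x \in A); case: (x \in B) => /=;
    rewrite ?subrr ?normr0 ?addr0 ?add0r ?subr0 ?sub0r ?normrN ?normr1 ?ler01//.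
Qed.

Lemma setI_box a b a' b' : box a b `&` box a' b' =
  box (\row_i Num.max (a 0 i) (a' 0 i)) (\row_i Num.min (b 0 i) (b' 0 i)).
Proof.
apply/seteqP; split => [x [xab xab'] i|x xab].
  have /andP[h1 h2] := xab i; have /andP[h3 h4] := xab' i.
  by rewrite !mxE ge_max lt_min h1 h2 h3 h4.
split => i; have := xab i; rewrite !mxE ge_max lt_min => /andP[/andP[h1 h2] /andP[h3 h4]].
  by rewrite h1 h3.
by rewrite h2 h4.
Qed.

(** A is covered by countably many boxes of total measure at most L A + t/3. Cut down to [box a b],
    they have a union BB, and a finite subunion B misses at most t/3 of BB; then both A minus B and
    B minus A have measure at most t/3. The cut boxes keep a margin e inside U, so each of them can
    be approximated. *)
Lemma test_approx_subbox U a b (e : R) A : 0 < e ->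
  cbox (a - const_mx e) b `<=` U -> measurable (A : set T) -> A `<=` box a b ->
  test_approx U A.
Proof.
move=> e0 abU mA Aab; apply: (test_approx_close mA) => t t0.
have t3 : 0 < t / 3 by rewrite divr_gt0.
have LA : (L A < +oo)%E.
  have ccab : compact (cbox a b) by exact: compact_cbox.
  apply: le_lt_trans (leb_compact ccab); apply: le_outer_measure => x /Aab xab i.
  by have /andP[-> /ltW ->] := xab i.
have LA0 : (0 <= L A)%E by exact: outer_measure_ge0.
have LAfin : L A \is a fin_num by rewrite ge0_fin_numE.
have [a' [b' [ab' Acov Lcov]]] := leb_box_cover d_gt0 t3 LA.
pose Q k := box (a' k) (b' k) `&` box a b.
have mQ k : measurable (Q k : set T) by apply: measurableI; exact: measurable_box.
have aQ k : test_approx U (Q k).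
  rewrite /Q setI_box; set a'' := \row_i _; set b'' := \row_i _.
  have [ab''|/existsNP[i /negP nab'']] := pselect (forall i, a'' 0 i <= b'' 0 i).
    apply: (test_approx_box e0 ab''); apply: subset_trans abU => x xab i.
    have := xab i; rewrite !mxE => /andP[+ +]; rewrite lerBlDr ge_max => /andP[_].
    by rewrite -lerBlDr => ->; rewrite le_min => /andP[_ ->].
  rewrite (_ : box _ _ = set0); first exact: test_approx0.
  apply/seteqP; split => // x /(_ i) /andP[h1 h2].
  by move: nab''; rewrite (le_trans h1 (ltW h2)).
pose B n := \big[setU/set0]_(k < n) Q k.
have mB n : measurable (B n : set T) by apply: bigsetU_measurable.
pose BB := \bigcup_k Q k.
have mBB : measurable (BB : set T) by exact: bigcupT_measurable.
have ABB : A `<=` BB.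
  by move=> x Ax; have [k _ xk] := Acov x Ax; exists k => //; split => //; exact: Aab.
have LBB : (L BB <= L A + (t / 3)%:E)%E.
  apply: le_trans Lcov.
  apply: le_trans (outer_measure_sigma_subadditive (lebesgue_outer R d) Q) _.
  apply: lee_nneseries => [k _ _|k _]; first exact: outer_measure_ge0.
  by apply: (le_outer_measure (lebesgue_outer R d)) => x [].
have BE : \bigcup_n B n = BB.
  apply/seteqP; split => [x [n _]|x [k _ Qk]].
    by rewrite /B -bigcup_mkord => -[k _ Qk]; exists k.
  by exists k.+1 => //; rewrite /B -bigcup_mkord; exists k => //=.
have cvB : L (B n) @[n --> \oo] --> L BB.
  rewrite -BE; apply: (@nondecreasing_cvg_mu _ T R L B) => //.
    by rewrite BE.
  by move=> m n mn; apply/subsetPset; exact: subset_bigsetU.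
have LBBfin : L BB \is a fin_num.
  rewrite ge0_fin_numE ?outer_measure_ge0//; apply: le_lt_trans LBB _.
  by rewrite lte_add_pinfty// ltry.
have BsubBB n : B n `<=` BB by rewrite -BE; exact: bigcup_sup.
have [n Hn] : exists n, (L BB - L (B n) <= (t / 3)%:E)%E.
  apply: cvge0_ex t3.
  rewrite -(subee LBBfin); apply: cvgeB => //; first by rewrite fin_num_adde_defr.
  exact: cvg_cst.
exists (B n); split; first exact: mB.
  by apply: test_approx_bigsetU.
have LD (C D : set T) : measurable C -> measurable D -> C `<=` D ->
    L D \is a fin_num -> L (D `\` C) = (L D - L C)%E.
  move=> mC mD CD finD; rewrite measureD//; last by rewrite -ge0_fin_numE.
  by rewrite setIidr.
have h1 : (L (A `\` B n) <= (t / 3)%:E)%E.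
  apply: le_trans Hn; rewrite -(LD _ _ (mB n) mBB (BsubBB n) LBBfin).
  by apply: (le_outer_measure (lebesgue_outer R d)); exact: setSD.
have h2 : (L (B n `\` A) <= (t / 3)%:E)%E.
  have : (L BB - L A <= (t / 3)%:E)%E by rewrite leeBlDl.
  apply: le_trans; rewrite -(LD _ _ mA mBB ABB LBBfin).
  by apply: (le_outer_measure (lebesgue_outer R d)); exact: setSD.
by apply: le_trans (leeD h1 h2) _; rewrite -EFinD lee_fin; lra.
Qed.

Lemma test_approx_compact U A K : open U -> compact K -> K `<=` U ->
  measurable (A : set T) -> A `<=` K -> test_approx U A.
Proof.
move=> oU cK KU mA AK; move/open_rowP : (oU) => oU'.
have /choice[r Hr] : forall x : 'rV[R]_d, exists e : R, 0 < e /\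
    (K x -> forall y : 'rV[R]_d, (forall i : 'I_d, `|x 0 i - y 0 i| < e) -> U y).
  move=> x; have [Kx|Kx] := pselect (K x); last by exists 1.
  by have [e e0 xe] := oU' _ (KU _ Kx); exists e.
have r0 x : 0 < r x by have [] := Hr x.
(* Radius r/4, so that the cube around x still lies in U when it is enlarged by the margin r/4. *)
pose O x := [set y : 'rV[R]_d | forall i, `|x 0 i - y 0 i| < r x / 4].
have oO x : K x -> open (O x).
  move=> _; apply/open_rowP => y Oy.
  have e0 : 0 < \big[Num.min/1]_(i < d) (r x / 4 - `|x 0 i - y 0 i|).
    by apply/bigmin_gtP; split => // i _; rewrite subr_gt0; exact: Oy.
  exists (\big[Num.min/1]_(i < d) (r x / 4 - `|x 0 i - y 0 i|)) => // z yz i.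
  have : `|y 0 i - z 0 i| < r x / 4 - `|x 0 i - y 0 i|.
    by apply: lt_le_trans (yz i) _; exact: bigmin_le_cond.
  rewrite ltrBrDl; apply: le_lt_trans.
  by rewrite -[x 0 i - z 0 i](subrKA (y 0 i)); exact: ler_normD.
have Kcov : K `<=` cover K O.
  by move=> x Kx; exists x => // i; rewrite subrr normr0 divr_gt0.
have [D DK Dcov] : finite_subset_cover K O K by move: cK; rewrite compact_cover; exact.
pose Q x := box (x - const_mx (r x / 4)) (x + const_mx (r x / 4)).
have aQ x : K x -> test_approx U (A `&` Q x).
  move=> Kx; have r4 : 0 < r x / 4 by rewrite divr_gt0.
  apply: (@test_approx_subbox U (x - const_mx (r x / 4)) (x + const_mx (r x / 4)) (r x / 4)) => //.
  - move=> y xy; have [_ /(_ Kx)] := Hr x; apply=> i; have := xy i.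
    rewrite !mxE => /andP[? ?]; have := r0 x.
    by rewrite ltr_norml => ?; apply/andP; split; lra.
  - by apply: measurableI => //; exact: measurable_box.
have -> : A = \big[setU/set0]_(x <- finmap.enum_fset D) (A `&` Q x).
  rewrite -bigcup_seq; apply/seteqP; split => [x Ax|x [z _ []]//].
  have [z zD Oz] := Dcov _ (AK _ Ax); exists z => //; split => // i.
  by have := Oz i; rewrite !mxE ltr_norml => /andP[? ?]; apply/andP; split; lra.
have : forall x, x \in finmap.enum_fset D -> K x.
  by move=> x xD; have := DK x xD; rewrite inE.
elim: (finmap.enum_fset D) => [_|x s IH Ks].
  by rewrite big_nil; exact: test_approx0.
rewrite big_cons; apply: test_approxU.
- by apply: measurableI => //; exact: measurable_box.
- by apply: bigsetU_measurable => z _; apply: measurableI => //; exact: measurable_box.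
- by apply: aQ; apply: Ks; rewrite inE eqxx.
- by apply: IH => z zs; apply: Ks; rewrite inE zs orbT.
Qed.

End approximation_by_test_functions.

(** * Integrable functions and uniform integrability *)

Section integrable_functions.
Context (disp : measure_display) (T : measurableType disp) (R : realType).
Context (mu : {measure set T -> \bar R}) (D : set T).
Hypothesis mD : measurable D.
Implicit Types f g h : T -> R.

Lemma integrable_measurable f : mu.-integrable D (EFin \o f) -> measurable_fun D f.
Proof. by move=> /integrableP[/measurable_EFinP]. Qed.

Lemma integrable_lty_norm f : mu.-integrable D (EFin \o f) ->
  (\int[mu]_(x in D) (`|f x|%R)%:E < +oo)%E.
Proof. by move=> /integrableP[_]. Qed.

Lemma integrable_le f g : measurable_fun D f -> mu.-integrable D (EFin \o g) ->
  (forall x, D x -> `|f x| <= `|g x|) -> mu.-integrable D (EFin \o f).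
Proof.
move=> mf ig fg; apply: (le_integrable mD _ _ ig); first exact/measurable_EFinP.
by move=> x Dx; rewrite /= lee_fin; exact: fg.
Qed.

Lemma integrable_mul_bounded f g (M : R) : mu.-integrable D (EFin \o f) ->
  measurable_fun D g -> (forall x, D x -> `|g x| <= M) ->
  mu.-integrable D (EFin \o (fun x => f x * g x)).
Proof.
move=> fi mg gM.
have iMf : mu.-integrable D (EFin \o (fun x => M * f x)).
  exact: (integrableZl mD M fi).
apply: (integrable_le _ iMf).
  by apply: measurable_funM => //; exact: integrable_measurable.
move=> x Dx; rewrite !normrM mulrC; apply: ler_wpM2r => //.
by apply: (le_trans (gM _ Dx)); exact: ler_norm.
Qed.

Lemma integral_Rintegral f : mu.-integrable D (EFin \o f) ->
  (\int[mu]_(x in D) (f x)%:E = (\int[mu]_(x in D) f x)%:E)%E.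
Proof. by move=> fi; rewrite /Rintegral fineK//; exact: integrable_fin_num. Qed.

Lemma normr_Rintegral_le f (C : R) : mu.-integrable D (EFin \o f) ->
  (\int[mu]_(x in D) (`|f x|%R)%:E <= C%:E)%E ->
  `|\int[mu]_(x in D) f x| <= C.
Proof.
move=> fi fC; rewrite -lee_fin EFin_normr_Rintegral//; apply: le_trans fC.
by apply: le_abse_integral => //; case/integrableP: fi.
Qed.

Lemma ge0_integral_subT f (e : \bar R) : measurable_fun setT f ->
  (forall x, 0 <= f x) -> (\int[mu]_x (f x)%:E <= e)%E ->
  (\int[mu]_(x in D) (f x)%:E <= e)%E.
Proof.
move=> mf f0; apply: le_trans; apply: ge0_subset_integral => //.
  exact/measurable_EFinP.
by move=> x _; rewrite lee_fin.
Qed.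

Lemma integral_le_excess_bound (h a b x : T -> R) (M eta z : R) : 0 <= M ->
  measurable_fun D h -> measurable_fun D a -> measurable_fun D b -> measurable_fun D x ->
  (forall t, 0 <= h t) -> (forall t, 0 <= a t) -> (forall t, 0 <= b t) ->
  (forall t, 0 <= x t) -> (forall t, D t -> h t <= M * (a t + b t) + 2 * x t) ->
  (\int[mu]_(t in D) (a t)%:E <= eta%:E)%E ->
  (\int[mu]_(t in D) (b t)%:E <= eta%:E)%E ->
  (\int[mu]_(t in D) (x t)%:E <= z%:E)%E ->
  (\int[mu]_(t in D) (h t)%:E <= (M * (eta + eta) + 2 * z)%:E)%E.
Proof.
move=> M0 mh ma mb mx h0 a0 b0 x0 hle Ia Ib Ix.
have mab : measurable_fun D (fun t => a t + b t) by exact: measurable_funD.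
apply: le_trans (@ge0_integral_le_add _ _ _ mu D mD h (fun t => M * (a t + b t))
  (fun t => 2 * x t) mh _ _ _ _ _) _.
- exact: measurable_funM.
- exact: measurable_funM.
- by move=> t _; rewrite mulr_ge0// addr_ge0.
- by move=> t _; rewrite mulr_ge0.
- by move=> t Dt; rewrite h0 hle.
rewrite !ge0_integralZl_EFin'//; last by move=> t _; rewrite addr_ge0.
rewrite ge0_integralD_EFin//.
have -> : (M * (eta + eta) + 2 * z)%:E =
    (M%:E * (eta%:E + eta%:E) + 2%:E * z%:E)%E by [].
by apply: leeD; [apply: lee_wpmul2l => //; exact: leeD|exact: lee_wpmul2l].
Qed.

(** The inequality |f| <= M + [excess f M] replaces a splitting of the domain into {|f| <= M} and
    its complement; that the excess has small integral for large M is the uniform integrability of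
    f. *)
Definition excess f (M : R) (x : T) : R := Num.max (`|f x| - M) 0.

Lemma excess_ge0 f M x : 0 <= excess f M x.
Proof. by rewrite /excess le_max lexx orbT. Qed.

Lemma le_excess f M x : `|f x| <= M + excess f M x.
Proof. by rewrite /excess -lerBlDl le_max lexx. Qed.

Lemma measurable_excess f M : measurable_fun D f -> measurable_fun D (excess f M).
Proof.
move=> mf; apply: measurable_maxr; last exact: measurable_cst.
by apply: measurable_funB; [exact: measurable_fun_norm|exact: measurable_cst].
Qed.

Lemma excess_small f (e : R) : mu.-integrable D (EFin \o f) -> 0 < e ->
  exists2 M, 0 <= M & (\int[mu]_(x in D) (excess f M x)%:E <= e%:E)%E.
Proof.
move=> fi e0; have mf := integrable_measurable fi.
have fi' : mu.-integrable D (EFin \o (fun x => `|f x|)) by exact: integrable_norm.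
have [_ _ cv] : [/\ mu.-integrable D (EFin \o (cst 0 : T -> R)),
  (\int[mu]_(x in D) `|(excess f n%:R x)%:E - 0%:E| @[n --> \oo] --> 0)%E &
  (\int[mu]_(x in D) (excess f n%:R x)%:E @[n --> \oo] --> \int[mu]_(x in D) 0%:E)%E].
  apply: (@dominated_convergence _ T R mu D mD
     (fun n => EFin \o excess f n%:R) (EFin \o cst 0) (EFin \o (fun x => `|f x|))).
  - by move=> n; apply/measurable_EFinP; exact: measurable_excess.
  - by apply/measurable_EFinP; exact: measurable_cst.
  - apply/aeW => x _; apply: cvg_near_cst.
    exists (Num.bound `|f x|) => // n /= bn; rewrite /excess max_r//.
    rewrite subr_le0 (le_trans (ltW (archi_boundP (normr_ge0 _))))//.
    by rewrite ler_nat.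
  - exact: fi'.
  - apply/aeW => x n _; rewrite /= lee_fin ger0_norm ?excess_ge0//.
    by rewrite /excess ge_max normr_ge0 andbT gerBl.
rewrite integral0 in cv; have [n Hn] := cvge0_ex cv e0.
by exists n%:R.
Qed.

End integrable_functions.

Section thickening.
Context (R : realType) (d : nat).
Implicit Types (x y : 'rV[R]_d) (K U : set 'rV[R]_d).

Definition thick K (r : R) := [set x : 'rV[R]_d |
  exists2 y : 'rV[R]_d, K y & forall i, `|x 0 i - y 0 i| <= r].

Definition othick K (r : R) := [set x : 'rV[R]_d |
  exists2 y : 'rV[R]_d, K y & forall i, `|x 0 i - y 0 i| < r].

Lemma compact_thick K r : compact K -> compact (thick K r).
Proof.
move=> cK; pose B := cbox (const_mx (- r) : 'rV[R]_d) (const_mx r).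
have -> : thick K r = (fun z : 'rV[R]_d * 'rV[R]_d => z.1 + z.2) @` (K `*` B).
  apply/seteqP; split => [x [y Ky xy]|_ [[y z] /= [Ky Bz] <-]].
    exists (y, x - y) => /=; last by rewrite addrC subrK.
    by split => // i; rewrite !mxE -ler_norml.
  by exists y => // i; rewrite mxE addrAC subrr add0r ler_norml; have := Bz i; rewrite !mxE.
apply: continuous_compact.
  by apply: continuous_subspaceT; exact: add_continuous.
by apply: compact_setX => //; exact: compact_cbox.
Qed.

Lemma open_othick K r : open (othick K r).
Proof.
apply/open_rowP => x [y Ky xy].
have e0 : 0 < \big[Num.min/1]_(i < d) (r - `|x 0 i - y 0 i|).
  by apply/bigmin_gtP; split => // i _; rewrite subr_gt0.
exists (\big[Num.min/1]_(i < d) (r - `|x 0 i - y 0 i|)) => // z xz; exists y => // i.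
have : `|x 0 i - z 0 i| < r - `|x 0 i - y 0 i|.
  by apply: lt_le_trans (xz i) _; exact: bigmin_le_cond.
rewrite ltrBrDr distrC; apply: le_lt_trans.
by rewrite -[z 0 i - y 0 i](subrKA (x 0 i)); exact: ler_normD.
Qed.

Lemma othick_thick K r : othick K r `<=` thick K r.
Proof. by move=> x [y Ky xy]; exists y => // i; exact: ltW. Qed.

Lemma sub_othick K r : 0 < r -> K `<=` othick K r.
Proof. by move=> r0 x Kx; exists x => // i; rewrite subrr normr0. Qed.

Lemma thick_thick K r s : thick (thick K r) s `<=` thick K (r + s).
Proof.
move=> x [y [z Kz yz] xy]; exists z => // i.
rewrite -[x 0 i - z 0 i](subrKA (y 0 i)).
by apply: (le_trans (ler_normD _ _)); rewrite [leRHS]addrC lerD.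
Qed.

Lemma le_thick K r s : r <= s -> thick K r `<=` thick K s.
Proof. by move=> rs x [y Ky xy]; exists y => // i; apply: le_trans (xy i) rs. Qed.

(** Lebesgue number argument: K is covered by finitely many cubes of radius r z / 2, half of what U
    allows at z, and any e smaller than all these half-radii works by the triangle inequality. *)
Lemma thick_sub K U : compact K -> open U -> K `<=` U ->
  exists2 r : R, 0 < r & thick K r `<=` U.
Proof.
move=> cK /open_rowP oU KU.
have /choice[r Hr] : forall x : 'rV[R]_d, exists e : R, 0 < e /\
    (K x -> forall y : 'rV[R]_d, (forall i : 'I_d, `|x 0 i - y 0 i| < e) -> U y).
  move=> x; have [Kx|Kx] := pselect (K x); last by exists 1.
  by have [e e0 xe] := oU _ (KU _ Kx); exists e.
have r0 x : 0 < r x by have [] := Hr x.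
have oO x : K x -> open (othick [set x] (r x / 2)) by move=> _; exact: open_othick.
have Kcov : K `<=` cover K (fun x => othick [set x] (r x / 2)).
  by move=> x Kx; exists x => //; apply: sub_othick => //; rewrite divr_gt0.
have [D DK Dcov] : finite_subset_cover K (fun x => othick [set x] (r x / 2)) K.
  by move: cK; rewrite compact_cover; exact.
pose s := finmap.enum_fset D.
have [e e0 es] : exists2 e : R, 0 < e & forall x, x \in s -> e < r x / 2.
  elim: s => [|x s [e e0 es]]; first by exists 1.
  exists (Num.min e (r x / 4)); first by rewrite lt_min e0 divr_gt0.
  move=> y; rewrite inE => /orP[/eqP ->|ys]; last first.
    by rewrite gt_min (es _ ys).
  by rewrite gt_min; apply/orP; right; have := r0 x; lra.
exists e => // x [y Ky xy]; have [z zD [_ -> yz]] := Dcov _ Ky.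
have Kz : K z by have := DK z zD; rewrite inE.
have [_ /(_ Kz)] := Hr z; apply=> i.
have := xy i; have := yz i; have := es _ zD => h1 h2 h3.
rewrite -[z 0 i - x 0 i](subrKA (y 0 i)).
apply: (le_lt_trans (ler_normD _ _)); rewrite [X in X + _]distrC [X in _ + X]distrC.
by rewrite [ltRHS]splitr; apply: ltrD => //; apply: le_lt_trans h3 h1.
Qed.

Lemma thick_shift K r x y : thick K r x -> forall s, (forall i, `|y 0 i| <= s) ->
  thick K (r + s) (x + y).
Proof.
move=> xK s ys; apply: (@thick_thick K r s); exists x => // i.
by rewrite mxE addrAC subrr add0r.
Qed.

End thickening.

Lemma normB_le1 (R : realType) (a b : R) : 0 <= a <= 1 -> 0 <= b <= 1 -> `|a - b| <= 1.
Proof. by move=> ? ?; rewrite ler_norml; lra. Qed.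

(** F S <= (M + X)(A + B), where A + B is kept next to the constant M and bounded by 2 next to X. *)
Lemma normM_le_excess (R : realType) (M F S A B X : R) : 0 <= M -> 0 <= F -> 0 <= B -> 0 <= A ->
  0 <= X -> F <= M + X -> S <= A + B -> A <= 1 -> B <= 1 ->
  F * S <= M * (A + B) + 2 * X.
Proof. by move=> *; nra. Qed.

(** * Duality between L^1 and test functions *)

Section fundamental_lemma.
Context (R : realType) (d : nat).
Hypothesis d_gt0 : (0 < d)%N.
Local Notation L := (leb R d).
Local Notation T := (caratheodory_type (lebesgue_outer R d)).
Implicit Types (x : 'rV[R]_d) (U K : set 'rV[R]_d) (f phi : 'rV[R]_d -> R).

Lemma mul_continuous_integrable K f phi : compact K ->
  L.-integrable K (EFin \o f) -> continuous phi ->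
  L.-integrable K (EFin \o (fun x => f x * phi x)).
Proof.
move=> cK fi cphi; have [M HM] := continuous_compact_bounded cK cphi.
apply: (@integrable_mul_bounded _ T R L K (measurable_compact cK) f phi M fi) => //.
exact: continuous_leb_measurable.
Qed.

Lemma Rintegral_support (A B : set T) f : (forall x, ~ A x -> f x = 0) ->
  A `<=` B -> \int[L]_(x in B) f x = \int[L]_(x in A) f x.
Proof.
move=> f0 AB; rewrite Rintegral_mkcond [RHS]Rintegral_mkcond.
congr (Rintegral _ _ _); apply/funext => x; rewrite !patchE.
case: ifPn => [_|]; case: ifPn => //; rewrite ?inE ?notin_setE.
  by move=> /f0.
by move=> Ax /(_ (AB _ Ax)).
Qed.

(** On K, |f| is f times its sign, and the sign is the difference of the indicators of P = {f > 0}
    and N = {f < 0}. Approximating these in L^1 by test functions p and q with values in [0, 1]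
    gives phi = p - q with |phi| <= 1. As f may be unbounded, L^1 closeness alone does not control
    the error: f is cut at a level M. Everything is supported in a compact neighbourhood [K'] of K,
    where f is integrable. *)
Lemma fundamental_lemma U K f (C : R) : open U -> locally_L1 U f ->
  compact K -> K `<=` U ->
  (forall phi, test_function U phi -> (forall x, `|phi x| <= 1) ->
    `|\int[L]_(x in U) (f x * phi x)| <= C) ->
  (\int[L]_(x in K) (`|f x|%R)%:E <= C%:E)%E.
Proof.
move=> oU lf cK KU fC; have [r r0 rU] := thick_sub cK oU KU.
pose K' := thick K r; pose U' := othick K r.
have cK' : compact K' by exact: compact_thick.
have oU' : open U' by exact: open_othick.
have KU' : K `<=` U' by exact: sub_othick.
have U'K' : U' `<=` K' by exact: othick_thick.
have fi : L.-integrable K' (EFin \o f) by exact: lf.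
have mK' := measurable_compact cK'.
have mK := measurable_compact cK.
have KK' : K `<=` K' by exact: subset_trans U'K'.
have mf : @measurable_fun _ _ T _ K' f by exact: integrable_measurable fi.
apply/lee_addgt0Pr => e e0.
have e4 : 0 < e / 4 by rewrite divr_gt0.
have [M M0 HM] := excess_small mK' fi e4.
pose P : set T := K `&` (K' `&` f @^-1` `]0, +oo[%classic).
pose N : set T := K `&` (K' `&` f @^-1` `]-oo, 0[%classic).
have mP : measurable P.
  by apply: measurableI mK _; apply: mf mK' _ _; exact: measurable_itv.
have mN : measurable N.
  by apply: measurableI mK _; apply: mf mK' _ _; exact: measurable_itv.
(* Chosen so that the part of f below M costs at most M (eta + eta) <= e/2; the excess, weighted by
   2, costs 2 (e/4). *)
have eta0 : 0 < e / (4 * (M + 1)) by rewrite divr_gt0// mulr_gt0// ltr_wpDl.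
set eta := e / _ in eta0.
have Meta : M * (eta + eta) <= e / 2.
  rewrite /eta -mulr2n -[_ *+ 2]mulr_natl.
  have M1 : 0 < M + 1 by rewrite ltr_wpDl.
  have -> : M * (2 * (e / (4 * (M + 1)))) = (e / 2) * (M / (M + 1)).
    by field; rewrite gt_eqF.
  by apply: ler_piMr; [rewrite divr_ge0// ltW|rewrite ler_pdivrMr// mul1r lerDl].
have [p [tp p01 pP]] := test_approx_compact d_gt0 oU' cK KU' mP (@subIsetl _ _ _) eta0.
have [q [tq q01 qN]] := test_approx_compact d_gt0 oU' cK KU' mN (@subIsetl _ _ _) eta0.
pose phi := p \+ (q \* cst (-1)).
have tphi : test_function U' phi.
  apply: (test_functionD tp); apply: (test_functionM tq) => n.
  exact: differentiable_n_cst.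
pose sg : T -> R := fun x => \1_P x - \1_N x.
have msg : @measurable_fun _ _ T _ K' sg by apply: measurable_funB; exact: measurable_indic.
have mphi : @measurable_fun _ _ T _ K' phi by exact: test_function_measurable tphi.
pose a : T -> R := fun x => `|\1_P x - p x|.
pose b : T -> R := fun x => `|\1_N x - q x|.
have ma D : @measurable_fun _ _ T _ D a.
  apply: measurable_fun_normB; first exact: measurable_indic.
  exact: test_function_measurable tp.
have mb D : @measurable_fun _ _ T _ D b.
  apply: measurable_fun_normB; first exact: measurable_indic.
  exact: test_function_measurable tq.
have i01 A x : 0 <= (\1_A x : R) <= 1 by exact: indic01.
have phi1 x : `|phi x| <= 1.
  by rewrite /phi /= mulrN1; exact: normB_le1 (p01 x) (q01 x).
have ifsg : L.-integrable K' (EFin \o (fun x => f x * sg x)).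
  apply: (@integrable_mul_bounded _ T R L K' mK' f sg 1 fi msg) => x _.
  exact: normB_le1 (i01 P x) (i01 N x).
have ifphi : L.-integrable K' (EFin \o (fun x => f x * phi x)).
  apply: (@integrable_mul_bounded _ T R L K' mK' f phi 1 fi mphi) => x _.
  exact: phi1.
have msgphi : @measurable_fun _ _ T _ K' (fun x => sg x - phi x) by exact: measurable_funB.
have ifd : L.-integrable K' (EFin \o (fun x => f x * (sg x - phi x))).
  apply: (@integrable_mul_bounded _ T R L K' mK' f (fun x => sg x - phi x) 2 fi msgphi) => x _.
  apply: le_trans (ler_normB _ _) _.
  exact: lerD (normB_le1 (i01 P x) (i01 N x)) (phi1 x).
have E1 : (\int[L]_(x in K) (`|f x|%R)%:E = (\int[L]_(x in K') (f x * sg x))%:E)%E.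
  rewrite -integral_Rintegral// [LHS]integral_mkcond [RHS]integral_mkcond.
  apply: eq_integral => x _; rewrite !patchE.
  have sgE (s1 s2 : bool) : (P x <-> s1) -> (N x <-> s2) -> sg x = s1%:R - s2%:R.
    move=> [P1 P2] [N1 N2]; rewrite /sg !indicE; congr ((nat_of_bool _)%:R - (nat_of_bool _)%:R).
      by case: s1 P1 P2 => P1 P2; [exact/mem_set/P2|apply/memNset => /P1].
    by case: s2 N1 N2 => N1 N2; [exact/mem_set/N2|apply/memNset => /N1].
  have [Kx|Kx] := pselect (K x); last first.
    rewrite (memNset Kx) (sgE false false) ?subrr ?mulr0; first by case: ifP.
      by split => // -[].
    by split => // -[].
  have K'x := KK' _ Kx.
  rewrite (mem_set Kx) (mem_set K'x); congr EFin.
  have Pxe : P x <-> (0 < f x).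
    rewrite /P; split => [[_ [_]]|fx]; first by rewrite /= in_itv/= andbT.
    by split => //; split => //=; rewrite in_itv/= andbT.
  have Nxe : N x <-> (f x < 0).
    rewrite /N; split => [[_ [_]]|fx]; first by rewrite /= in_itv.
    by split => //; split => //=; rewrite in_itv.
  rewrite (sgE _ _ Pxe Nxe); have [fx|fx|fx] := ltgtP 0 (f x).
  - by rewrite subr0 mulr1 gtr0_norm.
  - by rewrite sub0r mulrN1 ltr0_norm.
  - by rewrite -fx normr0 mul0r.
have E2 : \int[L]_(x in K') (f x * sg x) =
    \int[L]_(x in K') (f x * phi x) + \int[L]_(x in K') (f x * (sg x - phi x)).
  rewrite -RintegralD//; apply: eq_Rintegral => x _; ring.
have K'0 x : ~ K' x -> f x * phi x = 0.
  move=> K'x; have [_ [K2 [_ K2U' ->]]] := tphi; first by rewrite mulr0.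
  by move=> /K2U'/U'K'.
have E3 : \int[L]_(x in K') (f x * phi x) <= C.
  rewrite -(@Rintegral_support K' U (fun x => f x * phi x) K'0 rU).
  apply: le_trans (ler_norm _) _; apply: fC.
    by apply: test_functionS tphi; exact: subset_trans rU.
  exact: phi1.
have E4 : `|\int[L]_(x in K') (f x * (sg x - phi x))| <= e.
  apply: normr_Rintegral_le ifd _ => //.
  pose ex : T -> R := @excess _ T R f M.
  have ex0 x : 0 <= ex x by exact: excess_ge0.
  have lex x : `|f x| <= M + ex x by exact: le_excess.
  have mex : @measurable_fun _ _ T _ K' ex := @measurable_excess _ T R K' f M mf.
  have Hex : (\int[L]_(x in K') (ex x)%:E <= (e / 4)%:E)%E by exact: HM.
  have mfd : @measurable_fun _ _ T _ K' (fun x => `|f x * (sg x - phi x)|).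
    exact: (measurable_fun_norm (measurable_funM mf msgphi)).
  have a0 x : 0 <= a x by exact: normr_ge0.
  have b0 x : 0 <= b x by exact: normr_ge0.
  have Ia := @ge0_integral_subT _ T R L K' mK' a _ (ma setT) a0 pP.
  have Ib := @ge0_integral_subT _ T R L K' mK' b _ (mb setT) b0 qN.
  have H := @integral_le_excess_bound _ T R L K' mK' _ a b ex M eta (e / 4) M0
    mfd (ma K') (mb K') mex (fun x => normr_ge0 _) a0 b0 ex0 _
    Ia Ib Hex.
  apply: (le_trans (H _)) => [x _|]; last first.
    by rewrite lee_fin (splitr e); apply: lerD => //; clear; lra.
  rewrite normrM /=.
  have sab : `|sg x - phi x| <= a x + b x.
    rewrite /sg /phi /a /b /=.
    have -> : \1_P x - \1_N x - (p x + q x * -1) =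
      (\1_P x - p x) - (\1_N x - q x) by clear; ring.
    exact: ler_normB.
  have a1 : a x <= 1 by exact: normB_le1.
  have b1 : b x <= 1 by exact: normB_le1.
  exact: (normM_le_excess M0 (normr_ge0 _) (b0 x) (a0 x) (ex0 x) (lex x) sab a1 b1).
rewrite E1 -EFinD lee_fin E2; apply: lerD => //.
exact: le_trans (ler_norm _) E4.
Qed.

End fundamental_lemma.

Section L1_distance.
Context (disp : measure_display) (T : measurableType disp) (R : realType).
Context (mu : {measure set T -> \bar R}) (D : set T).
Hypothesis mD : measurable D.
Implicit Types f g h : T -> R.

Lemma L1_triangle f g h (a b c : R) :
  measurable_fun D f -> measurable_fun D g -> measurable_fun D h ->
  (\int[mu]_(x in D) (`|f x - g x|%R)%:E <= a%:E)%E ->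
  (\int[mu]_(x in D) (`|g x - h x|%R)%:E <= b%:E)%E ->
  a + b <= c ->
  (\int[mu]_(x in D) (`|f x - h x|%R)%:E <= c%:E)%E.
Proof.
move=> mf mg mh fg gh abc.
apply: (@le_trans _ _ (a%:E + b%:E)%E); last by rewrite -EFinD lee_fin.
apply: le_trans (leeD fg gh).
apply: ge0_integral_le_add => //; try exact: measurable_fun_normB.
move=> x _; rewrite normr_ge0 /=.
by rewrite -[f x - h x](subrKA (g x)) ler_normD.
Qed.

Lemma L1_add f f' g g' (a b c : R) :
  measurable_fun D f -> measurable_fun D f' ->
  measurable_fun D g -> measurable_fun D g' ->
  (\int[mu]_(x in D) (`|f x - f' x|%R)%:E <= a%:E)%E ->
  (\int[mu]_(x in D) (`|g x - g' x|%R)%:E <= b%:E)%E ->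
  a + b <= c ->
  (\int[mu]_(x in D) (`|(f x + g x) - (f' x + g' x)|%R)%:E <= c%:E)%E.
Proof.
move=> mf mf' mg mg' ff' gg' abc.
apply: (@le_trans _ _ (a%:E + b%:E)%E); last by rewrite -EFinD lee_fin.
apply: le_trans (leeD ff' gg').
apply: ge0_integral_le_add => //; try exact: measurable_fun_normB.
  by apply: measurable_fun_normB; exact: measurable_funD.
move=> x _; rewrite normr_ge0 /= opprD addrACA.
exact: ler_normD.
Qed.

Lemma L1_scale f f' (k a : R) : measurable_fun D f -> measurable_fun D f' ->
  (\int[mu]_(x in D) (`|f x - f' x|%R)%:E <= a%:E)%E ->
  (\int[mu]_(x in D) (`|k * f x - f' x * k|%R)%:E <= (`|k| * a)%:E)%E.
Proof.
move=> mf mf' ff'.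
under eq_integral do rewrite [_ * k]mulrC -mulrBr normrM.
rewrite ge0_integralZl_EFin'//; last exact: measurable_fun_normB.
by rewrite EFinM lee_wpmul2l// lee_fin.
Qed.

End L1_distance.

(** * Density of test functions in L^1 and continuity of translations *)

Section L1_density.
Import HBSimple.
Context (R : realType) (d : nat).
Hypothesis d_gt0 : (0 < d)%N.
Local Notation L := (leb R d).
Local Notation T := (caratheodory_type (lebesgue_outer R d)).
Local Notation mfunT f := (@measurable_fun _ _ T _ setT f).
Implicit Types (c x : 'rV[R]_d) (A U K : set 'rV[R]_d) (f g phi : 'rV[R]_d -> R).

Definition l1approx (G : T -> R) := forall e : R, 0 < e -> exists2 phi : 'rV[R]_d -> R,
  test_function setT phi & (\int[L]_x (`|G x - phi x|%R)%:E <= e%:E)%E.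

Lemma l1approx_indic A K : measurable (A : set T) -> compact K -> A `<=` K ->
  l1approx (\1_A : T -> R).
Proof.
move=> mA cK AK e e0.
have [phi [tphi _ Aphi]] :=
  test_approx_compact d_gt0 openT cK (@subsetT _ _) mA AK e0.
by exists phi.
Qed.

Lemma l1approxZ (G : T -> R) (k : R) : mfunT G -> l1approx G -> l1approx (fun x => k * G x).
Proof.
move=> mG aG e e0; have k1 : 0 < `|k| + 1 by rewrite ltr_wpDl.
have [|phi tphi Gphi] := aG (e / (`|k| + 1)); first by rewrite divr_gt0.
exists (phi \* cst k).
  by apply: (test_functionM tphi) => n; exact: differentiable_n_cst.
have := L1_scale measurableT k mG (test_function_measurable (D:=setT) tphi) Gphi.
move=> /le_trans; apply; rewrite lee_fin mulrCA ler_piMr ?(ltW e0)// ler_pdivrMr//.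
by rewrite mul1r lerDl.
Qed.

Lemma l1approxD (G H : T -> R) : mfunT G -> mfunT H -> l1approx G -> l1approx H ->
  l1approx (fun x => G x + H x).
Proof.
move=> mG mH aG aH e e0; have e2 : 0 < e / 2 by rewrite divr_gt0.
have [p tp Gp] := aG _ e2; have [q tq Hq] := aH _ e2.
exists (p \+ q); first exact: test_functionD.
have mp := test_function_measurable (D:=setT) tp.
have mq := test_function_measurable (D:=setT) tq.
by apply: (L1_add measurableT mG mp mH mq Gp Hq); rewrite -splitr.
Qed.

Lemma l1approx_sum (I : eqType) (s : seq I) (G : I -> T -> R) :
  (forall i, mfunT (G i)) -> (forall i, l1approx (G i)) ->
  l1approx (fun x => \sum_(i <- s) G i x).
Proof.
move=> mG aG; elim: s => [e e0|i s IH].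
  exists (cst 0).
    split; first by move=> n; exact: differentiable_n_cst.
    by exists set0; split => //; exact: compact0.
  rewrite integral0_eq ?lee_fin ?ltW// => x _.
  by rewrite big_nil subr0 normr0.
rewrite (_ : (fun _ => _) = (fun x => G i x + \sum_(j <- s) G j x)); last first.
  by apply/funext => x; rewrite big_cons.
apply: (l1approxD (mG i) _ (aG i) IH).
exact: (measurable_sum _ mG).
Qed.

Lemma l1approx_close (G : T -> R) : mfunT G ->
  (forall e : R, 0 < e -> exists H : T -> R, [/\ mfunT H, l1approx H &
    (\int[L]_x (`|G x - H x|%R)%:E <= e%:E)%E]) -> l1approx G.
Proof.
move=> mG hG e e0; have e2 : 0 < e / 2 by rewrite divr_gt0.
have [H [mH aH GH]] := hG _ e2; have [p tp Hp] := aH _ e2.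
exists p => //.
have mp := test_function_measurable (D:=setT) tp.
by apply: (L1_triangle measurableT mG mH mp GH Hp); rewrite -splitr.
Qed.

(** Simple functions are dense in L^1(K), and restricted to K they are finite combinations of
    indicators of measurable subsets of K. *)
Lemma l1approx_integrable K (f : T -> R) : compact K ->
  L.-integrable K (EFin \o f) -> l1approx (fun x => f x * \1_K x).
Proof.
move=> cK fi; have mK := measurable_compact cK.
have mf : @measurable_fun _ _ T _ K f by exact: integrable_measurable fi.
have EK g : (fun x => g x * \1_K x) = g \_ K.
  apply/funext => x; rewrite patchE indicE.
  by case: (x \in K); rewrite ?mulr1 ?mulr0.
have mG : mfunT (fun x => f x * \1_K x).
  by rewrite EK; apply/(measurable_restrictT _ mK).
apply: l1approx_close => // e e0.
have [s [si _ cvs]] := approximation_sfun_integrable mK fi.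
have [n Hn] := cvge0_ex cvs e0.
have msn y : measurable (K `&` s n @^-1` [set y] : set T).
  by apply: measurableI mK _; exact: measurable_sfunP.
exists (fun x => s n x * \1_K x); split.
- by apply: measurable_funM; [exact: measurable_funP|exact: measurable_indic].
- rewrite (_ : (fun _ => _) = (fun x => \sum_(y <- finmap.enum_fset (fset_set (range (s n))))
      y * \1_(K `&` s n @^-1` [set y]) x)); last first.
    apply/funext => x; rewrite fimfunE fsbig_finite; last exact: fimfunP.
    apply: etrans (mulr_suml _ _ _ _) _; apply: eq_bigr => y _; rewrite -mulrA; congr (_ * _).
    by rewrite indicI /= mulrC.
  apply: l1approx_sum => y.
    by apply: measurable_funM; [exact: measurable_cst|exact: measurable_indic].
  apply: l1approxZ; first exact: measurable_indic.
  by apply: (l1approx_indic (msn y) cK) => x [].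
- apply: le_trans Hn; rewrite [leRHS]integral_mkcond.
  rewrite le_eqVlt; apply/orP; left; apply/eqP; apply: eq_integral => x _.
  rewrite patchE !indicE; case: (x \in K); rewrite ?mulr1 ?mulr0//.
  by rewrite subrr normr0.
Qed.

End L1_density.

Section translation.
Context (R : realType) (d : nat).
Local Notation L := (leb R d).
Local Notation T := (caratheodory_type (lebesgue_outer R d)).
Implicit Types (c x : 'rV[R]_d) (A U K : set 'rV[R]_d).

Lemma measurable_fun_translate c (f : T -> R) : measurable_fun setT f ->
  @measurable_fun _ _ T _ setT (fun x => f (x + c)).
Proof. by move=> mf; exact: (measurableT_comp mf (@measurable_translate R d c)). Qed.

Lemma pushforward_translate c (A : set T) : measurable A ->
  pushforward L ((fun x => (x + c)%R) : T -> T) A = L A.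
Proof. by move=> mA; exact: lebesgue_outer_translate. Qed.

Lemma ge0_integral_translate c (f : T -> R) : measurable_fun setT f ->
  (forall x, 0 <= f x) ->
  (\int[L]_x (f (x + c)%R)%:E = \int[L]_x (f x)%:E)%E.
Proof.
move=> mf f0; have mc := @measurable_translate R d c.
transitivity (\int[pushforward L ((fun x => (x + c)%R) : T -> T)]_x (f x)%:E)%E.
  rewrite ge0_integral_pushforward//; first exact/measurable_EFinP.
  by move=> x _; rewrite lee_fin.
by apply: eq_measure_integral => A mA _; exact: pushforward_translate.
Qed.

Lemma integrable_translate c (f : T -> R) : L.-integrable setT (EFin \o f) ->
  L.-integrable setT (EFin \o (fun x => f (x + c))).
Proof.
move=> fi; have mf := integrable_measurable fi; apply/integrableP; split.
  by apply/measurable_EFinP; exact: measurable_fun_translate.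
have E := @ge0_integral_translate c (fun x => `|f x|)
  (measurable_fun_norm mf) (fun x => normr_ge0 _).
have := integrable_lty_norm fi; rewrite -E; exact.
Qed.

Lemma Rintegral_translate c (f : T -> R) : L.-integrable setT (EFin \o f) ->
  \int[L]_x f (x + c) = \int[L]_x f x.
Proof.
move=> fi; rewrite /Rintegral; congr fine.
have mf := integrable_measurable fi; have mc := @measurable_translate R d c.
transitivity (\int[pushforward L ((fun x => (x + c)%R) : T -> T)]_x (f x)%:E)%E.
  rewrite integral_pushforward//; first exact/measurable_EFinP.
  exact: integrable_translate.
by apply: eq_measure_integral => A mA _; exact: pushforward_translate.
Qed.

End translation.

Section line_derivatives.
Context (R : realType) (d : nat) (i : 'I_d).
Local Notation e := (delta_mx 0 i : 'rV[R]_d).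
Implicit Types (phi : 'rV[R]_d -> R) (x : 'rV[R]_d).

Lemma is_derive_line phi x (t l : R) : is_derive (x + t *: e) e phi l ->
  is_derive t (1 : R) (fun s => phi (x + s *: e)) l.
Proof.
move=> [dphi phil].
have E : (fun h : R => h^-1 *: (((fun s => phi (x + s *: e)) \o shift t) (h *: 1) -
      phi (x + t *: e))) =
    (fun h => h^-1 *: ((phi \o shift (x + t *: e)) (h *: e) - phi (x + t *: e))).
  apply/funext => h /=; congr (_ *: (phi _ - _)).
  by rewrite [h%:A]mulr1 scalerDl addrCA.
by split; rewrite /derivable /derive E.
Qed.

Lemma MVT_0 (g g' : R -> R) (t : R) : (forall s : R, is_derive s (1 : R) g (g' s)) ->
  exists2 c, `|c| <= `|t| & g t - g 0 = g' c * t.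
Proof.
move=> gg'.
have cg (a b : R) : {within `[a, b], continuous g}.
  apply: continuous_subspaceT => s; exact: is_derive_continuous (gg' s).
have [t0|t0] := leP 0 t.
  have [c c0t E] := MVT_segment t0 (fun s _ => gg' s) (cg 0 t).
  exists c; last by rewrite E subr0.
  by move: c0t; rewrite in_itv/= => /andP[? ?]; rewrite !ger0_norm.
have [c ct0 E] := MVT_segment (ltW t0) (fun s _ => gg' s) (cg t 0).
exists c; last by rewrite -opprB E sub0r mulrN opprK.
by move: ct0; rewrite in_itv/= => /andP[? ?]; rewrite !ler0_norm ?lerN2// ltW.
Qed.

Lemma line_lipschitz phi (M : R) : smooth phi ->
  (forall x, `|partial i phi x| <= M) ->
  forall x t, `|phi (x + t *: e) - phi x| <= M * `|t|.
Proof.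
move=> sphi pM x t.
have [c _] := MVT_0 t (fun s => is_derive_line (differentiable_n_derive i (x + s *: e) (sphi 1%N))).
by rewrite scale0r addr0 => ->; rewrite normrM ler_wpM2r.
Qed.

(** The mean value theorem used twice, for phi and then for its partial derivative, which costs the
    constant M instead of M/2. *)
Lemma line_taylor phi (M : R) : smooth phi ->
  (forall x, `|partial i (partial i phi) x| <= M) ->
  forall x t, `|phi (x + t *: e) - phi x - t * partial i phi x| <= M * t ^+ 2.
Proof.
move=> sphi pM x t.
have [c ct] := MVT_0 t (fun s => is_derive_line (differentiable_n_derive i (x + s *: e) (sphi 1%N))).
rewrite scale0r addr0 => ->; rewrite [t * _]mulrC -mulrBl normrM.
have spp : smooth (partial i phi) by move=> n; exact: differentiable_n_partial (sphi n.+1).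
rewrite -[t ^+ 2]real_normK ?num_real// expr2 mulrA ler_wpM2r//.
apply: le_trans (line_lipschitz spp pM _ _) _; rewrite ler_wpM2l//.
exact: le_trans (normr_ge0 _) (pM x).
Qed.

End line_derivatives.

Section translation_continuity.
Context (R : realType) (d : nat) (i : 'I_d).
Hypothesis d_gt0 : (0 < d)%N.
Local Notation L := (leb R d).
Local Notation T := (caratheodory_type (lebesgue_outer R d)).
Local Notation mfunT f := (@measurable_fun _ _ T _ setT f).
Local Notation e_ := (delta_mx 0 i : 'rV[R]_d).
Implicit Types (c x : 'rV[R]_d) (A U K : set 'rV[R]_d) (f g phi : 'rV[R]_d -> R).

(** A test function p close to f on [K'] is Lipschitz along e_i, and translation does not change the
    L^1 distance between p and f. Extending f by 0 outside [K'] makes that distance a global one; x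
    and x + t e lying in [K'] makes the extension harmless. *)
Lemma translation_continuity K K' f (e : R) : compact K -> compact K' ->
  L.-integrable K' (EFin \o f) -> 0 < e ->
  exists2 r : R, 0 < r & forall t, `|t| <= r ->
    (forall x, K x -> K' x /\ K' (x + t *: e_)) ->
    (\int[L]_(x in K) (`|f (x + t *: e_)%R - f x|%R)%:E <= e%:E)%E.
Proof.
move=> cK cK' fi e0; have e3 : 0 < e / 3 by rewrite divr_gt0.
have mK := measurable_compact cK.
have mK' := measurable_compact cK'.
pose G : T -> R := fun x => f x * \1_K' x.
have [p tp Gp] := l1approx_integrable d_gt0 cK' fi e3.
have mp : mfunT p by exact: test_function_measurable tp.
have mG : mfunT G.
  have mf : @measurable_fun _ _ T _ K' f by exact: integrable_measurable fi.
  have := (@measurable_restrictT _ _ T _ K' f mK').1 mf; congr (@measurable_fun _ _ T _ setT _).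
  apply/funext => x; rewrite /G patchE indicE.
  by case: (x \in K'); rewrite ?mulr1 ?mulr0.
have [M M0 HM] := test_function_bounded (test_function_partial i tp).
have LK : L K \is a fin_num by rewrite ge0_fin_numE ?leb_compact// outer_measure_ge0.
pose l := fine (L K); have l0 : 0 <= l by exact: fine_ge0.
have Ml : 0 < M * (l + 1) by rewrite mulr_gt0// ltr_wpDl.
(* Makes M |t| L(K) <= e/3; l + 1 in place of l = L(K) avoids a division by 0. *)
exists (e / 3 / (M * (l + 1))); first by rewrite divr_gt0.
move=> t tr KK'.
have mGt : mfunT (fun x => G (x + t *: e_)) by exact: measurable_fun_translate.
have mpt : mfunT (fun x => p (x + t *: e_)) by exact: measurable_fun_translate.
have mS (g : T -> R) : mfunT g -> @measurable_fun _ _ T _ K g.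
  by move=> mg; exact: (measurable_funS measurableT (@subsetT _ _) mg).
have h1 : (\int[L]_(x in K) (`|G (x + t *: e_)%R - p (x + t *: e_)%R|%R)%:E <= (e / 3)%:E)%E.
  apply: (@ge0_integral_subT _ T R L K mK (fun x => `|G (x + t *: e_) - p (x + t *: e_)|)).
  - exact: measurable_fun_normB mGt mpt.
  - by move=> x; exact: normr_ge0.
  - rewrite (@ge0_integral_translate R d (t *: e_) (fun x => `|G x - p x|)).
    + exact: Gp.
    + exact: measurable_fun_normB mG mp.
    + by move=> x; exact: normr_ge0.
have h3 : (\int[L]_(x in K) (`|p x - G x|%R)%:E <= (e / 3)%:E)%E.
  apply: (@ge0_integral_subT _ T R L K mK (fun x => `|p x - G x|)).
  - exact: measurable_fun_normB mp mG.
  - by move=> x; exact: normr_ge0.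
  - by under eq_integral do rewrite distrC; exact: Gp.
have h2 : (\int[L]_(x in K) (`|p (x + t *: e_)%R - p x|%R)%:E <= (e / 3)%:E)%E.
  apply: (@le_trans _ _ (\int[L]_(x in K) (M * `|t|)%:E)%E).
    apply: (@ge0_le_integral_EFin _ T R L K mK (fun x => `|p (x + t *: e_) - p x|) (cst (M * `|t|))).
    - exact: mS (measurable_fun_normB mpt mp).
    - exact: measurable_cst.
    - move=> x _; rewrite normr_ge0 /=.
      exact: line_lipschitz (proj1 tp) HM x t.
  rewrite integral_cst// -(fineK LK) -EFinM lee_fin -/l.
  have := ler_wpM2l (ltW Ml) tr; rewrite mulrCA mulfV ?gt_eqF// mulr1.
  apply: le_trans; rewrite mulrAC ler_wpM2r// ler_wpM2l ?(ltW M0)//.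
  by rewrite lerDl.
have h12 := @L1_triangle _ T R L K mK (fun x => G (x + t *: e_))
  (fun x => p (x + t *: e_)) p (e / 3) (e / 3) (e / 3 + e / 3)
  (mS _ mGt) (mS _ mpt) (mS _ mp) h1 h2 (lexx _).
have e3E : e / 3 + e / 3 + e / 3 <= e by lra.
have := @L1_triangle _ T R L K mK (fun x => G (x + t *: e_)) p G
  (e / 3 + e / 3) (e / 3) e (mS _ mGt) (mS _ mp) (mS _ mG) h12 h3 e3E.
congr (_ <= _)%E; apply: eq_integral => x; rewrite inE => /KK'[K'x K'xt].
by rewrite /G !indicE !mem_set// !mulr1.
Qed.

End translation_continuity.

Lemma is_derive_quadratic (R : realType) (g : R -> R) (t l C : R) :
  (forall k, `|g (t + k) - g t - k * l| <= C * k ^+ 2) -> is_derive t (1 : R) g l.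
Proof.
move=> gC; apply: is_derive_cvg; apply/cvgrPdist_le => e e0.
have C1 : 0 < `|C| + 1 by rewrite ltr_wpDl.
near=> k.
have k0 : k != 0 by near: k; exact: nbhs_dnbhs_neq.
have -> : l - k^-1 *: ((g \o shift t) (k *: 1) - g t) = - (k^-1 * (g (t + k) - g t - k * l)).
  by rewrite /= [k%:A]mulr1 [k + t]addrC /GRing.scale /=; field.
rewrite normrN normrM normfV ler_pdivrMl ?normr_gt0//.
apply: le_trans (gC k) _; rewrite -[k ^+ 2]real_normK ?num_real// expr2 mulrA mulrC.
rewrite ler_wpM2l//; apply: (@le_trans _ _ ((`|C| + 1) * `|k|)).
  by rewrite ler_wpM2r// (le_trans (ler_norm _))// lerDl.
rewrite mulrC -ler_pdivlMr//; near: k; apply: nbhs_dnbhs; apply/nbhs_ballP.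
exists (e / (`|C| + 1)); first by rewrite /= divr_gt0.
by move=> k; rewrite -ball_normE /ball_ /= sub0r normrN => /ltW.
Unshelve. all: by end_near. Qed.

Section Rintegral_linear.
Context (disp : measure_display) (T : measurableType disp) (R : realType).
Context (mu : {measure set T -> \bar R}) (D : set T).
Hypothesis mD : measurable D.
Implicit Types f g h : T -> R.

Lemma integrable_comb3 f g h (a b c : R) : mu.-integrable D (EFin \o f) ->
  mu.-integrable D (EFin \o g) -> mu.-integrable D (EFin \o h) ->
  mu.-integrable D (EFin \o (fun x => a * f x + b * g x + c * h x)).
Proof.
move=> fi gi hi.
have Z k w : mu.-integrable D (EFin \o w) -> mu.-integrable D (EFin \o (fun x => k * w x)).
  by move=> wi; exact: (integrableZl mD k wi).
exact: (integrableD mD (integrableD mD (Z a _ fi) (Z b _ gi)) (Z c _ hi)).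
Qed.

Lemma Rintegral_comb3 f g h (a b c : R) : mu.-integrable D (EFin \o f) ->
  mu.-integrable D (EFin \o g) -> mu.-integrable D (EFin \o h) ->
  \int[mu]_(x in D) (a * f x + b * g x + c * h x) =
  a * \int[mu]_(x in D) f x + b * \int[mu]_(x in D) g x + c * \int[mu]_(x in D) h x.
Proof.
move=> fi gi hi.
have Z k w : mu.-integrable D (EFin \o w) -> mu.-integrable D (EFin \o (fun x => k * w x)).
  by move=> wi; exact: (integrableZl mD k wi).
rewrite RintegralD//; last 2 first.
- exact: (integrableD mD (Z a _ fi) (Z b _ gi)).
- exact: Z.
by rewrite RintegralD ?RintegralZl//; exact: Z.
Qed.

Lemma normr_Rintegral_mul f g (B : R) : mu.-integrable D (EFin \o f) ->
  measurable_fun D g -> (forall x, D x -> `|g x| <= B) ->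
  `|\int[mu]_(x in D) (f x * g x)| <= B * \int[mu]_(x in D) `|f x|.
Proof.
move=> fi mg gB; have fn := integrable_norm fi.
have fgi := integrable_mul_bounded mD fi mg gB.
apply: le_trans (le_normr_Rintegral mD fgi) _; rewrite -RintegralZl//.
apply: le_Rintegral => //.
- exact: integrable_norm.
- exact: (integrableZl mD B fn).
- by move=> x Dx; rewrite normrM mulrC ler_wpM2r// gB.
Qed.

End Rintegral_linear.

(** * Weak derivatives and difference quotients *)

Section difference_quotients.
Context (R : realType) (d : nat) (i : 'I_d).
Hypothesis d_gt0 : (0 < d)%N.
Local Notation L := (leb R d).
Local Notation T := (caratheodory_type (lebesgue_outer R d)).
Local Notation e_ := (delta_mx 0 i : 'rV[R]_d).
Implicit Types (c x : 'rV[R]_d) (A U K : set 'rV[R]_d) (f g u w phi : 'rV[R]_d -> R).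

Lemma integrable_shift K K' f c : compact K -> compact K' ->
  (forall x, K x -> K' (x + c)) -> L.-integrable K' (EFin \o f) ->
  L.-integrable K (EFin \o (fun x => f (x + c))).
Proof.
move=> cK cK' KK' fi.
have mK := measurable_compact cK.
have mK' := measurable_compact cK'.
have E : (EFin \o f) \_ K' = EFin \o (fun x => f x * \1_K' x).
  apply/funext => x; rewrite patchE /= indicE.
  by case: (x \in K'); rewrite ?mulr1 ?mulr0.
have := (@integrable_mkcond _ T R L K' (EFin \o f) mK').1 fi; rewrite E.
move=> /(@integrable_translate R d c) /(integrableS measurableT mK (@subsetT _ _)).
apply: eq_integrable => // x; rewrite inE => /KK' K'x.
by rewrite /= indicE mem_set// mulr1.
Qed.

Lemma integral_mul_shift K K' f phi c : compact K -> compact K' ->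
  L.-integrable K' (EFin \o f) -> continuous phi -> (forall x, ~ K x -> phi x = 0) ->
  (forall x, K x -> K' (x + c)) ->
  \int[L]_(x in K') (f x * phi (x - c)) = \int[L]_(x in K) (f (x + c) * phi x).
Proof.
move=> cK cK' fi cphi phi0 KK'.
have mK := measurable_compact cK.
have mK' := measurable_compact cK'.
pose h : T -> R := (fun x => f x * phi (x - c)) \_ K'.
have cphic : continuous (fun x => phi (x - c)).
  move=> x; apply: (@continuous_comp _ _ _ (fun x => x - c) phi); last exact: cphi.
  exact: translate_continuous.
have hi : L.-integrable setT (EFin \o h).
  have := (@integrable_mkcond _ T R L K' _ mK').1 (mul_continuous_integrable cK' fi cphic).
  by congr (L.-integrable setT _); apply/funext => x; rewrite /h /= !patchE; case: ifP.
rewrite Rintegral_mkcond [RHS]Rintegral_mkcond -(Rintegral_translate c hi).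
congr (Rintegral _ _ _); apply/funext => x; rewrite /h !patchE addrK.
have [Kx|Kx] := pselect (K x); first by rewrite !mem_set//; exact: KK'.
by rewrite (memNset Kx) phi0// mulr0; case: ifP.
Qed.

(** Differentiation under the integral: the Taylor remainder of phi is at most M k^2 uniformly in x,
    so integrated against u it is at most k^2 times a constant. *)
Lemma integral_smooth_shift_derive K u phi : compact K ->
  L.-integrable K (EFin \o u) -> test_function setT phi -> forall t : R,
  is_derive t (1 : R) (fun s => \int[L]_(x in K) (u x * phi (x - s *: e_)))
    (- \int[L]_(x in K) (u x * partial i phi (x - t *: e_))).
Proof.
move=> cK ui tphi t; have mK := measurable_compact cK.
have tp := test_function_partial i tphi.
have [M M0 HM] := test_function_bounded (test_function_partial i tp).
have cshift f (s : R) : continuous f -> continuous (fun x => f (x - s *: e_)).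
  move=> cf x; apply: (@continuous_comp _ _ _ (fun x => x - s *: e_) f); last exact: cf.
  exact: translate_continuous.
have cphi := differentiable_n_continuous (proj1 tphi 0%N).
have cpphi := differentiable_n_continuous (proj1 tp 0%N).
have Iphi s : L.-integrable K (EFin \o (fun x => u x * phi (x - s *: e_))).
  by apply: mul_continuous_integrable => //; exact: cshift.
have Ip s : L.-integrable K (EFin \o (fun x => u x * partial i phi (x - s *: e_))).
  by apply: mul_continuous_integrable => //; exact: cshift.
have un : L.-integrable K (EFin \o (fun x => `|u x|)) by exact: integrable_norm.
apply: (@is_derive_quadratic _ _ _ _ (M * \int[L]_(x in K) `|u x|)) => k.
pose D x := phi (x - (t + k) *: e_) - phi (x - t *: e_) + k * partial i phi (x - t *: e_).
have DE x : D x = phi (x - (t + k) *: e_) - phi (x - t *: e_) + k * partial i phi (x - t *: e_).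
  by [].
have DM x : `|D x| <= M * k ^+ 2.
  have := line_taylor (proj1 tphi) HM (x - t *: e_) (- k).
  have -> : x - t *: e_ + - k *: e_ = x - (t + k) *: e_.
    by rewrite scaleNr scalerDl opprD addrA.
  by rewrite sqrrN mulNr opprK -DE.
have mDD : @measurable_fun _ _ T _ K D.
  have c3 := cshift _ t cpphi; have c2 := cshift _ t cphi; have c1 := cshift _ (t + k) cphi.
  have mc f : continuous f -> @measurable_fun _ _ T _ K f by exact: continuous_leb_measurable.
  apply: measurable_funD; first exact: (measurable_funB (mc _ c1) (mc _ c2)).
  by apply: measurable_funM; [exact: measurable_cst|exact: mc].
have := @normr_Rintegral_mul _ T R L K mK u D _ ui mDD (fun x _ => DM x).
rewrite mulrAC; congr (`|_| <= _).
rewrite mulrN.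
have := @Rintegral_comb3 _ T R L K mK _ _ _ 1 (-1) k (Iphi (t + k)) (Iphi t) (Ip t).
rewrite mul1r mulN1r opprK => <-.
by apply: eq_Rintegral => x _; rewrite /D; ring.
Qed.

(** Convergence in L^1_loc of the one-sided difference quotients to g, multiplied through by s. The
    inclusion of [thick K s] in U keeps the shifted points in the set where u is controlled. *)
Definition dquot_cvg U u g := forall K, compact K -> K `<=` U ->
  forall eps : R, 0 < eps -> exists2 r : R, 0 < r &
  forall s, 0 < s <= r -> thick K s `<=` U /\
    (\int[L]_(x in K) (`|u (x + s *: e_)%R - u x - s * g x|%R)%:E <= (eps * s)%:E)%E.

Definition weak_partial U u g := [/\ locally_L1 U u, locally_L1 U g &
  forall phi, test_function U phi ->
    \int[L]_(x in U) (u x * partial i phi x) = - \int[L]_(x in U) (g x * phi x)].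

Lemma delta_shift_norm (t : R) j : `|(t *: e_) 0 j| <= `|t|.
Proof.
rewrite !mxE eqxx /= normrM ler_piMr// ger0_norm ?ler0n//.
by rewrite lern1 leq_b1.
Qed.

(* The L^1 norm on the left is a supremum over test functions phi. For each phi,
   t |-> \int u(x) phi(x - t e) is differentiable and the mean value theorem turns
   the increment of u into a translate of g. *)
Lemma weak_partial_shift U u g K (rho s C : R) : open U -> weak_partial U u g ->
  compact K -> 0 < rho -> thick K (rho + rho) `<=` U -> 0 < s <= rho ->
  (forall c : R, `|c| <= s ->
    (\int[L]_(x in thick K rho) (`|g (x + c *: e_)%R - g x|%R)%:E <= C%:E)%E) ->
  (\int[L]_(x in K) (`|u (x + s *: e_)%R - u x - s * g x|%R)%:E <= (C * s)%:E)%E.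
Proof.
move=> oU [lu lg ug] cK rho0 K2U /andP[s0 srho] gC.
(* One margin rho leaves room for the supports of the test functions around K, the second one for
   their translates by at most rho. *)
pose U' := othick K rho; pose K1 := thick K rho; pose K2 := thick K (rho + rho).
have oU' : open U' by exact: open_othick.
have cK1 : compact K1 by exact: compact_thick.
have cK2 : compact K2 by exact: compact_thick.
have K12 : K1 `<=` K2 by apply: le_thick; rewrite lerDl ltW.
have ui : L.-integrable K2 (EFin \o u) by exact: lu.
have gi : L.-integrable K2 (EFin \o g) by exact: lg.
have shift12 (c : R) x : `|c| <= rho -> K1 x -> K2 (x + c *: e_).
  move=> crho K1x; apply: thick_shift => // j.
  exact: le_trans (delta_shift_norm c j) crho.
have mK1 := measurable_compact cK1.
have mK2 := measurable_compact cK2.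
have u1 : L.-integrable K1 (EFin \o u) by exact: (integrableS mK2 mK1 K12 ui).
have g1 : L.-integrable K1 (EFin \o g) by exact: (integrableS mK2 mK1 K12 gi).
have us (c : R) : `|c| <= rho -> L.-integrable K1 (EFin \o (fun x => u (x + c *: e_))).
  by move=> crho; apply: (integrable_shift cK1 cK2 _ ui) => x; exact: shift12.
have gs (c : R) : `|c| <= rho -> L.-integrable K1 (EFin \o (fun x => g (x + c *: e_))).
  by move=> crho; apply: (integrable_shift cK1 cK2 _ gi) => x; exact: shift12.
have srho' : `|s| <= rho by rewrite gtr0_norm.
have KU' : K `<=` U' by exact: sub_othick.
have lf : locally_L1 U' (fun x => u (x + s *: e_) - u x - s * g x).
  move=> A cA AU'; have AK1 : A `<=` K1 by apply: subset_trans AU' _; exact: othick_thick.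
  have mA := measurable_compact cA.
  have := @integrable_comb3 _ T R L K1 mK1 _ _ _ 1 (-1) (- s) (us _ srho') u1 g1.
  move=> /(integrableS mK1 mA AK1); apply: eq_integrable => // x _ /=.
  by congr EFin; ring.
apply: (fundamental_lemma d_gt0 oU' lf cK KU') => phi tphi phi1.
have U'K1 : U' `<=` K1 by exact: othick_thick.
have [sphi [A [cA AU' phi0]]] := tphi.
have AK1 : A `<=` K1 by exact: subset_trans U'K1.
have cphi : continuous phi := differentiable_n_continuous (sphi 0%N).
have off1 psi : test_function U' psi -> forall x, ~ K1 x -> psi x = 0.
  by move=> [_ [B [_ BU' psi0]]] x K1x; apply: psi0 => /BU'/U'K1.
have tT : test_function setT phi by exact: test_functionS tphi.
have prod0 x : ~ A x -> (u (x + s *: e_) - u x - s * g x) * phi x = 0.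
  by move=> /phi0 ->; rewrite mulr0.
rewrite (Rintegral_support prod0 AU') -(Rintegral_support prod0 AK1).
(* The intermediate point c depends on phi, which is why translates of g are controlled for all |c|
   <= s. *)
have [c cs] := MVT_0 s (integral_smooth_shift_derive cK2 ui tT).
have crho : `|c| <= rho by exact: le_trans cs srho'.
rewrite (integral_mul_shift cK1 cK2 ui cphi (off1 _ tphi)
  (fun x => @shift12 s x srho')).
have zrho : `|0 : R| <= rho by rewrite normr0 ltW.
rewrite (integral_mul_shift cK1 cK2 ui cphi (off1 _ tphi)
  (fun x => @shift12 0 x zrho)).
(* The derivative at c is an integral of u against a partial derivative of this translate, to which
   the definition of the weak derivative applies. *)
have tphic : test_function U (fun x => phi (x - c *: e_)).
  apply: (test_function_translate tphi) => x /U'K1 K1x; rewrite opprK.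
  by apply: K2U; exact: shift12.
have pE : partial i (fun x => phi (x - c *: e_)) = fun x => partial i phi (x - c *: e_).
  apply/funext => x; apply: partialE; apply: is_derive_translate.
  exact: differentiable_n_derive (sphi 1%N).
have off2 (psi : 'rV[R]_d -> R) : (forall x, ~ K1 x -> psi x = 0) ->
    forall x, ~ K2 x -> psi (x - c *: e_) = 0.
  move=> psi0 x K2x; apply: psi0 => K1x; apply: K2x.
  by have := shift12 c _ crho K1x; rewrite subrK.
have tpp := test_function_partial i tphi.
have := ug _ tphic; rewrite pE.
rewrite (@Rintegral_support _ _ K2 U (fun x => u x * partial i phi (x - c *: e_)) _ K2U); last first.
  by move=> x K2x; rewrite (off2 _ (off1 _ tpp) x K2x) mulr0.
rewrite (@Rintegral_support _ _ K2 U (fun x => g x * phi (x - c *: e_)) _ K2U); last first.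
  by move=> x K2x; rewrite (off2 _ (off1 _ tphi) x K2x) mulr0.
move=> ->; rewrite opprK.
rewrite (integral_mul_shift cK1 cK2 gi cphi (off1 _ tphi)
  (fun x => @shift12 c x crho)) => E.
have M f : L.-integrable K1 (EFin \o f) -> L.-integrable K1 (EFin \o (fun x => f x * phi x)).
  by move=> fi; exact: mul_continuous_integrable.
have := @Rintegral_comb3 _ T R L K1 mK1 _ _ _ 1 (-1) (- s)
  (M _ (us _ srho')) (M _ u1) (M _ g1).
rewrite mul1r mulN1r.
have -> : \int[L]_(x in K1) (u x * phi x) = \int[L]_(x in K1) (u (x + 0 *: e_) * phi x).
  by apply: eq_Rintegral => x _; rewrite scale0r addr0.
rewrite E => E2.
have -> : \int[L]_(x in K1) ((u (x + s *: e_) - u x - s * g x) * phi x) =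
    s * \int[L]_(x in K1) ((g (x + c *: e_) - g x) * phi x).
  transitivity (\int[L]_(x in K1) (1 * (u (x + s *: e_) * phi x) + -1 * (u x * phi x)
     + - s * (g x * phi x))).
    by apply: eq_Rintegral => x _; ring.
  rewrite E2 mulrC mulNr -mulrBr; congr (_ * _).
  have := @Rintegral_comb3 _ T R L K1 mK1 _ _ _ 1 (-1) 0
    (M _ (gs _ crho)) (M _ g1) (M _ g1).
  rewrite mul1r mulN1r mul0r addr0 => <-.
  by apply: eq_Rintegral => x _; ring.
have gcg : L.-integrable K1 (EFin \o (fun x => g (x + c *: e_) - g x)).
  have := @integrable_comb3 _ T R L K1 mK1 _ _ _ 1 (-1) 0 (gs _ crho) g1 g1.
  by congr (L.-integrable K1 _); apply/funext => x /=; congr EFin; ring.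
have mphi : @measurable_fun _ _ T _ K1 phi by exact: continuous_leb_measurable.
rewrite normrM gtr0_norm// mulrC ler_wpM2r ?(ltW s0)//.
apply: le_trans (normr_Rintegral_mul mK1 gcg mphi (fun x _ => phi1 x)) _.
rewrite mul1r -lee_fin -integral_Rintegral//; last exact: integrable_norm.
by apply: gC; apply: le_trans cs _; rewrite gtr0_norm.
Qed.

Lemma weak_partial_dquot U u g : open U -> weak_partial U u g -> dquot_cvg U u g.
Proof.
move=> oU wug K cK KU eps eps0; have [lu lg _] := wug.
have [r0 r00 r0U] := thick_sub cK oU KU.
pose rho := r0 / 2; have rho0 : 0 < rho by rewrite divr_gt0.
have rhoE : rho + rho = r0 by rewrite -splitr.
have K2U : thick K (rho + rho) `<=` U by rewrite rhoE.
have cK1 : compact (thick K rho) by exact: compact_thick.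
have cK2 : compact (thick K (rho + rho)) by exact: compact_thick.
have [r1 r10 Hr1] := translation_continuity i d_gt0 cK1 cK2 (lg _ cK2 K2U) eps0.
exists (Num.min r1 rho); first by rewrite lt_min r10.
move=> s /andP[s0]; rewrite le_min => /andP[sr1 srho]; split.
  apply: subset_trans K2U; apply: le_thick; apply: le_trans srho _.
  by rewrite lerDl ltW.
apply: (weak_partial_shift oU wug cK rho0 K2U); first by rewrite s0.
move=> c cs; apply: Hr1 => [|x K1x]; first exact: le_trans cs sr1.
split; first by apply: le_thick K1x; rewrite lerDl ltW.
apply: thick_shift => // j; apply: le_trans (delta_shift_norm c j) _.
exact: le_trans cs srho.
Qed.

End difference_quotients.

Section weak_derivative_of_limits.
Context (R : realType) (d : nat) (i : 'I_d).
Hypothesis d_gt0 : (0 < d)%N.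
Local Notation L := (leb R d).
Local Notation T := (caratheodory_type (lebesgue_outer R d)).
Local Notation e_ := (delta_mx 0 i : 'rV[R]_d).
Implicit Types (c x : 'rV[R]_d) (A U K : set 'rV[R]_d) (f g u w phi : 'rV[R]_d -> R).

(** Discrete integration by parts: moving the shift from w to phi expresses s (I1 + I2) through two
    error terms, the Taylor remainder of phi against w, of order s^2, and the L^1 error of the
    difference quotient against phi, small compared with s. Dividing by s shows that I1 + I2 is
    arbitrarily small. *)
Lemma dquot_weak_partial U w k : open U -> locally_L1 U w -> locally_L1 U k ->
  dquot_cvg i U w k -> weak_partial i U w k.
Proof.
move=> oU lw lk wk; split => // phi tphi.
have [sphi [A [cA AU phi0]]] := tphi.
have [r0 r00 r0U] := thick_sub cA oU AU.
pose K2 := thick A r0; have cK2 : compact K2 by exact: compact_thick.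
have AK2 : A `<=` K2.
  by apply: subset_trans (othick_thick (r := r0)); exact: sub_othick.
have mA := measurable_compact cA.
have mK2 := measurable_compact cK2.
have wi : L.-integrable K2 (EFin \o w) by exact: lw.
have wA : L.-integrable A (EFin \o w) by exact: lw.
have kA : L.-integrable A (EFin \o k) by exact: lk.
have tp := test_function_partial i tphi.
have cphi : continuous phi := differentiable_n_continuous (sphi 0%N).
have cp : continuous (partial i phi) := differentiable_n_continuous (proj1 tp 0%N).
have [B B0 HB] := test_function_bounded tphi.
have [M M0 HM] := test_function_bounded (test_function_partial i tp).
have p0 x : ~ A x -> partial i phi x = 0.
  move=> Ax; apply: partialE.
  have oA : open (~` A).
    by apply: closed_openC; apply: compact_closed => //; exact: norm_hausdorff.
  have d0 : is_derive x e_ (cst 0 : 'rV[R]_d -> R) 0 by exact: is_derive_cst.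
  apply: near_eq_is_derive d0.
  by near=> y; rewrite phi0//; near: y; exact: open_nbhs_nbhs.
have wp0 x : ~ K2 x -> w x * partial i phi x = 0.
  by move=> K2x; rewrite p0 ?mulr0// => /AK2.
have kp0 x : ~ A x -> k x * phi x = 0 by move=> /phi0 ->; rewrite mulr0.
rewrite (Rintegral_support wp0 r0U) (Rintegral_support kp0 AU).
set I1 := \int[L]_(x in K2) _; set I2 := \int[L]_(x in A) _.
pose N := \int[L]_(x in K2) `|w x|.
have N0 : 0 <= N by exact: Rintegral_ge0.
have N1 : 0 < M * N + 1 by rewrite ltr_wpDl// mulr_ge0// ltW.
suff H : forall eta : R, 0 < eta -> `|I1 + I2| <= eta.
  apply/eqP; rewrite -subr_eq0 opprK -normr_le0; apply/ler_addgt0Pr => eta eta0.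
  by rewrite add0r; exact: H.
move=> eta eta0; have e0 : 0 < eta / 2 / B by rewrite !divr_gt0.
have [r r_gt0 Hr] := wk A cA AU _ e0.
(* The three bounds give the quotient estimate, keep the shifted support in [K2], and make M N s <=
   eta/2. *)
pose s := Num.min r (Num.min r0 (eta / 2 / (M * N + 1))).
have s0 : 0 < s by rewrite /s !lt_min r_gt0 r00 !divr_gt0.
have sr : s <= r by rewrite /s ge_min lexx.
have sr0 : s <= r0 by rewrite /s ge_min ge_min lexx orbT.
have sN : s <= eta / 2 / (M * N + 1) by rewrite /s ge_min ge_min lexx !orbT.
have [_ Hs] : thick A s `<=` U /\ _ := Hr s (introT andP (conj s0 sr)).
have shiftA x : A x -> K2 (x + s *: e_).
  move=> Ax; exists x => // j; rewrite mxE addrAC subrr add0r.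
  by apply: le_trans (delta_shift_norm _ _ _) _; rewrite gtr0_norm.
have cphis : continuous (fun x => phi (x - s *: e_)).
  move=> x; apply: (@continuous_comp _ _ _ (fun x => x - s *: e_) phi); last exact: cphi.
  exact: translate_continuous.
pose D x := phi (x - s *: e_) - phi x + s * partial i phi x.
have DM x : `|D x| <= M * s ^+ 2.
  have := line_taylor sphi HM x (- s).
  by rewrite sqrrN mulNr opprK scaleNr.
have mc (E : set T) f : continuous f -> @measurable_fun _ _ T _ E f.
  exact: continuous_leb_measurable.
have mD : @measurable_fun _ _ T _ K2 D.
  apply: measurable_funD; first exact: (measurable_funB (mc _ _ cphis) (mc _ _ cphi)).
  by apply: measurable_funM; [exact: measurable_cst|exact: mc].
have wsA : L.-integrable A (EFin \o (fun x => w (x + s *: e_))).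
  exact: (integrable_shift cA cK2 shiftA wi).
have Q : L.-integrable A (EFin \o (fun x => w (x + s *: e_) - w x - s * k x)).
  have := @integrable_comb3 _ T R L A mA _ _ _ 1 (-1) (- s) wsA wA kA.
  by congr (L.-integrable A _); apply/funext => x /=; congr EFin; ring.
have E1 : \int[L]_(x in K2) (w x * D x) =
    \int[L]_(x in A) (w (x + s *: e_) * phi x) - \int[L]_(x in A) (w x * phi x) + s * I1.
  have M2 f : continuous f -> L.-integrable K2 (EFin \o (fun x => w x * f x)).
    by move=> cf; exact: mul_continuous_integrable.
  have := @Rintegral_comb3 _ T R L K2 mK2 _ _ _ 1 (-1) s (M2 _ cphis) (M2 _ cphi) (M2 _ cp).
  rewrite mul1r mulN1r -/I1 (integral_mul_shift cA cK2 wi cphi phi0 shiftA).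
  rewrite -(@Rintegral_support _ _ A K2 (fun x => w x * phi x) _ AK2); last first.
    by move=> x /phi0 ->; rewrite mulr0.
  by move=> <-; apply: eq_Rintegral => x _; rewrite /D; ring.
have E2 : \int[L]_(x in A) ((w (x + s *: e_) - w x - s * k x) * phi x) =
    \int[L]_(x in A) (w (x + s *: e_) * phi x) - \int[L]_(x in A) (w x * phi x) - s * I2.
  have MA f : L.-integrable A (EFin \o f) -> L.-integrable A (EFin \o (fun x => f x * phi x)).
    by move=> fi; exact: mul_continuous_integrable.
  have := @Rintegral_comb3 _ T R L A mA _ _ _ 1 (-1) (- s) (MA _ wsA) (MA _ wA) (MA _ kA).
  rewrite mul1r mulN1r mulNr -/I2 => <-.
  by apply: eq_Rintegral => x _; ring.
have sI : s * (I1 + I2) = \int[L]_(x in K2) (w x * D x) -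
    \int[L]_(x in A) ((w (x + s *: e_) - w x - s * k x) * phi x).
  by rewrite E1 E2; ring.
have B1 := normr_Rintegral_mul mK2 wi mD (fun x _ => DM x).
have B2 := normr_Rintegral_mul mA Q (mc A _ cphi) (fun x _ => HB x).
have B3 : \int[L]_(x in A) `|w (x + s *: e_) - w x - s * k x| <= eta / 2 / B * s.
  by rewrite -lee_fin -integral_Rintegral//; exact: integrable_norm.
have : s * `|I1 + I2| <= s * eta.
  rewrite -[X in X * `|_|]gtr0_norm// -normrM sI.
  apply: le_trans (ler_normB _ _) _.
  have -> : s * eta = s * (eta / 2) + B * (eta / 2 / B * s) by field; rewrite gt_eqF.
  apply: lerD; last by apply: le_trans B2 _; rewrite ler_wpM2l// ltW.
  apply: le_trans B1 _; rewrite -/N mulrAC expr2 mulrA mulrC ler_wpM2l ?(ltW s0)//.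
  move: sN; rewrite ler_pdivlMr// => sN.
  by apply: le_trans sN; rewrite mulrC ler_wpM2l ?(ltW s0)// lerDl.
by rewrite ler_pM2l.
Unshelve. all: by end_near. Qed.

End weak_derivative_of_limits.

(* q is the Taylor remainder of F between u(x) and u(x + s e), D is the increment
   |u(x + s e) - u(x)|, a its distance to s G with G = |g|, and G <= M + X cuts the
   large values of g. *)
Lemma quotient_chain_bound (R : realType) (q a s D G M X : R) :
  0 <= a -> 0 < s -> 0 <= G -> 0 <= M -> 0 <= X ->
  G <= M + X -> q <= D -> q <= D ^+ 2 -> 0 <= D -> D <= a + s * G ->
  q <= a + s * (M * D + X).
Proof.
move=> a0 s0 G0 M0 X0 GMX qD qD2 D0 DaG.
have [D1|D1] := leP 1 D.
  apply: le_trans qD _; apply: le_trans DaG _; rewrite lerD2l ler_pM2l//.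
  apply: le_trans GMX _; rewrite lerD2r; exact: ler_peMr.
apply: le_trans qD2 _; apply: (@le_trans _ _ ((a + s * G) * D)).
  by rewrite expr2 ler_wpM2r.
rewrite mulrDl; apply: lerD; first by rewrite ler_piMr// ltW.
rewrite -mulrA ler_pM2l//; apply: (@le_trans _ _ ((M + X) * D)).
  by rewrite ler_wpM2r.
by rewrite mulrDl lerD2l ler_piMr// ltW.
Qed.

Lemma ge0_integral_le_comb3 (disp : measure_display) (T : measurableType disp) (R : realType)
    (mu : {measure set T -> \bar R}) (D : set T) (h a b x : T -> R)
    (c1 c2 c3 A B X : R) : measurable D -> 0 <= c1 -> 0 <= c2 -> 0 <= c3 ->
  measurable_fun D h -> measurable_fun D a -> measurable_fun D b -> measurable_fun D x ->
  (forall t, 0 <= h t) -> (forall t, 0 <= a t) -> (forall t, 0 <= b t) ->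
  (forall t, 0 <= x t) ->
  (forall t, D t -> h t <= c1 * a t + c2 * b t + c3 * x t) ->
  (\int[mu]_(t in D) (a t)%:E <= A%:E)%E ->
  (\int[mu]_(t in D) (b t)%:E <= B%:E)%E ->
  (\int[mu]_(t in D) (x t)%:E <= X%:E)%E ->
  (\int[mu]_(t in D) (h t)%:E <= (c1 * A + c2 * B + c3 * X)%:E)%E.
Proof.
move=> mD c10 c20 c30 mh ma mb mx h0 a0 b0 x0 hle Ia Ib Ix.
have mZ (c : R) (w : T -> R) : measurable_fun D w -> measurable_fun D (fun t => c * w t).
  by move=> mw; apply: measurable_funM.
have m12 : measurable_fun D (fun t => c1 * a t + c2 * b t).
  by apply: measurable_funD; exact: mZ.
apply: le_trans (@ge0_integral_le_add _ _ _ mu D mD h (fun t => c1 * a t + c2 * b t)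
  (fun t => c3 * x t) mh m12 (mZ c3 _ mx) _ _ _) _.
- by move=> t _; rewrite addr_ge0// mulr_ge0.
- by move=> t _; rewrite mulr_ge0.
- by move=> t Dt; rewrite h0 hle.
rewrite ge0_integralD_EFin//; try exact: mZ; last 2 first.
- by move=> t _; rewrite mulr_ge0.
- by move=> t _; rewrite mulr_ge0.
rewrite !ge0_integralZl_EFin'//.
have -> : (c1 * A + c2 * B + c3 * X)%:E =
    (c1%:E * A%:E + c2%:E * B%:E + c3%:E * X%:E)%E by [].
by apply: leeD; [apply: leeD|]; apply: lee_wpmul2l.
Qed.

Section chain_rule.
Context (R : realType) (d : nat).
Hypothesis d_gt0 : (0 < d)%N.
Context (F f : R -> R).
Hypothesis F_lip : forall a b, `|F b - F a| <= `|b - a|.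
Hypothesis f_cont : continuous f.
Hypothesis f_le1 : forall a, `|f a| <= 1.
Hypothesis F_taylor1 : forall a b, `|F b - F a - f a * (b - a)| <= `|b - a|.
Hypothesis F_taylor2 : forall a b, `|F b - F a - f a * (b - a)| <= (b - a) ^+ 2.
Hypothesis F0 : F 0 = 0.
Local Notation L := (leb R d).
Local Notation T := (caratheodory_type (lebesgue_outer R d)).
Implicit Types (c x : 'rV[R]_d) (A U K : set 'rV[R]_d) (g u : 'rV[R]_d -> R).

Lemma lipschitz_continuous : continuous F.
Proof.
move=> a; apply/cvgrPdist_le => e e0; near=> b.
apply: le_trans (F_lip b a) _; near: b.
by apply/nbhs_ballP; exists e => // b; exact: ltW.
Unshelve. all: by end_near. Qed.

Lemma F_le a : `|F a| <= `|a|.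
Proof. by have := F_lip 0 a; rewrite F0 !subr0. Qed.

Lemma comp_locally_L1 U u : locally_L1 U u -> locally_L1 U (F \o u).
Proof.
move=> lu K cK KU; have mK := measurable_compact cK.
have ui : L.-integrable K (EFin \o u) := lu K cK KU.
apply: (@integrable_le _ T R L K mK (F \o u) u _ ui) => [|x _]; last exact: F_le.
have mF := continuous_measurable_fun lipschitz_continuous.
exact: (measurableT_comp mF (integrable_measurable ui)).
Qed.

Lemma mul_locally_L1 U u g : locally_L1 U u -> locally_L1 U g ->
  locally_L1 U (fun x => f (u x) * g x).
Proof.
move=> lu lg K cK KU; have mK := measurable_compact cK.
have ui : L.-integrable K (EFin \o u) := lu K cK KU.
have gi : L.-integrable K (EFin \o g) := lg K cK KU.
have mfu : @measurable_fun _ _ T _ K (f \o u).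
  exact: (measurableT_comp (continuous_measurable_fun f_cont) (integrable_measurable ui)).
have := @integrable_mul_bounded _ T R L K mK g (f \o u) 1 gi mfu (fun x _ => f_le1 (u x)).
by congr (L.-integrable K _); apply/funext => x /=; rewrite mulrC.
Qed.

(** With A = u(x) and B = u(x + s e), the quantity F(B) - F(A) - s f(A) g is the Taylor remainder of
    F plus f(A) times the error B - A - s g. The latter is small compared with s in L^1 as |f| <= 1;
    the former is treated by [quotient_chain_bound], whose term s X is made small by the choice of M
    rather than of s. *)
Lemma chain_rule U u g i : open U -> weak_partial i U u g ->
  weak_partial i U (F \o u) (fun x => f (u x) * g x).
Proof.
move=> oU wug; have [lu lg _] := wug.
apply: dquot_weak_partial => //.
- exact: comp_locally_L1.
- exact: mul_locally_L1.
move=> K cK KU eta eta0.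
have mK := measurable_compact cK.
have ui : L.-integrable K (EFin \o u) := lu K cK KU.
have gi : L.-integrable K (EFin \o g) := lg K cK KU.
have eta4 : 0 < eta / 4 by rewrite divr_gt0.
have [M M0 HM] := excess_small mK gi eta4.
have eta8 : 0 < eta / 8 by rewrite divr_gt0.
have [r1 r10 Hr1] := weak_partial_dquot d_gt0 oU wug cK KU eta8.
pose N := \int[L]_(x in K) `|g x|.
have N0 : 0 <= N by exact: Rintegral_ge0.
have MN : 0 < M * (eta / 8 + N) + 1 by rewrite ltr_wpDl// mulr_ge0// addr_ge0// ltW.
(* The errors, divided by s, are 2 (eta/8) from the quotients of u, eta/4 from the excess, and s M
   (eta/8 + N), which this choice keeps below eta/4. *)
exists (Num.min r1 (eta / 4 / (M * (eta / 8 + N) + 1))).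
  by rewrite lt_min r10 divr_gt0.
move=> s /andP[s0]; rewrite le_min => /andP[sr1 sMN].
have [sU Hs] := Hr1 s (introT andP (conj s0 sr1)); split; first exact: sU.
pose e_ : 'rV[R]_d := delta_mx 0 i.
have cs : compact (thick K s) by exact: compact_thick.
have shiftK x : K x -> thick K s (x + s *: e_).
  move=> Kx; exists x => // j; rewrite mxE addrAC subrr add0r.
  by apply: le_trans (delta_shift_norm _ _ _) _; rewrite gtr0_norm.
have usi : L.-integrable K (EFin \o (fun x => u (x + s *: e_))).
  exact: (integrable_shift cK cs shiftK (lu _ cs sU)).
have mu := integrable_measurable ui; have mus := integrable_measurable usi.
have mg := integrable_measurable gi.
have mF := continuous_measurable_fun lipschitz_continuous.
have mf := continuous_measurable_fun f_cont.
pose a : T -> R := fun x => `|u (x + s *: e_) - u x - s * g x|.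
pose h : T -> R := fun x => `|F (u (x + s *: e_)) - F (u x) - s * (f (u x) * g x)|.
pose gn : T -> R := fun x => `|g x|.
pose X : T -> R := @excess _ T R g M.
have mZ (w : T -> R) : @measurable_fun _ _ T _ K w -> @measurable_fun _ _ T _ K (fun x => s * w x).
  by move=> mw; exact: (measurable_funM (measurable_cst s) mw).
have ma : @measurable_fun _ _ T _ K a.
  exact: measurable_fun_normB (measurable_funB mus mu) (mZ _ mg).
have mh : @measurable_fun _ _ T _ K h.
  apply: measurable_fun_normB.
    exact: measurable_funB (measurableT_comp mF mus) (measurableT_comp mF mu).
  exact: (mZ _ (measurable_funM (measurableT_comp mf mu) mg)).
have mX : @measurable_fun _ _ T _ K X by exact: (@measurable_excess _ T R K g M mg).
have X0 x : 0 <= X x by exact: excess_ge0.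
have a0 x : 0 <= a x by exact: normr_ge0.
have gn0 x : 0 <= gn x by exact: normr_ge0.
have gX x : gn x <= M + X x by exact: le_excess.
have In : (\int[L]_(x in K) (gn x)%:E <= N%:E)%E.
  by rewrite integral_Rintegral//; exact: integrable_norm.
have hle x : K x -> h x <= (2 + s * M) * a x + (s * (s * M)) * gn x + s * X x.
  move=> _; set A := u x; set B := u (x + s *: e_); rewrite /h -/A -/B.
  have hq : h x <= `|F B - F A - f A * (B - A)| + a x.
    rewrite /h -/A -/B.
    have -> : F B - F A - s * (f A * g x) =
        (F B - F A - f A * (B - A)) + f A * (B - A - s * g x) by ring.
    apply: le_trans (ler_normD _ _) _; rewrite lerD2l normrM.
    by rewrite ler_piMl.
  have Da : `|B - A| <= a x + s * gn x.
    rewrite -[s]gtr0_norm// -normrM /a -/A -/B.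
    by apply: le_trans (ler_normD _ _); rewrite subrK.
  have q2 : `|F B - F A - f A * (B - A)| <= `|B - A| ^+ 2.
    by rewrite real_normK ?num_real.
  have := quotient_chain_bound (a0 x) s0 (gn0 x) M0 (X0 x) (gX x)
    (F_taylor1 A B) q2 (normr_ge0 _) Da.
  have := ler_wpM2l (mulr_ge0 (ltW s0) M0) Da.
  move: hq; rewrite /h -/A -/B.
  move: `|_| `|_| `|_| (a x) (gn x) (X x) => D Q V a' g' x' h1 h2 h3.
  apply: le_trans h1 _; apply: le_trans (lerD h3 (lexx _)) _.
  have -> : (2 + s * M) * a' + s * (s * M) * g' + s * x' =
    a' + s * x' + a' + s * M * (a' + s * g') by ring.
  have -> : a' + s * (M * D + x') + a' = a' + s * x' + a' + s * M * D by ring.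
  by rewrite lerD2l.
have c1 : 0 <= 2 + s * M by rewrite addr_ge0// mulr_ge0// ltW.
have c2 : 0 <= s * (s * M) by rewrite !mulr_ge0// ltW.
have := @ge0_integral_le_comb3 _ T R L K h a gn X _ _ _ _ _ _ mK c1 c2 (ltW s0)
  mh ma (measurable_fun_norm mg) mX (fun x => normr_ge0 _) a0 gn0 X0 hle Hs In HM.
move=> /le_trans; apply; rewrite lee_fin.
move: sMN; rewrite ler_pdivlMr// => sMN.
have -> : (2 + s * M) * (eta / 8 * s) + s * (s * M) * N + s * (eta / 4) =
  s * (s * (M * (eta / 8 + N)) + eta / 2) by field.
rewrite [leRHS]mulrC ler_pM2l//.
apply: (@le_trans _ _ (eta / 4 + eta / 2)); last by lra.
rewrite lerD2r; apply: le_trans sMN; rewrite ler_pM2l//.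
by rewrite lerDl.
Qed.

End chain_rule.

Lemma ae0_of_integral (disp : measure_display) (T : measurableType disp) (R : realType)
    (mu : {measure set T -> \bar R}) (K : set T) (h : T -> R) : measurable K ->
  measurable_fun K h -> (\int[mu]_(x in K) (`|h x|%R)%:E <= 0)%E ->
  {ae mu, forall x, K x -> h x = 0}.
Proof.
move=> mK mh h0.
have mh' : measurable_fun K (EFin \o h) by exact/measurable_EFinP.
have h1 : (\int[mu]_(x in K) `|(EFin \o h) x| = 0)%E.
  apply/eqP; rewrite eq_le h0/=; by apply: integral_ge0 => x _; rewrite lee_fin.
have := (ae_eq_integral_abs mu mK mh').1 h1.
by apply: filterS => x hx Kx; have := hx Kx => -[].
Qed.

(** * Localisation and uniqueness of weak gradients *)

Section gradients.
Context (R : realType) (d : nat).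
Hypothesis d_gt0 : (0 < d)%N.
Local Notation L := (leb R d).
Local Notation T := (caratheodory_type (lebesgue_outer R d)).
Implicit Types (c x : 'rV[R]_d) (A U K : set 'rV[R]_d) (u v w : 'rV[R]_d -> R)
  (g : 'rV[R]_d -> 'rV[R]_d).

Lemma weak_gradientP U u g : weak_gradient U u g <->
  forall i, weak_partial i U u (fun x => g x 0 i).
Proof.
split => [[lu lg ug] i|H]; first by split => // phi; exact: ug.
split => [|i|phi i].
- by have [] := H (Ordinal d_gt0).
- by have [] := H i.
- by have [_ _] := H i; exact.
Qed.

Lemma locally_L1S U U' u : U' `<=` U -> locally_L1 U u -> locally_L1 U' u.
Proof. by move=> U'U lu K cK KU'; apply: lu => //; exact: subset_trans KU' U'U. Qed.

Lemma weak_partialS U U' u (k : 'rV[R]_d -> R) i : U' `<=` U ->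
  weak_partial i U u k -> weak_partial i U' u k.
Proof.
move=> U'U [lu lk uk]; split; [exact: locally_L1S lu|exact: locally_L1S lk|].
move=> phi tphi; have := uk _ (test_functionS U'U tphi).
have [_ [A [_ AU' phi0]]] := tphi.
have [_ [B [_ BU' p0]]] := test_function_partial i tphi.
rewrite (@Rintegral_support _ _ U' U (fun x => u x * partial i phi x) _ U'U); last first.
  by move=> x U'x; rewrite p0 ?mulr0// => /BU'.
rewrite (@Rintegral_support _ _ U' U (fun x => k x * phi x) _ U'U)//.
by move=> x U'x; rewrite phi0 ?mulr0// => /AU'.
Qed.

Lemma weak_gradientS U U' u g : U' `<=` U ->
  weak_gradient U u g -> weak_gradient U' u g.
Proof.
move=> U'U /weak_gradientP ug; apply/weak_gradientP => i.
exact: weak_partialS (ug i).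
Qed.

(** The difference k - k' integrates to 0 against every test function, so the fundamental lemma
    applies with C = 0. *)
Lemma weak_partial_unique U u (k k' : 'rV[R]_d -> R) i K : open U ->
  weak_partial i U u k -> weak_partial i U u k' -> compact K -> K `<=` U ->
  {ae L, forall x, K x -> k x = k' x}.
Proof.
move=> oU [lu lk uk] [_ lk' uk'] cK KU.
have mK := measurable_compact cK.
have lkk' : locally_L1 U (fun x => k x - k' x).
  move=> A cA AU; have mA := measurable_compact cA.
  exact: (integrableB mA (lk _ cA AU) (lk' _ cA AU)).
have H0 : (\int[L]_(x in K) (`|k x - k' x|%R)%:E <= 0%:E)%E.
  apply: (fundamental_lemma d_gt0 oU lkk' cK KU) => phi tphi phi1.
  have [sphi [A [cA AU phi0]]] := tphi.
  have mA := measurable_compact cA.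
  have cphi := differentiable_n_continuous (sphi 0%N).
  have m0 (l : 'rV[R]_d -> R) x : ~ A x -> l x * phi x = 0 by move=> /phi0 ->; rewrite mulr0.
  have E := uk _ tphi; rewrite (uk' _ tphi) in E; move/oppr_inj : E.
  rewrite (Rintegral_support (m0 k) AU) (Rintegral_support (m0 k') AU) => E.
  rewrite (Rintegral_support (m0 (fun x => k x - k' x)) AU).
  rewrite (_ : Rintegral _ _ _ = 0) ?normr0//.
  have ki := mul_continuous_integrable cA (lk _ cA AU) cphi.
  have k'i := mul_continuous_integrable cA (lk' _ cA AU) cphi.
  have := RintegralB mA ki k'i; rewrite E subrr => <-.
  by apply: eq_Rintegral => x _; rewrite mulrBl.
have := @ae0_of_integral _ T R L K (fun x => k x - k' x) mK
  (integrable_measurable (lkk' _ cK KU)) H0.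
apply: filterS => x hx Kx; apply/eqP; rewrite -subr_eq0; apply/eqP; exact: hx.
Qed.

Lemma open_sigma_compact U : open U ->
  exists K_ : nat -> set 'rV[R]_d, [/\ forall n, compact (K_ n),
    forall n, K_ n `<=` U & U = \bigcup_n K_ n].
Proof.
move=> oU.
pose K_ n := if @unpickle ('rV[int]_d * nat)%type n is Some k then
    if `[< cbox (cube_lo R k) (cube_hi R k) `<=` U >]
    then cbox (cube_lo R k) (cube_hi R k) else set0
  else set0 : set 'rV[R]_d.
exists K_; split.
- move=> n; rewrite /K_; case: unpickle => [k|]; last exact: compact0.
  by case: ifP => _; [exact: compact_cbox|exact: compact0].
- move=> n; rewrite /K_; case: unpickle => [k|]; last exact: sub0set.
  by case: ifP => [/asboolP//|_]; exact: sub0set.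
- apply/seteqP; split => [x Ux|x [n _]]; last first.
    rewrite /K_; case: unpickle => [k|//].
    by case: ifP => [/asboolP kU /kU|].
  have := Ux; rewrite {1}(open_bigcup_cubes oU) => -[k /= kU xk].
  exists (pickle k) => //; rewrite /K_ pickleK; case: asboolP => // _ i.
  by have /andP[-> /ltW ->] := xk i.
Qed.

Lemma ae_open_of_compact U (P : T -> Prop) : open U ->
  (forall K, compact K -> K `<=` U -> {ae L, forall x, K x -> P x}) ->
  {ae L, forall x, U x -> P x}.
Proof.
move=> oU HK; have [K_ [cK KU ->]] := open_sigma_compact oU.
have : {ae L, forall x : T, forall n, K_ n x -> P x}.
  by apply/ae_foralln => n; exact: HK.
by apply: (@filterS _ _ (ae_filter_ringOfSetsType L)) => x Hx [n _ /Hx].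
Qed.

Lemma measurable_open_of_compact U (h : 'rV[R]_d -> R) : open U ->
  (forall K, compact K -> K `<=` U -> @measurable_fun _ _ T _ K h) ->
  @measurable_fun _ _ T _ U h.
Proof.
move=> oU HK; have [K_ [cK KU ->]] := open_sigma_compact oU.
apply/(@measurable_fun_bigcup _ _ T _ K_) => n.
  by apply: measurable_compact.
exact: HK.
Qed.

End gradients.

(** * Truncation in Sobolev spaces *)

Section powers.
Context (R : realType).
Implicit Types (a b e p : R).

Lemma le_powR p a b : 0 <= p -> 0 <= a -> a <= b -> a `^ p <= b `^ p.
Proof.
move=> p0 a0 ab; apply: ge0_ler_powR => //.
exact: le_trans ab.
Qed.

Lemma powRD_le p a b : 0 < p -> 0 <= a -> 0 <= b ->
  (a + b) `^ p <= 2 `^ p * (a `^ p + b `^ p).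
Proof.
move=> p0 a0 b0; wlog ab : a b a0 b0 / a <= b => [H|].
  have [/H|/ltW ba] := leP a b; first exact.
  by rewrite addrC [a `^ p + _]addrC; exact: H.
apply: (@le_trans _ _ ((2 * b) `^ p)).
  by apply: le_powR; [exact: ltW|exact: addr_ge0|rewrite mulr_natl mulr2n lerD2r].
by rewrite powRM// ler_wpM2l ?powR_ge0// lerDr powR_ge0.
Qed.

Lemma poweR_invr_lt p e (I : \bar R) : 0 < p -> 0 < e -> (0 <= I)%E ->
  (I `^ p^-1 < e%:E)%E <-> (I < (e `^ p)%:E)%E.
Proof.
move=> p0 e0 I0; have pV0 : 0 < p^-1 by rewrite invr_gt0.
case: I I0 => [r|_|//]; last by rewrite poweRyr ?gt_eqF//; split.
rewrite lee_fin => r0; rewrite poweR_EFin !lte_fin.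
have er : e = (e `^ p) `^ p^-1 by rewrite -powRrM mulfV ?gt_eqF// powRr1// ltW.
have rr : r = (r `^ p^-1) `^ p by rewrite -powRrM mulVf ?gt_eqF// powRr1.
split => h.
  by rewrite rr; apply: gt0_ltr_powR => //; rewrite ?nnegrE ?powR_ge0 ?ltW.
by rewrite er; apply: gt0_ltr_powR => //; rewrite ?nnegrE ?powR_ge0.
Qed.

End powers.

Section Lp_functions.
Import HBNNSimple.
Context (disp : measure_display) (T : measurableType disp) (R : realType).
Context (mu : {measure set T -> \bar R}) (D : set T) (p : R).
Hypothesis p_gt0 : 0 < p.
Implicit Types f g : T -> R.

(** A nonnegative integral is a supremum over the simple functions below the integrand, so
    monotonicity holds for arbitrary functions, measurable or not. *)
Lemma ge0_le_integral_any (f g : T -> \bar R) : (forall x, D x -> (0 <= f x)%E) ->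
  (forall x, D x -> (f x <= g x)%E) ->
  (\int[mu]_(x in D) f x <= \int[mu]_(x in D) g x)%E.
Proof.
move=> f0 fg; rewrite !ge0_integralE//; last first.
  by move=> x Dx; apply: le_trans (fg _ Dx); exact: f0.
apply: ereal_sup_le => _ [h hf <-]; exists h => // x; apply: le_trans (hf x) _; rewrite !patchE.
by case: ifPn => // /set_mem; exact: fg.
Qed.

Lemma measurable_powR_comp f : measurable_fun D f -> measurable_fun D (fun x => f x `^ p).
Proof. by move=> mf; exact: (measurableT_comp (measurable_powR p) mf). Qed.

Lemma Lp_on_le f g : measurable_fun D f -> (forall x, D x -> `|f x| <= `|g x|) ->
  Lp_on mu D p g -> Lp_on mu D p f.
Proof.
move=> mf fg [mg gi]; split; first exact: mf.
apply: le_lt_trans gi.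
apply: ge0_le_integral_any => x Dx; rewrite lee_fin ?powR_ge0//.
by apply: le_powR; [exact: ltW| |exact: fg].
Qed.

Lemma Lp_on_integrable f : measurable D -> Lp_on mu D p f ->
  mu.-integrable D (EFin \o (fun x => `|f x| `^ p)).
Proof.
move=> mD [mf fi]; apply/integrableP; split.
  by apply/measurable_EFinP; apply: measurable_powR_comp; exact: measurable_fun_norm.
by under eq_integral do rewrite /= ger0_norm ?powR_ge0//.
Qed.

Lemma Lp_on_add f g : measurable D -> Lp_on mu D p f -> Lp_on mu D p g ->
  Lp_on mu D p (fun x => `|f x| + `|g x|).
Proof.
move=> mD fi gi; have mf := fi.1; have mg := gi.1.
have fi' := integrableZl mD (2 `^ p) (Lp_on_integrable mD fi).
have gi' := integrableZl mD (2 `^ p) (Lp_on_integrable mD gi).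
have H := integrable_lty_norm (f := fun x => 2 `^ p * `|f x| `^ p + 2 `^ p * `|g x| `^ p)
  (integrableD mD fi' gi').
split.
  by apply: measurable_funD; exact: measurable_fun_norm.
apply: le_lt_trans H; apply: ge0_le_integral_any => x Dx; rewrite lee_fin ?powR_ge0//.
rewrite ger0_norm ?addr_ge0// [leRHS]ger0_norm -?mulrDr; first exact: powRD_le.
by rewrite mulr_ge0 ?addr_ge0 ?powR_ge0.
Qed.

End Lp_functions.

Section euclidean_norm.
Context (R : realType) (d : nat).
Implicit Types (x y : 'rV[R]_d).

Lemma dotvv_ge0 x : 0 <= dotv x x.
Proof. by apply: sumr_ge0 => i _; rewrite -expr2 sqr_ge0. Qed.

Lemma enorm_ge0 x : 0 <= enorm x.
Proof. exact: sqrtr_ge0. Qed.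

Lemma enorm_sqr x : enorm x ^+ 2 = dotv x x.
Proof. by rewrite sqr_sqrtr// dotvv_ge0. Qed.

Lemma coord_le_enorm x i : `|x 0 i| <= enorm x.
Proof.
rewrite -ler_sqr ?nnegrE ?enorm_ge0// enorm_sqr real_normK ?num_real//.
rewrite /dotv (bigD1 i)//= expr2 lerDl.
by apply: sumr_ge0 => j _; rewrite -expr2 sqr_ge0.
Qed.

Lemma enorm_le x (B : R) : 0 <= B -> (forall i, `|x 0 i| <= B) -> enorm x <= d%:R * B.
Proof.
move=> B0 xB; have dB : 0 <= d%:R * B by rewrite mulr_ge0.
rewrite -ler_sqr ?nnegrE ?enorm_ge0// enorm_sqr.
apply: (@le_trans _ _ (\sum_(i < d) B ^+ 2)).
  apply: ler_sum => i _; rewrite -expr2 -[x 0 i ^+ 2]real_normK ?num_real//.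
  by rewrite ler_sqr ?nnegrE.
rewrite sumr_const card_ord exprMn -[leLHS]mulr_natl ler_wpM2r ?sqr_ge0//.
by rewrite -natrX ler_nat; case: (d) => // n; rewrite leq_pmulr.
Qed.

Lemma enorm_continuous : continuous (fun x : 'rV[R]_d => enorm x).
Proof.
have cd : continuous (fun x : 'rV[R]_d => dotv x x).
  rewrite /dotv => x; elim: (index_enum _) => [|j s IH].
    rewrite (_ : (fun _ => _) = cst 0); first exact: cst_continuous.
    by apply/funext => y; rewrite big_nil.
  rewrite (_ : (fun _ => _) =
      ((fun y : 'rV[R]_d => y 0 j * y 0 j) \+ (fun y => \sum_(i <- s) y 0 i * y 0 i))).
    have cj := @coord_row_continuous R d j x.
    exact: (cvgD (cvgM cj cj) IH).
  by apply/funext => y; rewrite big_cons.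
move=> x; apply: (@continuous_comp _ _ _ (fun x => dotv x x) Num.sqrt); first exact: cd.
exact: sqrt_continuous.
Qed.

Lemma open_eball (r : R) : open (eball r : set 'rV[R]_d).
Proof.
have /continuousP/(_ _ (open_lt (y := r))) := enorm_continuous.
by congr open.
Qed.

End euclidean_norm.

Section weak_gradient_linear.
Context (R : realType) (d : nat).
Hypothesis d_gt0 : (0 < d)%N.
Local Notation L := (leb R d).
Local Notation T := (caratheodory_type (lebesgue_outer R d)).
Implicit Types (A U K : set 'rV[R]_d) (u w k l : 'rV[R]_d -> R)
  (g : 'rV[R]_d -> 'rV[R]_d) (a b : R).

Lemma locally_L1_comb U u w a b : locally_L1 U u -> locally_L1 U w ->
  locally_L1 U (fun x => a * u x + b * w x).
Proof.
move=> lu lw K cK KU; have mK := measurable_compact cK.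
have := integrable_comb3 mK a b 0 (lu K cK KU) (lw K cK KU) (lw K cK KU).
by congr (L.-integrable K _); apply/funext => x /=; rewrite mul0r addr0.
Qed.

Lemma weak_partial_comb i U u w k l a b : weak_partial i U u k -> weak_partial i U w l ->
  weak_partial i U (fun x => a * u x + b * w x) (fun x => a * k x + b * l x).
Proof.
move=> [lu lk uk] [lw ll wl]; split; [exact: locally_L1_comb|exact: locally_L1_comb|].
move=> phi tphi; have [sphi [A [cA AU phi0]]] := test_function_partial i tphi.
have [sphi' [A' [cA' AU' phi0']]] := tphi.
have mA := measurable_compact cA.
have mA' := measurable_compact cA'.
have := uk _ tphi; have := wl _ tphi.
have z1 (q : 'rV[R]_d -> R) x : ~ A x -> q x * partial i phi x = 0.
  by move=> /phi0 ->; rewrite mulr0.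
have z2 (q : 'rV[R]_d -> R) x : ~ A' x -> q x * phi x = 0.
  by move=> /phi0' ->; rewrite mulr0.
rewrite (Rintegral_support (z1 w) AU) (Rintegral_support (z1 u) AU).
rewrite (Rintegral_support (z2 l) AU') (Rintegral_support (z2 k) AU') => E1 E2.
rewrite (Rintegral_support (z1 (fun x => a * u x + b * w x)) AU).
rewrite (Rintegral_support (z2 (fun x => a * k x + b * l x)) AU').
have cp := differentiable_n_continuous (sphi 0%N).
have cphi := differentiable_n_continuous (sphi' 0%N).
have I1 q : locally_L1 U q -> L.-integrable A (EFin \o (fun x => q x * partial i phi x)).
  by move=> lq; apply: mul_continuous_integrable => //; exact: lq.
have I2 q : locally_L1 U q -> L.-integrable A' (EFin \o (fun x => q x * phi x)).
  by move=> lq; apply: mul_continuous_integrable => //; exact: lq.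
have := Rintegral_comb3 mA a b 0 (I1 _ lu) (I1 _ lw) (I1 _ lw).
have := Rintegral_comb3 mA' a b 0 (I2 _ lk) (I2 _ ll) (I2 _ ll).
rewrite !mul0r !addr0 E1 E2 => E3 E4.
apply: etrans (etrans _ E4) _; first by apply: eq_Rintegral => x _; ring.
rewrite !mulrN -opprD -E3; congr (- _).
by apply: eq_Rintegral => x _; ring.
Qed.

Lemma weak_gradient_comb U u w g g' a b : weak_gradient U u g -> weak_gradient U w g' ->
  weak_gradient U (fun x => a * u x + b * w x) (fun x => a *: g x + b *: g' x).
Proof.
move=> /(weak_gradientP d_gt0) ug /(weak_gradientP d_gt0) wg.
apply/(weak_gradientP d_gt0) => i.
have := weak_partial_comb a b (ug i) (wg i).
by congr weak_partial; apply/funext => x; rewrite !mxE.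
Qed.

End weak_gradient_linear.

Section measurable_enorm.
Context (R : realType) (d : nat) (disp : measure_display) (T : measurableType disp).
Context (mu : {measure set T -> \bar R}) (D : set T) (p : R).
Hypothesis mD : measurable D.
Hypothesis p_gt0 : 0 < p.
Implicit Types g : T -> 'rV[R]_d.

Lemma measurable_enorm g : (forall i, measurable_fun D (fun x => g x 0 i)) ->
  measurable_fun D (fun x => enorm (g x)).
Proof.
move=> mg; rewrite /enorm /dotv.
have msqrt : measurable_fun [set: R] (@Num.sqrt R).
  by apply: continuous_measurable_fun; exact: sqrt_continuous.
have ms : measurable_fun D (fun x => \sum_(i < d) g x 0 i * g x 0 i).
  by apply: measurable_sum => i; exact: (measurable_funM (mg i) (mg i)).
exact: (measurableT_comp msqrt ms).
Qed.

Lemma enorm_powR_le_sum (y : 'rV[R]_d) :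
  enorm y `^ p <= d%:R `^ p * \sum_(i < d) `|y 0 i| `^ p.
Proof.
(* The l^p norm of y, which dominates every coordinate. *)
pose B := (\sum_(i < d) `|y 0 i| `^ p) `^ p^-1.
have B0 : 0 <= B by exact: powR_ge0.
have sum0 : 0 <= \sum_(i < d) `|y 0 i| `^ p by apply: sumr_ge0 => i _; exact: powR_ge0.
have Bp : B `^ p = \sum_(i < d) `|y 0 i| `^ p.
  by rewrite /B -powRrM mulVf ?gt_eqF// powRr1.
rewrite -Bp -powRM//; apply: le_powR; [exact: ltW|exact: enorm_ge0|].
apply: enorm_le => // i.
rewrite -[leLHS]powRr1// -(@mulfV _ p) ?gt_eqF// powRrM.
apply: le_powR; [by rewrite invr_ge0 ltW|exact: powR_ge0|].
rewrite (bigD1 i)//= lerDl; apply: sumr_ge0 => j _; exact: powR_ge0.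
Qed.

Lemma integrable_sum_EFin (I : Type) (s : seq I) (h : I -> T -> R) :
  (forall i, mu.-integrable D (EFin \o h i)) ->
  mu.-integrable D (EFin \o (fun x => \sum_(i <- s) h i x)).
Proof.
move=> hi; elim: s => [|i s IH].
  rewrite (_ : _ \o _ = cst 0%E); first exact: integrable0.
  by apply/funext => x /=; rewrite big_nil.
rewrite (_ : _ \o _ = (fun x => (h i x)%:E + (\sum_(j <- s) h j x)%:E)%E).
  exact: (integrableD mD (hi i) IH).
by apply/funext => x /=; rewrite big_cons.
Qed.

Lemma Lp_on_enorm_integrable g : (forall i, Lp_on mu D p (fun x => g x 0 i)) ->
  mu.-integrable D (EFin \o (fun x => enorm (g x) `^ p)).
Proof.
move=> gi; have mg i : measurable_fun D (fun x => g x 0 i) := (gi i).1.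
have si := integrable_sum_EFin (index_enum 'I_d) (fun i => Lp_on_integrable mD (gi i)).
apply: (integrable_le mD _ (integrableZl mD (d%:R `^ p) si)).
  exact: (measurable_powR_comp p (measurable_enorm mg)).
move=> x Dx; rewrite ger0_norm ?powR_ge0//=.
exact: le_trans (enorm_powR_le_sum _) (ler_norm _).
Qed.

End measurable_enorm.

(** f stands for F'. Of the two bounds on the Taylor remainder, the quadratic one gives smallness
    for small increments, the linear one integrability for large increments. *)
Record truncation (R : realType) (F f : R -> R) : Prop := Truncation {
  truncation0 : F 0 = 0;
  truncation_ge0_le1 : forall a, 0 <= f a <= 1;
  truncation_derivative_lip : forall a b, `|f b - f a| <= `|b - a|;
  truncation_lip : forall a b, `|F b - F a| <= `|b - a|;
  truncation_taylor1 : forall a b, `|F b - F a - f a * (b - a)| <= `|b - a|;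
  truncation_taylor2 : forall a b, `|F b - F a - f a * (b - a)| <= (b - a) ^+ 2 }.

Lemma quarters_lt (R : realType) (s : R) : 0 < s -> s / 4 + s / 4 < s.
Proof. lra. Qed.

Section truncation_sobolev.
Context (R : realType) (d : nat).
Hypothesis d_gt0 : (0 < d)%N.
Context (F f : R -> R).
Hypothesis Ff : truncation F f.
Local Notation L := (leb R d).
Local Notation T := (caratheodory_type (lebesgue_outer R d)).
Implicit Types (c x : 'rV[R]_d) (A U K : set 'rV[R]_d) (u v w : 'rV[R]_d -> R)
  (g : 'rV[R]_d -> 'rV[R]_d) (p : R).

Let F_lip := truncation_lip Ff.
Let F0 := truncation0 Ff.
Let F_cont : continuous F := lipschitz_continuous F_lip.
Let f_cont : continuous f := lipschitz_continuous (truncation_derivative_lip Ff).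

Let f_le1 a : `|f a| <= 1.
Proof. by have /andP[? ?] := truncation_ge0_le1 Ff a; rewrite ger0_norm. Qed.

Lemma truncation_weak_gradient U u g : open U -> weak_gradient U u g ->
  weak_gradient U (F \o u) (fun x => f (u x) *: g x).
Proof.
move=> oU /(weak_gradientP d_gt0) ug; apply/(weak_gradientP d_gt0) => i.
have := chain_rule d_gt0 F_lip f_cont f_le1 (truncation_taylor1 Ff)
  (truncation_taylor2 Ff) F0 oU (ug i).
by congr weak_partial; apply/funext => x; rewrite mxE.
Qed.

Lemma measurable_truncation_comp (disp : measure_display) (X : measurableType disp)
    (D : set X) (t : X -> R) : measurable_fun D t -> measurable_fun D (F \o t).
Proof. by move=> mt; exact: (measurableT_comp (continuous_measurable_fun F_cont) mt). Qed.

Lemma measurable_truncation_der_comp (disp : measure_display) (X : measurableType disp)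
    (D : set X) (t : X -> R) : measurable_fun D t -> measurable_fun D (f \o t).
Proof. by move=> mt; exact: (measurableT_comp (continuous_measurable_fun f_cont) mt). Qed.

Lemma truncation_Lp (disp : measure_display) (X : measurableType disp)
    (mu : {measure set X -> \bar R}) (D : set X) p (t : X -> R) : 0 < p ->
  Lp_on mu D p t -> Lp_on mu D p (F \o t).
Proof.
move=> p0 ti; apply: (Lp_on_le p0 _ _ ti) => [|x _]; last exact: (F_le F_lip F0).
by apply: measurable_truncation_comp; case: ti.
Qed.

Lemma truncation_sobolev_with p U u g : 0 < p -> open U -> sobolev_with p U u g ->
  sobolev_with p U (F \o u) (fun x => f (u x) *: g x).
Proof.
move=> p0 oU [ug ui gi]; split; [exact: truncation_weak_gradient| |move=> i].
  exact: truncation_Lp.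
apply: (Lp_on_le p0 _ _ (gi i)) => [|x _]; last first.
  by rewrite mxE normrM ler_piMl.
rewrite (_ : (fun _ => _) = (fun x => f (u x) * g x 0 i)); last first.
  by apply/funext => x; rewrite mxE.
apply: measurable_funM; last by case: (gi i).
by apply: measurable_truncation_der_comp; case: ui.
Qed.

Lemma truncation_V1p p Omega r0 u : 0 < p -> open Omega ->
  V1p p Omega r0 u -> V1p p Omega r0 (F \o u).
Proof.
move=> p0 oO [ul ur]; split.
  move=> U oU cU UO; have [g ug] := ul U oU cU UO.
  by exists (fun x => f (u x) *: g x); exact: truncation_sobolev_with.
move=> r r0r; have [g ug] := ur r r0r.
exists (fun x => f (u x) *: g x); apply: truncation_sobolev_with => //.
by apply: openI => //; exact: open_eball.
Qed.

(* a = u, b = v, y = grad (u - v) and z = grad v. The term (f(u) - f(v)) grad v is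
   bounded by M |u - v|^p where |grad v|^p <= M, and by the excess X elsewhere. *)
Lemma truncation_pointwise p (a b : R) (y z : 'rV[R]_d) (M X : R) : 0 < p ->
  0 <= M -> 0 <= X -> enorm z `^ p <= M + X ->
  `|F a - F b| `^ p + enorm (f a *: (y + z) - f b *: z) `^ p <=
  (1 + (d%:R `^ p * 2 `^ p) * M + (d%:R `^ p * 2 `^ p)) *
    (`|a - b| `^ p + enorm y `^ p) + (d%:R `^ p * 2 `^ p) * X.
Proof.
move=> p0 M0 X0 zMX; set C : R := d%:R `^ p * 2 `^ p.
have C0 : 0 <= C by rewrite mulr_ge0 ?powR_ge0.
set del := `|f a - f b|.
have del1 : del <= 1 by exact: (normB_le1 (truncation_ge0_le1 Ff _) (truncation_ge0_le1 Ff _)).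
have del0 : 0 <= del by exact: normr_ge0.
have delab : del <= `|a - b| by exact: (truncation_derivative_lip Ff).
have hF : `|F a - F b| `^ p <= `|a - b| `^ p.
  by apply: le_powR; [exact: ltW|exact: normr_ge0|exact: F_lip].
(* The vector is f(a) y + (f(a) - f(b)) z, estimated coordinate by coordinate; this is the origin of
   the factor d. *)
have hG : enorm (f a *: (y + z) - f b *: z) <= d%:R * (enorm y + del * enorm z).
  apply: enorm_le => [|i].
    by rewrite addr_ge0 ?mulr_ge0 ?enorm_ge0.
  have -> : (f a *: (y + z) - f b *: z) 0 i = f a * y 0 i + (f a - f b) * z 0 i.
    by rewrite !mxE; ring.
  apply: le_trans (ler_normD _ _) _; rewrite !normrM; apply: lerD.
    by apply: le_trans (coord_le_enorm y i); apply: ler_piMl.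
  by apply: ler_wpM2l => //; exact: coord_le_enorm.
have dp0 : 0 <= del `^ p by exact: powR_ge0.
have dp1 : del `^ p <= 1 by have := le_powR (ltW p0) del0 del1; rewrite powR1.
have dpab : del `^ p <= `|a - b| `^ p by apply: le_powR => //; exact: ltW.
have hGp : enorm (f a *: (y + z) - f b *: z) `^ p <=
    C * (enorm y `^ p + del `^ p * enorm z `^ p).
  apply: le_trans (le_powR (ltW p0) (enorm_ge0 _) hG) _.
  rewrite powRM ?addr_ge0 ?mulr_ge0 ?enorm_ge0// /C -mulrA ler_wpM2l ?powR_ge0//.
  by rewrite -powRM ?enorm_ge0//; apply: powRD_le; rewrite ?mulr_ge0 ?enorm_ge0.
(* The Lipschitz bound on f is spent on the part below M, the bound [del] <= 1 on the excess. *)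
have hz : del `^ p * enorm z `^ p <= M * `|a - b| `^ p + X.
  apply: (@le_trans _ _ (del `^ p * (M + X))); first exact: ler_wpM2l.
  rewrite mulrDr; apply: lerD; first by rewrite mulrC ler_wpM2l.
  exact: ler_piMl.
have Y0 : 0 <= enorm y `^ p by exact: powR_ge0.
have P0 : 0 <= `|a - b| `^ p by exact: powR_ge0.
apply: le_trans (lerD hF (le_trans hGp (ler_wpM2l C0 (lerD (lexx _) hz)))) _.
move: (enorm y `^ p) (`|a - b| `^ p) Y0 P0 => Y P Y0 P0.
have -> : (1 + C * M + C) * (P + Y) + C * X =
  P + C * (Y + (M * P + X)) + (Y + C * M * Y + C * P) by ring.
by rewrite lerDl !addr_ge0 ?mulr_ge0.
Qed.

(** Continuity of u |-> F(u) at v. It is not uniform: eta depends on v through the level M at which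
    the excess of |grad v|^p becomes small. *)
Lemma truncation_close p U v g : 0 < p -> open U -> sobolev_with p U v g ->
  forall e : R, 0 < e -> exists2 eta : R, 0 < eta & forall u,
    sobolev_close p U u v eta -> sobolev_close p U (F \o u) (F \o v) e.
Proof.
move=> p0 oU vg e e0; have [wvg vi gi] := vg.
have mU : measurable (U : set T) by exact: measurable_open.
have Gi := Lp_on_enorm_integrable mU p0 gi.
pose C : R := d%:R `^ p * 2 `^ p.
have C0 : 0 <= C by rewrite mulr_ge0 ?powR_ge0.
have ep0 : 0 < e `^ p by exact: powR_gt0.
have z0 : 0 < e `^ p / (4 * (C + 1)) by rewrite divr_gt0// mulr_gt0// ltr_wpDl.
have [M M0 HM] := excess_small mU Gi z0.
pose A : R := 1 + C * M + C.
have A0 : 0 < A by rewrite /A -addrA ltr_pwDl// addr_ge0// mulr_ge0.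
(* A eta^p = e^p/4, and the excess contributes at most another e^p/4, so the total stays strictly
   below e^p. *)
pose eta : R := (e `^ p / (4 * A)) `^ p^-1.
have eA0 : 0 < e `^ p / (4 * A) by rewrite divr_gt0// mulr_gt0.
exists eta; first exact: powR_gt0.
have etap : eta `^ p = e `^ p / (4 * A).
  by rewrite /eta -powRrM mulVf ?gt_eqF// powRr1// ltW.
move=> u [h [[wuh ui hi]]] close.
set J := (\int[L]_(x in U) _)%E in close.
have J0 : (0 <= J)%E.
  by apply: integral_ge0 => x _; rewrite lee_fin addr_ge0 ?powR_ge0.
have eta0 : 0 < eta by exact: powR_gt0.
have {close} Jlt := (poweR_invr_lt p0 eta0 J0).1 close.
rewrite etap in Jlt.
(* Closeness provides only the gradient h of u - v; the gradient of u is recovered by adding that of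
   v. *)
have wu : weak_gradient U u (fun x => h x + g x).
  have := weak_gradient_comb d_gt0 1 1 wuh wvg.
  congr weak_gradient; apply/funext => x; first by rewrite !mul1r subrK.
  by rewrite !scale1r.
have mv : @measurable_fun _ _ T _ U v by case: vi.
have mu : @measurable_fun _ _ T _ U u.
  have := measurable_funD ui.1 mv.
  by congr (@measurable_fun _ _ T _ U _); apply/funext => x; rewrite /= subrK.
have wFu := truncation_weak_gradient oU wu; have wFv := truncation_weak_gradient oU wvg.
pose G x := f (u x) *: (h x + g x) - f (v x) *: g x.
have GE x i : G x 0 i = f (u x) * h x 0 i + (f (u x) - f (v x)) * g x 0 i.
  by rewrite /G !mxE; ring.
have fuv1 x : `|f (u x) - f (v x)| <= 1.
  exact: normB_le1 (truncation_ge0_le1 Ff _) (truncation_ge0_le1 Ff _).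
have mfu := measurable_truncation_der_comp mu.
have mfv := measurable_truncation_der_comp mv.
have mh i : @measurable_fun _ _ T _ U (fun x => h x 0 i) := (hi i).1.
have mg i : @measurable_fun _ _ T _ U (fun x => g x 0 i) := (gi i).1.
have mG i : @measurable_fun _ _ T _ U (fun x => G x 0 i).
  have := measurable_funD (measurable_funM mfu (mh i))
    (measurable_funM (measurable_funB mfu mfv) (mg i)).
  by congr (@measurable_fun _ _ T _ U _); apply/funext => x; rewrite GE.
exists G; split.
  split.
  - have := weak_gradient_comb d_gt0 1 (-1) wFu wFv.
    congr weak_gradient; apply/funext => x; first by rewrite mul1r mulN1r.
    by rewrite /G scale1r scaleN1r.
  - apply: (Lp_on_le p0 _ _ ui) => [|x _]; last exact: F_lip.
    exact: measurable_funB (measurable_truncation_comp mu) (measurable_truncation_comp mv).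
  - move=> i; apply: (Lp_on_le p0 (mG i) _ (Lp_on_add p0 mU (hi i) (gi i))) => x _.
    rewrite GE [leRHS]ger0_norm ?addr_ge0//.
    apply: le_trans (ler_normD _ _) _; rewrite !normrM.
    by apply: lerD; apply: ler_piMl.
pose H : T -> R := fun x => `|F (u x) - F (v x)| `^ p + enorm (G x) `^ p.
pose a : T -> R := fun x => `|u x - v x| `^ p + enorm (h x) `^ p.
pose X : T -> R := @excess _ T R (fun x => enorm (g x) `^ p) M.
have mX : @measurable_fun _ _ T _ U X.
  apply: measurable_excess; apply: measurable_powR_comp; exact: measurable_enorm mg.
have X0 x : 0 <= X x by exact: excess_ge0.
have lX x : enorm (g x) `^ p <= M + X x.
  by apply: le_trans (le_excess (fun x : T => enorm (g x) `^ p) M x); exact: ler_norm.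
have mH : @measurable_fun _ _ T _ U H.
  apply: measurable_funD; apply: measurable_powR_comp.
    by apply: measurable_fun_normB; exact: measurable_truncation_comp.
  exact: measurable_enorm mG.
have ma : @measurable_fun _ _ T _ U a.
  apply: measurable_funD; apply: measurable_powR_comp.
    exact: measurable_fun_normB mu mv.
  exact: measurable_enorm mh.
have H0 x : 0 <= H x by rewrite addr_ge0 ?powR_ge0.
have a0 x : 0 <= a x by rewrite addr_ge0 ?powR_ge0.
have HaX x : H x <= A * a x + 0 * a x + C * X x.
  have := truncation_pointwise (u x) (v x) (h x) p0 M0 (X0 x) (lX x).
  by rewrite mul0r addr0.
have Ja : (\int[L]_(x in U) (a x)%:E <= (e `^ p / (4 * A))%:E)%E by exact: (ltW Jlt).
have := ge0_integral_le_comb3 mU (ltW A0) (lexx 0) C0 mH ma ma mX H0 a0 a0 X0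
  (fun x _ => HaX x) Ja Ja HM.
move=> HJ; apply/(poweR_invr_lt p0 e0); first by apply: integral_ge0 => x _; rewrite lee_fin; exact: H0.
apply: le_lt_trans HJ _; rewrite lte_fin mul0r addr0.
have -> : A * (e `^ p / (4 * A)) = e `^ p / 4 by field; rewrite gt_eqF.
have C1 : 0 < C + 1 by rewrite ltr_wpDl.
have hC : C * (e `^ p / (4 * (C + 1))) <= e `^ p / 4.
  have -> : C * (e `^ p / (4 * (C + 1))) = e `^ p / 4 * (C / (C + 1)).
    by field; rewrite gt_eqF.
  by apply: ler_piMr; [rewrite divr_ge0// ltW|rewrite ler_pdivrMr// mul1r lerDl].
apply: le_lt_trans (lerD (lexx _) hC) _.
exact: quarters_lt.
Qed.

End truncation_sobolev.

Lemma Rintegral_ae0 (disp : measure_display) (T : measurableType disp) (R : realType)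
    (mu : {measure set T -> \bar R}) (D : set T) (f : T -> R) : measurable D ->
  measurable_fun D f -> {ae mu, forall x, D x -> f x = 0} ->
  \int[mu]_(x in D) f x = 0.
Proof.
move=> mD mf f0; rewrite /Rintegral (@ae_eq_integral _ _ _ mu D (cst 0%E) (EFin \o f)) //.
- by rewrite integral0.
- exact/measurable_EFinP.
- by apply: filterS f0 => x f0 Dx /=; rewrite f0.
Qed.

(** * Functions with zero gradient *)

Section zero_gradient.
Context (R : realType) (d : nat).
Hypothesis d_gt0 : (0 < d)%N.
Local Notation L := (leb R d).
Local Notation T := (caratheodory_type (lebesgue_outer R d)).
Implicit Types (x y z : 'rV[R]_d) (U K N : set 'rV[R]_d) (w k : 'rV[R]_d -> R) (rho s : R).

Lemma weak_partial_ae0 i U w k : weak_partial i U w k ->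
  {ae L, forall x, U x -> k x = 0} -> weak_partial i U w (cst 0).
Proof.
move=> [lw lk wk] k0; split=> // [K cK KU|phi tphi].
  have mK := measurable_compact cK.
  by rewrite (_ : _ \o _ = cst 0%E)//; exact: (integrable0 L).
rewrite wk//; have [sphi [A [cA AU phi0]]] := tphi.
have mA := measurable_compact cA.
have cphi := differentiable_n_continuous (sphi 0%N).
have z (q : 'rV[R]_d -> R) x : ~ A x -> q x * phi x = 0 by move=> /phi0 ->; rewrite mulr0.
congr (- _); rewrite (Rintegral_support (z k) AU) (Rintegral_support (z (cst 0)) AU).
have kp := mul_continuous_integrable cA (lk A cA AU) cphi.
rewrite (Rintegral_ae0 mA (integrable_measurable kp)).
  rewrite (_ : (fun x => cst 0 x * phi x) = cst 0); last by apply/funext => x; rewrite /= mul0r.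
  exact: (esym (congr1 fine (integral0 L A))).
by apply: (@filterS _ _ (ae_filter_ringOfSetsType L) _ _ _ k0) => x kx0 Ax; rewrite kx0 ?mul0r//; exact: AU.
Qed.

(** Nonempty open sets have positive measure. *)
Lemma ae_open_everywhere N (P : set 'rV[R]_d) : open N ->
  {ae L, forall x, N x -> ~ P x} -> (forall x, N x -> P x) -> N = set0.
Proof.
move=> oN [A [mA LA0 NA]] NP; apply/seteqP; split => // x Nx.
have := leb_open_gt0 d_gt0 oN (ex_intro _ x Nx); rewrite ltNge.
rewrite -LA0 => /negP []; apply: le_outer_measure => y Ny; apply: NA => /=.
by move=> /(_ Ny); apply; exact: NP.
Qed.

(** [weak_partial_shift] with g = 0 and C = 0 shows that w(y + s e) = w(y) for almost every y near
    x. Both sides are continuous in y, so a failure at x would persist on a nonempty open set. *)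
Lemma zero_weak_partial_step i U w x rho s : open U -> {within U, continuous w} ->
  weak_partial i U w (cst 0) -> 0 < rho -> thick [set x] (rho + (rho + rho)) `<=` U ->
  0 <= s <= rho -> w (x + s *: delta_mx 0 i) = w x.
Proof.
move=> oU cw wi rho0 tU /andP[s0 srho].
have [->|sn0] := eqVneq s 0; first by rewrite scale0r addr0.
have {}s0 : 0 < s by rewrite lt_neqAle eq_sym sn0.
(* Of the three margins rho, one forms the neighbourhood of x and two are those of
   [weak_partial_shift]. *)
have ttU : thick (thick [set x] rho) (rho + rho) `<=` U.
  exact: subset_trans (@thick_thick _ _ _ _ _) tU.
have K0 : compact (thick [set x] rho) by apply: compact_thick; exact: compact_set1.
have H := weak_partial_shift (C := 0) d_gt0 oU wi K0 rho0 ttU _ _.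
have srho' : 0 < s <= rho by rewrite s0.
have {}H := H s srho'.
have mK : measurable (thick [set x] rho : set T) by exact: measurable_compact.
have {}H : (\int[L]_(y in thick [set x] rho) (`|w (y + s *: delta_mx 0 i) - w y|%R)%:E <= 0)%E.
  under eq_integral do rewrite -[X in `|X|%R](subr0) -(mulr0 s).
  apply: le_trans (H _) _; last by rewrite mul0r.
  by move=> c _; under eq_integral do rewrite subrr normr0; rewrite integral0.
have cwx y : U y -> {for y, continuous w}.
  by move=> Uy; have := cw; rewrite (continuous_open_subspace w oU); apply; rewrite inE.
have tshift y : thick [set x] rho y -> U (y + s *: delta_mx 0 i).
  move=> ty; apply: tU; apply: (@le_thick _ _ _ (rho + s)).
    by rewrite lerD2l; apply: le_trans srho _; rewrite lerDl ltW.
  apply: (thick_shift ty) => j; rewrite -[leRHS](ger0_norm (ltW s0)).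
  exact: delta_shift_norm.
have tU1 y : thick [set x] rho y -> U y.
  by move=> ty; apply: tU; apply: le_thick ty; rewrite lerDl addr_ge0 ?ltW.
pose h y := w (y + s *: delta_mx 0 i) - w y.
have ch y : thick [set x] rho y -> {for y, continuous h}.
  move=> ty; apply: continuousB; last exact: (cwx _ (tU1 _ ty)).
  apply: (@continuous_comp _ _ _ (fun y => y + s *: delta_mx 0 i) w).
    exact: translate_continuous.
  exact: cwx (tshift _ ty).
apply/eqP; rewrite -subr_eq0; apply/negPn/negP => hx.
pose N := othick [set x] rho `&` [set y | h y != 0].
have oN : open N.
  rewrite openE => y [Oy hy]; apply: filterI.
    exact: (open_nbhs_nbhs (conj (open_othick (K:=_) (r:=_)) Oy)).
  have := ch y (othick_thick Oy).
  move=> /(_ [set t | t != 0]); apply.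
  by apply: open_nbhs_nbhs; split => //; exact: open_neq.
have mh : @measurable_fun _ _ T _ (thick [set x] rho) h.
  apply: (@continuous_caratheodory _ _ (lebesgue_outer R d)); first exact: measurable_open.
  by apply: continuous_in_subspaceT => y; rewrite inE; exact: ch.
have := ae0_of_integral mK mh H => /= ae0.
suff N0 : N = set0 by have : N x by [split; [exact: (sub_othick rho0 (erefl x))|exact: hx]]; rewrite N0.
apply: (@ae_open_everywhere _ [set y | h y != 0]) => // [|y []//].
apply: (@filterS _ _ (ae_filter_ringOfSetsType L) _ _ _ ae0) => y hy0 [Oy _] /=.
by rewrite hy0 ?eqxx//; exact: othick_thick.
Qed.

(** A point y near z is reached by changing one coordinate at a time, each move being an instance of
    [zero_weak_partial_step]. *)
Lemma zero_weak_gradient_near U w z : open U -> {within U, continuous w} ->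
  (forall i, weak_partial i U w (cst 0)) -> U z ->
  exists2 e : R, 0 < e & forall y, (forall i, `|z 0 i - y 0 i| < e) -> U y /\ w y = w z.
Proof.
move=> oU cw wi Uz; have zU : [set z] `<=` U by move=> _ ->.
have [r r0 rU] := thick_sub (@compact_set1 _ z) oU zU.
(* One margin contains the whole path from z to y, the other three are needed around each of its
   points. *)
pose rho := r / 4; have rho0 : 0 < rho by rewrite divr_gt0.
have rE : r = rho + (rho + (rho + rho)).
  by rewrite /rho; move: (r) => t; field.
exists rho => // y zy; split.
  apply: rU; exists z => // i; rewrite distrC; apply: ltW; apply: lt_le_trans (zy i) _.
  by rewrite rE lerDl !addr_ge0 ?ltW.
have step i s a b : thick [set z] rho a -> b = a + s *: delta_mx 0 i -> 0 <= s <= rho ->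
    w b = w a.
  move=> ta -> sr; apply: (zero_weak_partial_step oU cw (wi i) rho0) => //.
  apply: subset_trans rU; rewrite rE => q [_ -> qa].
  by apply: thick_thick; exists a.
pose a (n : nat) : 'rV[R]_d := \row_(j < d) (if (j < n)%N then y 0 j else z 0 j).
have ta (n : nat) : thick [set z] rho (a n).
  exists z => // j; rewrite mxE; case: ifP => _; last by rewrite subrr normr0 ltW.
  by rewrite distrC ltW.
have aS (n : nat) (nd : (n < d)%N) : a n.+1 =
    a n + (y 0 (Ordinal nd) - z 0 (Ordinal nd)) *: delta_mx 0 (Ordinal nd).
  apply/rowP => j; rewrite !mxE /= ltnS leq_eqVlt.
  case: (eqVneq j (Ordinal nd)) => [->|jn] /=.
    by rewrite eqxx /= ltnn mulr1 addrC subrK.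
  have -> : (nat_of_ord j == n) = false.
    by apply: contraNF jn => /eqP jn; apply/eqP/val_inj.
  by rewrite /= mulr0 addr0.
have wa (n : nat) : (n <= d)%N -> w (a n) = w z.
  elim: n => [_|n IH nd]; first by congr w; apply/rowP => j; rewrite mxE ltn0.
  rewrite -IH 1?ltnW//; set i := Ordinal nd.
  have := zy i; rewrite distrC => /ltW; have [s0|s0] := leP 0 (y 0 i - z 0 i) => sr.
    by apply: step (ta n) (aS n nd) _; rewrite s0 -(ger0_norm s0).
  (* The step is available for nonnegative increments, so a decreasing coordinate is traversed
     backwards. *)
  symmetry; apply: (step i (- (y 0 i - z 0 i)) _ _ (ta n.+1)).
    by rewrite aS scaleNr addrK.
  by rewrite -(ltr0_norm s0) normr_ge0.
rewrite -(wa d)//; congr w; apply/rowP => j; rewrite mxE ltn_ord//.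
Qed.

(** Local constancy makes the preimage in U of any set of values open, so {w = w x} is both open and
    closed in U. *)
Lemma zero_weak_gradient_constant U w x y : open U -> connected U ->
  {within U, continuous w} -> (forall i, weak_partial i U w (cst 0)) ->
  U x -> U y -> w y = w x.
Proof.
move=> oU kU cw wi Ux Uy.
have op (P : set R) : open (U `&` [set z | P (w z)]).
  apply/open_rowP => z [Uz Pz].
  have [e e0 He] := zero_weak_gradient_near oU cw wi Uz.
  by exists e => // q /He[Uq wq]; split => //=; rewrite wq.
suff E : U `&` [set z | w z = w x] = U by move: Uy; rewrite -E => -[].
apply: kU; first by exists x.
  exists (U `&` [set z | w z = w x]); first exact: (op [set t | t = w x]).
  by rewrite setIA setIid.
exists (~` (U `&` [set z | w z <> w x])).
  by apply: open_closedC; exact: (op [set t | t <> w x]).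
apply/seteqP; split => z [Uz /= wz]; split => //=; first by case.
by apply: contrapT => wzx; apply: wz.
Qed.

End zero_gradient.

(** * Hausdorff measure *)

(* Caratheodory's criterion for metric outer measures: the annuli S k.+1 `\` S k
   with k of a given parity are mutually separated, so the measures of the annuli
   are summable and X `&` S n exhausts X `&` \bigcup_n S n in measure. *)
Section caratheodory_increasing.
Local Open Scope ereal_scope.
Context (R : realType) (T : Type) (mu : {outer_measure set T -> \bar R}).
Variable S : nat -> set T.
Hypothesis S_mono : forall n, S n `<=` S n.+1.
Hypothesis S_split : forall n (A B : set T), A `<=` S n -> B `<=` ~` S n.+1 ->
  mu A + mu B <= mu (A `|` B).

Let R_ X k := X `&` (S k.+1 `\` S k).

Lemma annuli_sum_le X (o n : nat) :
  \sum_(0 <= k < n) mu (R_ X (2 * k + o).+1) <= mu (X `&` S (2 * n + o)).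
Proof.
elim: n => [|n IH]; first by rewrite big_nil outer_measure_ge0.
rewrite big_nat_recr //=; apply: le_trans (leeD IH (lexx _)) _.
apply: le_trans (S_split (n := (2 * n + o)%N) _ _) _; [by move=> x []|by move=> x [_ []]|].
rewrite (_ : (2 * n.+1 + o = (2 * n + o).+2)%N); last by rewrite mulnS.
apply: le_outer_measure => x [[Xx Sx]|[Xx [Sx _]]]; split => //.
by apply: S_mono; exact: S_mono.
Qed.

Let b_ X k := mu (R_ X (2 * k + 0).+1) + mu (R_ X (2 * k + 1).+1).

Let b_ge0 X k : 0 <= b_ X k. Proof. by rewrite adde_ge0 ?outer_measure_ge0. Qed.

Lemma annuli_series_fin X : mu X < +oo -> \sum_(0 <= k <oo) b_ X k < +oo.
Proof.
move=> muX; apply: (@le_lt_trans _ _ (mu X + mu X)); last by rewrite lte_add_pinfty.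
apply: lime_le; first by apply: is_cvg_nneseries => n _ _; exact: b_ge0.
apply: nearW => n; rewrite big_split /=; apply: leeD.
  by apply: le_trans (annuli_sum_le X 0 n) _; apply: le_outer_measure; exact: subIsetl.
by apply: le_trans (annuli_sum_le X 1 n) _; apply: le_outer_measure; exact: subIsetl.
Qed.

Lemma annuli_cover X N : X `&` \bigcup_n S n `<=`
  (X `&` S (2 * N).+1) `|`
  \bigcup_(k in ~` `I_N) (R_ X (2 * k + 0).+1 `|` R_ X (2 * k + 1).+1).
Proof.
move=> x [Xx [m _ Smx]]; have [Sx|nSx] := pselect (S (2 * N).+1 x); first by left.
right; have exS : exists n, `[< S n x >] by exists m; apply/asboolP.
have /asboolP Sn := ex_minnP exS.
case: (ex_minnP exS) => n /asboolP Sn' minn; clear Sn.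
have nlt q : (q < n)%N -> ~ S q x.
  by move=> qn /asboolP /minn; rewrite leqNgt qn.
have Nn : ((2 * N).+1 < n)%N.
  rewrite ltnNge; apply/negP => nN; apply: nSx.
  have mono (i j : nat) : (i <= j)%N -> S i `<=` S j.
    by apply: homo_leq => // [? //|A B C AB BC]; exact: subset_trans AB BC.
  exact: mono nN _ Sn'.
(* n is the first index with x in [S n], so x lies in the annulus before it. *)
have Rx : R_ X n.-1 x.
  split => //; split; first by rewrite prednK// (leq_trans _ Nn).
  by apply: nlt; rewrite prednK// (leq_trans _ Nn).
(* With k the half of n - 2 rounded down, n - 1 is 2k + 1 if n is even and 2k + 2 if n is odd; n >
   2N + 1 gives k >= N. *)
exists ((n.-2)./2).
  by rewrite /= => /=; apply/negP; rewrite -leqNgt; lia.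
have [e|e] := boolP (odd n).
  by right; move: Rx; congr (R_ X _ x); lia.
by left; move: Rx; congr (R_ X _ x); lia.
Qed.

Lemma caratheodory_increasing : caratheodory_measurable mu (\bigcup_n S n).
Proof.
apply: le_caratheodory_measurable => X.
have [muX|] := boolP (mu X < +oo); last by rewrite -leNgt => /(le_trans _); apply; exact: leey.
apply/lee_addgt0Pr => e e0.
have b0 k : xpredT k -> 0 <= b_ X k by move=> _; exact: b_ge0.
have /fine_cvgP[fb] := nneseries_tail_cvg (annuli_series_fin muX) b0.
move=> /cvgrPdist_lt /(_ e e0) near_e.
near \oo => N.
have fN : \sum_(N <= k <oo) b_ X k \is a fin_num by near: N.
have eN : \sum_(N <= k <oo) b_ X k <= e%:E.
  rewrite -(fineK fN) lee_fin; apply: le_trans (ler_norm _) _; apply: ltW.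
  by rewrite -normrN -[(- _)%R]add0r; near: N.
have step : mu (X `&` \bigcup_n S n) <= mu (X `&` S (2 * N).+1) + \sum_(N <= k <oo) b_ X k.
  apply: le_trans (le_outer_measure _ _ _ (@annuli_cover X N)) _.
  apply: le_trans (outer_measureU2 _ _ _) _; apply: leeD => //.
  apply: le_trans (outer_measure_sigma_subadditive_tail _ _ _) _.
  apply: lee_nneseries => k _ *; first exact: outer_measure_ge0.
  exact: outer_measureU2.
apply: le_trans (leeD (le_trans step (leeD (lexx _) eN)) (lexx _)) _.
rewrite addeAC; apply: leeD => //.
(* Points outside the union lie in particular outside [S (2 * N).+2], hence are separated from
   [S (2 * N).+1]. *)
apply: le_trans (S_split (n := (2 * N).+1) _ _) _; [by move=> x []| |].
  by move=> x [_ nSx] Sx; apply: nSx; exists (2 * N).+2.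
by apply: le_outer_measure => x [[]|[]].
Unshelve. all: by end_near. Qed.

End caratheodory_increasing.

Section hausdorff_metric.
Local Open Scope ereal_scope.
Context (R : realType) (d s : nat).
Implicit Types (A B C X U : set 'rV[R]_d) (e delta : R).
Local Notation H := (hausdorff_outer R d s).

Lemma diam_ge C x y : C x -> C y -> (enorm (x - y))%:E <= diam C.
Proof. by move=> Cx Cy; apply: ereal_sup_ubound; exists x => //; exists y. Qed.

Lemma le_hausdorff_cost delta delta' C : (delta <= delta')%R ->
  hausdorff_cost s delta' C <= hausdorff_cost s delta C.
Proof.
move=> dd; rewrite /hausdorff_cost; case: ifP => // _.
have [Cd|_] := boolP (diam C <= delta%:E); last exact: leey.
by rewrite ifT//; apply: le_trans Cd _; rewrite lee_fin.
Qed.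

Lemma le_hausdorff_pre delta delta' X : (delta <= delta')%R ->
  hausdorff_pre d s delta' X <= hausdorff_pre d s delta X.
Proof.
move=> dd; apply: (@covering_outer_ge _ _ (hausdorff_cost s delta)) => A XA.
apply: le_trans (@covering_outer_le _ _ (hausdorff_cost s delta') _ _ XA) _.
by apply: lee_nneseries => k _ *; [exact: hausdorff_cost_ge0|exact: le_hausdorff_cost].
Qed.

(* A set of diameter at most delta < e cannot meet both A and B. *)
Lemma hausdorff_pre_split delta e A B : (delta < e)%R ->
  (forall x y, A x -> B y -> (e <= enorm (x - y))%R) ->
  hausdorff_pre d s delta A + hausdorff_pre d s delta B <=
  hausdorff_pre d s delta (A `|` B).
Proof.
move=> de AB; pose YC Z C := if `[< C `&` Z !=set0 >] then C else set0.
have YCP Z C : Z `&` C `<=` YC Z C.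
  by move=> x [Zx Cx]; rewrite /YC asboolT//; exists x.
apply: (@covering_outer_split _ _ (hausdorff_cost s delta) _ _ _ _ _ _ (YCP A) (YCP B)).
- exact: hausdorff_cost_ge0.
- by move=> x; left.
- by move=> x; right.
move=> C; rewrite /YC.
case: asboolP => [[x [Cx Ax]]|_]; case: asboolP => [[y [Cy By]]|_];
  rewrite ?hausdorff_cost0 ?adde0 ?add0e// ?hausdorff_cost_ge0//.
rewrite {3}/hausdorff_cost ifF; last by apply/negbTE/set0P; exists x.
rewrite ifF ?leey//; apply/negbTE; rewrite -ltNge.
by apply: lt_le_trans (diam_ge Cx Cy); rewrite lte_fin (lt_le_trans de)// AB.
Qed.

(** The premeasures are additive on A and B once delta < e, and they increase as delta decreases.
    Allowing different scales for A and B lets the two suprema be taken one after the other, with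
    subtractions that are legitimate when the right-hand side is finite. *)
Lemma hausdorff_split e A B : (0 < e)%R ->
  (forall x y, A x -> B y -> (e <= enorm (x - y))%R) -> H A + H B <= H (A `|` B).
Proof.
move=> e0 AB; set c := H (A `|` B).
have pre_le (d1 d2 : R) : (0 < d1)%R -> (0 < d2)%R ->
    hausdorff_pre d s d1 A + hausdorff_pre d s d2 B <= c.
  move=> d10 d20; pose m : R := Num.min (Num.min d1 d2) (e / 2)%R.
  have m0 : (0 < m)%R by rewrite !lt_min d10 d20 divr_gt0.
  have m1 : (m <= d1)%R by rewrite !ge_min lexx.
  have m2 : (m <= d2)%R by rewrite !ge_min lexx orbT.
  have me : (m < e)%R.
    have : (m <= e / 2)%R by rewrite ge_min lexx orbT.
    by move=> /le_lt_trans; apply; move: e0; lra.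
  apply: le_trans (leeD (le_hausdorff_pre A m1) (le_hausdorff_pre B m2)) _.
  apply: le_trans (hausdorff_pre_split me AB) _.
  by apply: ereal_sup_ubound; exists m.
have [cfin|] := boolP (c \is a fin_num); last first.
  by rewrite ge0_fin_numE ?outer_measure_ge0// -leNgt => /(le_trans _); apply; exact: leey.
have preB (d2 : R) : (0 < d2)%R -> hausdorff_pre d s d2 B \is a fin_num.
  move=> d20; rewrite ge0_fin_numE ?outer_measure_ge0//.
  apply: (@le_lt_trans _ _ c); last by rewrite -ge0_fin_numE ?outer_measure_ge0.
  apply: le_trans (pre_le 1%R d2 _ d20); rewrite ?ltr01//.
  by rewrite leeDr// outer_measure_ge0.
have HAle (d2 : R) : (0 < d2)%R -> H A + hausdorff_pre d s d2 B <= c.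
  move=> d20; rewrite -leeBrDr ?preB//.
  by apply: ge_ereal_sup => _ [d1 /= d10 <-]; rewrite leeBrDr ?preB//; exact: pre_le.
have HAfin : H A \is a fin_num.
  rewrite ge0_fin_numE ?outer_measure_ge0//.
  apply: (@le_lt_trans _ _ c); last by rewrite -ge0_fin_numE ?outer_measure_ge0.
  by apply: le_trans (HAle 1%R _) => //; rewrite leeDl// outer_measure_ge0.
rewrite -leeBrDl//; apply: ge_ereal_sup => _ [d2 /= d20 <-].
by rewrite leeBrDl//; exact: HAle.
Qed.

(** U is the increasing union of the sets S n of points whose cube of radius 1/(n+1) lies in U.
    Points of S n and points outside S (n+1) are at distance at least 1/(n+1) - 1/(n+2), so
    Caratheodory's criterion applies. *)
Lemma hausdorff_measurable_open U : open U ->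
  measurable (U : set (caratheodory_type H)).
Proof.
move=> /open_rowP oU; pose S n := [set x : 'rV[R]_d |
  forall y : 'rV[R]_d, (forall i, (`|x 0 i - y 0 i| < n.+1%:R^-1)%R) -> U y].
have inv_lt n : (n.+2%:R^-1 < n.+1%:R^-1 :> R)%R by rewrite ltf_pV2 ?posrE// ltr_nat.
have -> : U = \bigcup_n S n.
  apply/seteqP; split => [x /oU[e e0 xe]|x [n _]].
    have [n ne] := ex_invS_lt e0; exists n => // y xy; apply: xe => i.
    exact: lt_trans (xy i) ne.
  by apply => i; rewrite subrr normr0 invr_gt0.
apply: caratheodory_increasing => [n x Sx y xy|n A B An Bn].
  by apply: Sx => i; exact: lt_trans (xy i) (inv_lt n).
pose e : R := (n.+1%:R^-1 - n.+2%:R^-1)%R.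
have e0 : (0 < e)%R by rewrite subr_gt0.
apply: (hausdorff_split e0) => x y Ax By; rewrite leNgt; apply/negP => xye.
apply: (Bn _ By) => z yz; apply: (An _ Ax) => i.
rewrite -[X in `|X|%R](subrKA (y 0%R i)); apply: le_lt_trans (ler_normD _ _) _.
rewrite -(subrK n.+2%:R^-1%R n.+1%:R^-1%R); apply: ltrD; last exact: yz.
by apply: le_lt_trans xye; have := coord_le_enorm (x - y)%R i; rewrite !mxE.
Qed.

Lemma hausdorff_measurable_closed C : closed C ->
  measurable (C : set (caratheodory_type H)).
Proof.
by move=> /closed_openC/hausdorff_measurable_open/measurableC; rewrite setCK.
Qed.

End hausdorff_metric.

(** * The energy argument *)

Section soft_threshold.
Context (R : realType) (eps : R).
Implicit Types a b s t : R.

(** The derivative F' of the overview. It is 1-Lipschitz and capped at 1, so that its primitive is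
    quadratic on [eps, eps + 1] and affine of slope 1 beyond. *)
Definition ramp s : R := Num.min (Num.max (s - eps) 0) 1.
(* The primitive of [ramp] that vanishes before eps. *)
Definition ramp_int s : R := ramp s * (Num.max (s - eps) 0 - ramp s / 2).

Lemma ramp_ge0_le1 s : 0 <= ramp s <= 1.
Proof. by rewrite /ramp le_min le_max lexx orbT ler01 ge_min lexx orbT. Qed.

Lemma ramp_lip a b : `|ramp b - ramp a| <= `|b - a|.
Proof.
rewrite ler_norml; have [ab|ab] := leP 0 (b - a);
  rewrite ?(ger0_norm ab) ?(ltr0_norm ab) /ramp;
  case: (leP (b - eps) 0) => ?; case: (leP (a - eps) 0) => ?;
  repeat (case: (leP _ 1) => ?); lra.
Qed.

Lemma ramp_mono a b : 0 <= (ramp b - ramp a) * (b - a).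
Proof.
have [ab|ab] := leP a b; [apply: mulr_ge0|apply: mulr_le0]; rewrite /ramp;
  case: (leP (b - eps) 0) => ?; case: (leP (a - eps) 0) => ?;
  repeat (case: (leP _ 1) => ?); lra.
Qed.

Lemma ramp_int_convex a b : 0 <= ramp_int b - ramp_int a - ramp a * (b - a).
Proof.
rewrite /ramp_int /ramp.
have -> : b - a = (b - eps) - (a - eps) by ring.
move: (a - eps) (b - eps) => {}a {}b.
case: (leP b 0) => Hb; case: (leP a 0) => Ha;
  repeat (case: (leP _ 1) => ?); have := sqr_ge0 (b - a); rewrite expr2; nra.
Qed.

(** Convexity at a makes the remainder nonnegative; convexity at b bounds it by (F'(b) - F'(a)) (b -
    a). Both Taylor bounds of [truncation] follow, since the increment of F' is at most 1 and at
    most |b - a|. *)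
Lemma ramp_int_taylor a b :
  `|ramp_int b - ramp_int a - ramp a * (b - a)| <= `|ramp b - ramp a| * `|b - a|.
Proof.
rewrite -normrM (ger0_norm (ramp_mono a b)) ger0_norm ?ramp_int_convex//.
by have := ramp_int_convex b a; lra.
Qed.

Lemma ramp_int_eps s : s <= eps -> ramp_int s = 0.
Proof.
by move=> se; rewrite /ramp_int /ramp (max_idPr _) ?subr_le0// (min_idPl _) ?ler01// mul0r.
Qed.

Lemma ramp_int_ge0 s : 0 <= ramp_int s.
Proof.
have := ramp_int_convex eps s; rewrite (ramp_int_eps (lexx eps)) subr0.
by rewrite /ramp subrr maxxx (min_idPl _) ?ler01// mul0r subr0.
Qed.

Lemma ramp_int_gt0 s : eps < s -> 0 < ramp_int s.
Proof.
rewrite -subr_gt0 /ramp_int /ramp => H; rewrite (max_idPl _) ?ltW//.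
by case: (leP _ 1) => ?; nra.
Qed.

Lemma ramp_truncation : 0 <= eps -> truncation ramp_int ramp.
Proof.
move=> eps0; split.
- exact: ramp_int_eps.
- exact: ramp_ge0_le1.
- exact: ramp_lip.
(* The supporting lines at a and at b squeeze F(b) - F(a) between F'(a) (b - a) and F'(b) (b - a),
   with slopes in [0, 1]. *)
- move=> a b; have := ramp_int_convex a b; have := ramp_int_convex b a.
  have /andP[a0 a1] := ramp_ge0_le1 a; have /andP[b0 b1] := ramp_ge0_le1 b.
  move: (ramp_int a) (ramp_int b) (ramp a) (ramp b) a0 a1 b0 b1.
  move=> A B x y x0 x1 y0 y1 H1 H2; rewrite ler_norml.
  by case: (leP 0 (b - a)) => Hab; rewrite ?(ger0_norm Hab) ?(ltr0_norm Hab); nra.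
- move=> a b; apply: le_trans (ramp_int_taylor a b) _; apply: ler_piMl => //.
  exact: (normB_le1 (ramp_ge0_le1 _) (ramp_ge0_le1 _)).
- move=> a b; apply: le_trans (ramp_int_taylor a b) _.
  by rewrite -real_normK ?num_real// expr2 ler_wpM2r// ramp_lip.
Qed.

End soft_threshold.

Section truncation_boundary.
Context (R : realType) (d : nat).
Hypothesis d_gt0 : (0 < d)%N.
Context (F f : R -> R).
Hypothesis Ff : truncation F f.
Context (p r0 : R).
Hypothesis p_gt0 : 0 < p.
Implicit Types (Omega Gamma U : set 'rV[R]_d) (u v t : 'rV[R]_d -> R).

Let F_lip := truncation_lip Ff.

Lemma sobolev_close_le U u v (e e' : R) : e <= e' ->
  sobolev_close p U u v e -> sobolev_close p U u v e'.
Proof.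
by move=> ee [g [ug lt]]; exists g; split=> //; apply: lt_le_trans lt _; rewrite lee_fin.
Qed.

Lemma truncation_close_eball Omega v : open Omega -> V1p p Omega r0 v ->
  forall r e : R, r0 < r -> 0 < e -> exists2 eta : R, 0 < eta & forall u,
    sobolev_close p (Omega `&` eball r) u v eta ->
    sobolev_close p (Omega `&` eball r) (F \o u) (F \o v) e.
Proof.
move=> oO [_ vr] r e r0r e0; have [g vg] := vr r r0r.
by apply: (truncation_close d_gt0 Ff p_gt0 _ vg) => //; apply: openI => //; exact: open_eball.
Qed.

(** As F(0) = 0, composition with F preserves vanishing near Gamma; its continuity at v carries this
    over to the closure. *)
Lemma truncation_V1p_Gamma Omega Gamma v : open Omega ->
  V1p_Gamma p Omega r0 Gamma v -> V1p_Gamma p Omega r0 Gamma (F \o v).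
Proof.
move=> oO [vV vG]; split; first exact: (truncation_V1p d_gt0 Ff p_gt0 oO vV).
move=> r e r0r e0; have [eta eta0 He] := truncation_close_eball oO vV r0r e0.
have [u [uV [N [oN GN uN]] uv]] := vG r eta r0r eta0.
exists (F \o u); split; [exact: (truncation_V1p d_gt0 Ff p_gt0 oO uV)| |exact: He].
exists N; split => //; apply: (@filterS _ _ (ae_filter_ringOfSetsType (leb R d)) _ _ _ uN) => x {}uN xN /=.
by rewrite uN// (truncation0 Ff).
Qed.

(** The functions F(u), for u approximating v, are again continuous up to the boundary, and F being
    1-Lipschitz does not increase distances in L^p of the boundary. *)
Lemma truncation_is_trace Omega v t : open Omega -> V1p p Omega r0 v ->
  is_trace p Omega r0 v t -> is_trace p Omega r0 (F \o v) (F \o t).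
Proof.
move=> oO vV [ti tv]; split; first exact: (truncation_Lp Ff p_gt0 ti).
move=> r e r0r e0; have [eta eta0 He] := truncation_close_eball oO vV r0r e0.
(* A single tolerance governs both the Sobolev distance, which needs eta, and the boundary distance,
   which needs e. *)
have m0 : 0 < Num.min eta e by rewrite lt_min eta0.
have [u [uV cu uv ut]] := tv r _ r0r m0.
exists (F \o u); split.
- exact: (truncation_V1p d_gt0 Ff p_gt0 oO uV).
- by move=> x; apply: (@continuous_comp (subspace (closure Omega)) R R u F);
    [exact: cu|exact: (lipschitz_continuous F_lip)].
- by apply: He; apply: sobolev_close_le uv; rewrite ge_min lexx.
- have ute : (\int[hausdorff R d d.-1]_(x in boundary Omega) (`|u x - t x| `^ p)%:E < e%:E)%E.
    by apply: lt_le_trans ut _; rewrite lee_fin ge_min lexx orbT.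
  apply: le_lt_trans ute; apply: ge0_le_integral_any => x _; rewrite lee_fin ?powR_ge0//.
  by apply: le_powR; [exact: ltW|exact: normr_ge0|exact: F_lip].
Qed.

End truncation_boundary.

Lemma Lp_on_subset (disp : measure_display) (T : measurableType disp) (R : realType)
    (mu : {measure set T -> \bar R}) (A B : set T) (p : R) (g : T -> R) :
  measurable A -> measurable B -> A `<=` B -> Lp_on mu B p g -> Lp_on mu A p g.
Proof.
move=> mA mB AB [mg gi]; split; first exact: measurable_funS mg.
apply: le_lt_trans gi; apply: ge0_subset_integral => //.
by apply/measurable_EFinP; apply: measurable_powR_comp; exact: measurable_fun_norm.
Qed.

Lemma Rintegral_ae_ge0 (disp : measure_display) (T : measurableType disp) (R : realType)
    (mu : {measure set T -> \bar R}) (D : set T) (g : T -> R) : measurable D ->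
  measurable_fun D g -> {ae mu, forall x, D x -> 0 <= g x} ->
  0 <= \int[mu]_(x in D) g x.
Proof.
move=> mD mg g0; rewrite /Rintegral.
rewrite (@ae_eq_integral _ _ _ mu D (fun x => (`|g x|)%:E) (fun x => (g x)%:E)) //.
- by apply: fine_ge0; apply: integral_ge0 => x _; rewrite lee_fin.
- exact/measurable_EFinP.
- by apply/measurable_EFinP; exact: measurable_fun_norm.
- by apply: filterS g0 => x g0 Dx /=; rewrite ger0_norm// g0.
Qed.

Lemma supp_eball (R : realType) (d : nat) (Omega : set 'rV[R]_d) (w : 'rV[R]_d -> R)
    (M r : R) : M < r -> (forall x, Omega x -> M < enorm x -> w x = 0) ->
  supp Omega w `<=` eball r.
Proof.
move=> Mr w0 x sx; rewrite /eball /= ltNge; apply/negP => rx.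
apply: (sx [set y | M < enorm y]).
- by have /continuousP/(_ _ (open_gt (y := M))) := @enorm_continuous R d; congr open.
- exact: lt_le_trans rx.
- by apply: aeW => y [Oy My]; exact: w0.
Qed.

Lemma exterior_unbounded (R : realType) (d : nat) (Omega : set 'rV[R]_d) (M : R) :
  (0 < d)%N -> compact (~` Omega) -> exists2 x, Omega x & M < enorm x.
Proof.
move=> d0 /compact_box[B [B0 OB]]; pose x : 'rV[R]_d := const_mx (Num.max B (M + 1)).
pose i := Ordinal d0; have xi : x 0 i = Num.max B (M + 1) by rewrite mxE.
exists x; last first.
  apply: lt_le_trans (coord_le_enorm x i); apply: lt_le_trans (ler_norm _).
  by rewrite xi lt_max ltrDl ltr01 orbT.
apply: contrapT => /OB/(_ i); rewrite xi !mxE => /andP[_].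
by rewrite ltNge le_max lexx.
Qed.

Lemma integrable_ae_eq (disp : measure_display) (T : measurableType disp) (R : realType)
    (mu : {measure set T -> \bar R}) (D : set T) (g h : T -> R) : measurable D ->
  measurable_fun D h -> {ae mu, forall x, D x -> g x = h x} ->
  mu.-integrable D (EFin \o g) -> mu.-integrable D (EFin \o h).
Proof.
move=> mD mh gh gi; have mg := integrable_measurable gi.
apply/integrableP; split; first exact/measurable_EFinP.
move/integrableP : gi => [_]; congr (_ < _)%E; apply: ae_eq_integral => //.
- by apply/measurable_EFinP; exact: measurable_fun_norm.
- by apply/measurable_EFinP; exact: measurable_fun_norm.
- by apply: filterS gh => x gh Dx /=; rewrite gh.
Qed.

Section flux.
Context (R : realType) (d : nat) (p : R).
Hypothesis d_gt0 : (0 < d)%N.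
Hypothesis p_gt0 : 0 < p.
Local Notation L := (leb R d).
Local Notation T := (caratheodory_type (lebesgue_outer R d)).
Implicit Types (z : 'rV[R]_d) (c : R).

Lemma p_fluxZ z c : p_flux p z (c *: z) = c * enorm z `^ p.
Proof.
rewrite /p_flux; have -> : dotv z (c *: z) = c * enorm z ^+ 2.
  by rewrite enorm_sqr /dotv mulr_sumr; apply: eq_bigr => i _; rewrite mxE; ring.
(* At z = 0 both sides vanish, the right one because p is not 0; elsewhere the exponents p - 2 and 2
   add up. *)
rewrite mulrCA; congr (_ * _); have [z0|z0] := eqVneq (enorm z) 0.
  by rewrite z0 expr0n mulr0 powR0// gt_eqF.
have zp : 0 < enorm z by rewrite lt_neqAle eq_sym z0 enorm_ge0.
by rewrite -powR_mulrn ?enorm_ge0// -powRD ?subrK// z0 implybT.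
Qed.

Lemma enorm_eq0 z : enorm z = 0 -> z = 0.
Proof.
move=> z0; apply/rowP => i; rewrite mxE; apply/eqP; rewrite -normr_le0 -z0.
exact: coord_le_enorm.
Qed.

(** A weak gradient is only locally integrable by definition. Membership in W^{1,p}(U) provides a
    possibly different gradient k in L^p, and uniqueness almost everywhere transfers integrability
    from k to g. *)
Lemma weak_gradient_integrable U v g : open U -> sobolev p U v -> weak_gradient U v g ->
  L.-integrable U (EFin \o (fun x => enorm (g x) `^ p)).
Proof.
move=> oU [k [vk _ ki]] vg; have mU : measurable (U : set T) by exact: measurable_open.
have Ik := Lp_on_enorm_integrable mU p_gt0 ki.
have mg i : @measurable_fun _ _ T _ U (fun x => g x 0 i).
  apply: measurable_open_of_compact => // K cK KU; have [_ lg _] := vg.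
  exact: integrable_measurable (lg i K cK KU).
have kg : {ae L, forall x, U x -> enorm (k x) `^ p = enorm (g x) `^ p}.
  have : {ae L, forall x, forall i : 'I_d, U x -> k x 0 i = g x 0 i}.
    apply: (@filter_forall _ _ _ _ (ae_filter_ringOfSetsType L)) => i.
    apply: ae_open_of_compact => // K cK KU.
    exact: (weak_partial_unique d_gt0 oU ((weak_gradientP d_gt0 _ _ _).1 vk i)
      ((weak_gradientP d_gt0 _ _ _).1 vg i) cK KU).
  apply: (@filterS _ _ (ae_filter_ringOfSetsType L)) => x kg Ux.
  by congr (enorm _ `^ _); apply/rowP => i; exact: kg.
apply: integrable_ae_eq mU _ kg Ik.
exact: (measurable_powR_comp p (measurable_enorm mg)).
Qed.

End flux.

Section vanishing_flux.
Context (R : realType) (d : nat) (p : R).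
Hypothesis d_gt0 : (0 < d)%N.
Hypothesis p_gt0 : 0 < p.
Local Notation L := (leb R d).
Local Notation T := (caratheodory_type (lebesgue_outer R d)).
Implicit Types (U W : set 'rV[R]_d) (v c : 'rV[R]_d -> R) (g : 'rV[R]_d -> 'rV[R]_d).

(** The flux is c |g|^p >= 0. Finite energy is known on W alone, typically Omega cut by a ball, and
    c vanishes on the rest of U. *)
Lemma vanishing_flux U W v g c : open U -> open W -> W `<=` U -> sobolev p W v ->
  weak_gradient U v g -> @measurable_fun _ _ T _ W c -> (forall x, 0 <= c x <= 1) ->
  (forall x, U x -> ~ W x -> c x = 0) ->
  \int[L]_(x in U) p_flux p (g x) (c x *: g x) <= 0 ->
  {ae L, forall x, U x -> c x *: g x = 0}.
Proof.
move=> oU oW WU vW vg mc c01 c0.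
have mW : measurable (W : set T) by exact: measurable_open.
(* Integrability is essential: a real-valued integral that diverges has the default value 0, and its
   being nonpositive would say nothing. *)
have gW := weak_gradient_integrable d_gt0 p_gt0 oW vW (weak_gradientS d_gt0 WU vg).
pose q x := c x * enorm (g x) `^ p.
have q0 x : 0 <= q x by have /andP[? _] := c01 x; rewrite mulr_ge0 ?powR_ge0.
have mq : @measurable_fun _ _ T _ W q.
  exact: (measurable_funM mc (integrable_measurable gW)).
have qW : L.-integrable W (EFin \o q).
  apply: (integrable_le mW mq gW) => x Wx; rewrite normrM ler_piMl//.
  by have /andP[? ?] := c01 x; rewrite ger0_norm.
pose q' x := if `[< W x >] then q x else 0.
have -> : \int[L]_(x in U) p_flux p (g x) (c x *: g x) = \int[L]_(x in W) q x.
  transitivity (\int[L]_(x in U) q' x).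
    apply: eq_Rintegral => x /set_mem Ux; rewrite p_fluxZ// /q' /q.
    by case: asboolP => // /(c0 x Ux) ->; rewrite mul0r.
  rewrite (@Rintegral_support _ _ W U q' _ WU).
    by apply: eq_Rintegral => x /set_mem Wx; rewrite /q' asboolT.
  by move=> x nW; rewrite /q' asboolF.
move=> q_le0.
have : (\int[L]_(x in W) (`|q x|%R)%:E <= 0)%E.
  under eq_integral do rewrite ger0_norm//.
  by rewrite integral_Rintegral// lee_fin.
move=> /(ae0_of_integral mW mq).
apply: (@filterS _ _ (ae_filter_ringOfSetsType L)) => x qx Ux.
have [Wx|nW] := pselect (W x); last by rewrite c0// scale0r.
have /eqP := qx Wx; rewrite /q mulf_eq0 => /orP[/eqP->|]; first by rewrite scale0r.
by rewrite powR_eq0 => /andP[/eqP/enorm_eq0-> _]; rewrite scaler0.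
Qed.

End vanishing_flux.

(** The product h(x, t) F(t) is nonnegative whatever the sign of t: F(t) = 0 for t <= 0, and for t >
    0 the condition h(x, t) t >= 0 gives h(x, t) >= 0. Measurability of Gamma2 comes from its being
    the closed boundary minus the closed Gamma1. *)
Lemma boundary_energy_ge0 (R : realType) (d : nat) (p : R) (Omega Gamma1 Gamma2 : set 'rV[R]_d)
    (h : 'rV[R]_d -> R -> R) (t : 'rV[R]_d -> R) (F : R -> R) :
  Gamma1 `|` Gamma2 = boundary Omega -> Gamma1 `&` Gamma2 = set0 -> closed Gamma1 ->
  open Omega -> continuous F -> (forall s, 0 <= F s) -> (forall s, s <= 0 -> F s = 0) ->
  (forall w : 'rV[R]_d -> R, Lp_on (hausdorff R d d.-1) Gamma2 p w ->
    Lp_on (hausdorff R d d.-1) Gamma2 (p / (p - 1)) (fun x => h x (w x)) /\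
    {ae hausdorff R d d.-1, forall x, Gamma2 x -> 0 <= h x (w x) * w x}) ->
  Lp_on (hausdorff R d d.-1) (boundary Omega) p t ->
  0 <= \int[hausdorff R d d.-1]_(x in Gamma2) (h x (t x) * F (t x)).
Proof.
move=> G12 G0 cG1 oO Fc F0 Fneg hw ti.
set H := hausdorff R d d.-1.
have mB : measurable (boundary Omega : set (caratheodory_type (hausdorff_outer R d d.-1))).
  apply: hausdorff_measurable_closed; rewrite /boundary setDE.
  by apply: closedI; [exact: closed_closure|apply: open_closedC; exact: open_interior].
have G2E : Gamma2 = boundary Omega `\` Gamma1.
  rewrite -G12; apply/seteqP; split => [x G2x|x [[]]//]; split; first by right.
  by move=> G1x; have : (Gamma1 `&` Gamma2) x by []; rewrite G0.
have mG : measurable (Gamma2 : set (caratheodory_type (hausdorff_outer R d d.-1))).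
  by rewrite G2E; apply: measurableD => //; exact: hausdorff_measurable_closed.
have ti2 : Lp_on H Gamma2 p t.
  by apply: Lp_on_subset mG mB _ ti; rewrite G2E; exact: subDsetl.
have [[mh _] hpos] := hw t ti2.
apply: Rintegral_ae_ge0 mG _ _.
  apply: measurable_funM mh _.
  exact: (measurableT_comp (continuous_measurable_fun Fc) ti2.1).
apply: (@filterS _ _ (ae_filter_ringOfSetsType H) _ _ _ hpos) => x hx G2x.
have [t0|t0] := leP (t x) 0; first by rewrite Fneg// mulr0.
by apply: mulr_ge0 => //; rewrite -(pmulr_lge0 _ t0) hx.
Qed.

Theorem theorem1p1 (R : realType) (d : nat) (Omega : set 'rV[R]_d)
    (Gamma1 Gamma2 : set 'rV[R]_d) (p r0 : R) (h : 'rV[R]_d -> R -> R)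
    (v : 'rV[R]_d -> R) :
  (2 <= d)%N ->
  exterior_domain Omega ->
  lipschitz_boundary Omega ->
  1 < p ->
  0 < r0 ->
  (forall r, r0 <= r -> boundary Omega `<=` eball r) ->
  Gamma1 `|` Gamma2 = boundary Omega ->
  Gamma1 `&` Gamma2 = set0 ->
  closed Gamma1 ->
  caratheodory_function Gamma2 h ->
  (forall w : 'rV[R]_d -> R, Lp_on (hausdorff R d d.-1) Gamma2 p w ->
    Lp_on (hausdorff R d d.-1) Gamma2 (p / (p - 1)) (fun x => h x (w x)) /\
    {ae hausdorff R d d.-1, forall x, Gamma2 x -> 0 <= h x (w x) * w x}) ->
  weak_solution p Omega r0 Gamma1 Gamma2 h v ->
  {within Omega, continuous v} ->
  (forall x, Omega x -> 0 <= v x) ->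
  tends_to_0_at_infinity Omega v ->
  forall x, Omega x -> v x = 0.
Proof.
move=> d2 [oO kO cO _] _ p1 _ _ G12 G0 cG1 _ hw [vG [gv [tv [vg vt test]]]] cv v0 vinf.
have d0 : (0 < d)%N by exact: ltnW.
have p0 : 0 < p by exact: lt_trans p1.
have vV : V1p p Omega r0 v by case: vG.
suff le_eps (eps : R) : 0 < eps -> forall x, Omega x -> v x <= eps.
  move=> x Ox; apply/eqP; rewrite eq_le v0// andbT.
  by apply/ler_addgt0Pr => e e0; rewrite add0r; exact: le_eps.
move=> eps0; have [M HM] := vinf eps eps0.
have Ff := ramp_truncation (ltW eps0).
pose F := ramp_int eps; pose f := ramp eps; pose phi := F \o v.
have f0 s : s <= eps -> f s = 0.
  by move=> se; rewrite /f /ramp (max_idPr _) ?subr_le0// (min_idPl _) ?ler01.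
have v_le x : Omega x -> M < enorm x -> v x <= eps.
  by move=> Ox Mx; apply: le_trans (ler_norm _) (ltW _); exact: HM.
have phi_far x : Omega x -> M < enorm x -> phi x = 0.
  by move=> Ox Mx; apply: ramp_int_eps; exact: v_le.
(* Beyond M one has v <= eps, so F(v) and F'(v) vanish outside this ball. *)
pose r := Num.max r0 M + 1.
have r0r : r0 < r by rewrite ltr_pwDr// le_max lexx.
have Mr : M < r by rewrite ltr_pwDr// le_max lexx orbT.
have phig := truncation_weak_gradient d0 Ff oO vg.
have oW : open (Omega `&` eball r) by apply: openI => //; exact: open_eball.
have Fc := lipschitz_continuous (truncation_lip Ff).
have fc := lipschitz_continuous (truncation_derivative_lip Ff).
have vm (U : set 'rV[R]_d) : open U -> U `<=` Omega ->
    @measurable_fun _ _ (caratheodory_type (lebesgue_outer R d)) _ U v.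
  move=> oU UO; apply: (@continuous_caratheodory _ _ (lebesgue_outer R d)).
    exact: measurable_open.
  exact: continuous_subspaceW UO cv.
have := test phi _ (F \o tv) (truncation_V1p_Gamma d0 Ff p0 oO vG)
  (ex_intro _ r (conj r0r (supp_eball Mr phi_far))) phig
  (truncation_is_trace d0 Ff p0 oO vV vt).
have bd : 0 <= \int[hausdorff R d d.-1]_(x in Gamma2) (h x (tv x) * F (tv x)).
  apply: (boundary_energy_ge0 G12 G0 cG1 oO Fc _ _ hw vt.1) => s.
    exact: ramp_int_ge0.
  by move=> s0; apply: ramp_int_eps; apply: le_trans s0 (ltW eps0).
(* The flux integral equals minus a nonnegative boundary term, hence is nonpositive. *)
move=> /eqP; rewrite addr_eq0 => /eqP flux.
have fg0 : {ae leb R d, forall x, Omega x -> f (v x) *: gv x = 0}.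
  apply: (vanishing_flux d0 p0 oO oW _ (vV.2 r r0r) vg (c := f \o v)).
  - exact: subIsetl.
  - by apply: (measurableT_comp (continuous_measurable_fun fc)); apply: vm => //; exact: subIsetl.
  - by move=> x; exact: ramp_ge0_le1.
  - move=> x Ox nW; apply: f0; apply: v_le => //; apply: lt_le_trans Mr _.
    by rewrite leNgt; apply/negP => xr; apply: nW.
  - by rewrite flux oppr_le0.
have phi_cst x y : Omega x -> Omega y -> phi y = phi x.
  apply: (zero_weak_gradient_constant d0 oO kO).
    move=> z; apply: (@continuous_comp (subspace Omega) R R v F); [exact: cv|exact: Fc].
  move=> i; apply: (weak_partial_ae0 ((weak_gradientP d0 _ _ _).1 phig i)).
  apply: (@filterS _ _ (ae_filter_ringOfSetsType (leb R d)) _ _ _ fg0) => z fg Oz.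
  by rewrite fg// mxE.
(* The constant value of [phi] is read off at a far point y, where it is 0; v x > eps would make
   [phi x] positive. *)
move=> x Ox; have [y Oy My] := exterior_unbounded M d0 cO.
rewrite leNgt; apply/negP => /ramp_int_gt0.
by rewrite -/F -[F (v x)]/(phi x) (phi_cst y x Oy Ox) phi_far// ltxx.
Qed.
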